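(* Let $\alpha,\beta,\gamma>0$, $\delta\in\mathbb N$ ($\delta\ge 1$), $0<b<c<1$, $\omega=(b,c)$, and let $T>0$. Then the internally controlled generalized Burgers--Huxley system $$\begin{cases}u_t=u_{xx}-\alpha u^\delta u_x+\beta u(1-u^\delta)(u^\delta-\gamma)+\chi_\omega f & \text{in }(0,T)\times(0,1),\\ u(t,0)=u(t,1)=0, & t\in(0,T),\\ u(0,x)=u_0(x), & x\in(0,1),\end{cases}$$ is not approximately controllable (in time $T$) in $L^2(0,1)$ with respect to the set of controls $f\in L^2((0,T)\times(0,1))$.
   Context: $\chi_\omega$ is the characteristic function of $\omega$. Approximate controllability: the system is said to be approximately controllable in time $T$ in $L^2(0,1)$ if, for every $u_0,u_T\in L^2(0,1)$ and every $\epsilon>0$, there exists a control $f\in L^2((0,T)\times(0,1))$ such that the corresponding solution $u$ of the system with initial datum $u_0$ satisfies $\|u(T)-u_T\|_{L^2(0,1)}\le\epsilon$. Solutions for $L^2$ data are weak solutions: for $u_0\in L^2(0,1)$ and $f\in L^2(0,T;L^2(0,1))$, a weak solution of the system is a function $u\in L^\infty(0,T;L^2(0,1))\cap L^2(0,T;H_0^1(0,1))\cap L^{2(\delta+1)}(0,T;L^{2(\delta+1)}(0,1))$ with $u_t\in L^{1+\frac1{2\delta-1}}(0,T;H^{-1}(0,1))$, such that for all $\varphi\in H_0^1(0,1)$ and a.e. $t\in(0,T)$ $$\langle u_t,\varphi\rangle+\int_0^1u_x\varphi_x\,dx+\alpha\int_0^1u^\delta u_x\varphi\,dx=\beta\int_0^1u(1-u^\delta)(u^\delta-\gamma)\varphi\,dx+\int_0^1\chi_\omega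 f\varphi\,dx,$$ and $u(0)=u_0$ in the sense that, for the weakly continuous representative of $u$, $\lim_{t\to0^+}\int_0^1u(t,x)\varphi(x)\,dx=\int_0^1u_0\varphi\,dx$ for all $\varphi\in H_0^1(0,1)$. (Here $\langle\cdot,\cdot\rangle$ is the duality pairing between $H^{-1}(0,1)$ and $H_0^1(0,1)$.) *)

(* Defs.v *)
From HB Require Import structures.
From mathcomp Require Import all_boot all_order all_algebra.
From mathcomp Require Import all_classical all_reals all_analysis.
Set Implicit Arguments.
Unset Strict Implicit.
Unset Printing Implicit Defensive.
Import Order.TTheory GRing.Theory Num.Theory.
Import numFieldNormedType.Exports.
Local Open Scope ring_scope.
Local Open Scope classical_set_scope.

Lemma lebesgue_itvoo_lty (R : realType) (a b : R) :
  (@lebesgue_measure R `]a, b[%classic < +oo)%E.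
Proof. by rewrite lebesgue_measure_itv /=; case: ifP; rewrite ?ltry. Qed.

(* Lebesgue measure on the open interval (a, b), as a finite measure on the
   Borel sets of R.  With respect to it, an element of L^p(a, b) is represented
   by a Borel function on R whose values outside (a, b) are irrelevant. *)
Definition leb (R : realType) (a b : R) :
    {finite_measure set (measurableTypeR R) -> \bar R} :=
  @mfrestr _ (measurableTypeR R) R `]a, b[%classic lebesgue_measure
    (measurable_itv `]a, b[%R) (lebesgue_itvoo_lty a b).

Section spaces.
Context {R : realType}.
Implicit Types (a b t : R) (u v : R -> R -> R) (phi dphi psi theta : R -> R).

Local Notation I := (leb (0 : R) 1).

Definition L2norm phi : \bar R := 'N[I]_2%:E [EFin \o phi].

Definition L2 : set (R -> R) := [set phi | phi \in Lfun I 2%:E].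

(* C_c^oo(a, b) *)
Definition test_function a b : set (R -> R) := [set theta : R -> R |
  [/\ forall n x, derivable (derive1n n theta) x 1,
      compact (closure [set x | theta x != 0])
    & closure [set x | theta x != 0] `<=` `]a, b[ ]].

Definition weak_derivative phi dphi : Prop :=
  forall theta, test_function 0 1 theta ->
    \int[I]_x (phi x * derive1 theta x) = - \int[I]_x (dphi x * theta x).

(* [H10 phi dphi]: phi is in H^1_0(0, 1), the closure of C_c^oo(0, 1) in
   H^1(0, 1), and dphi is (a representative of) its weak derivative. *)
Definition H10 phi dphi : Prop :=
  [/\ L2 phi, L2 dphi, weak_derivative phi dphi &
      forall e : R, 0 < e -> exists theta,
        [/\ test_function 0 1 theta,
            (L2norm (phi \- theta)%R <= e%:E)%E
          & (L2norm (dphi \- derive1 theta)%R <= e%:E)%E]].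

(* Dual norm on H^{-1}(0, 1), for the norm of the weak derivative in L^2 on
   H^1_0(0, 1). *)
Definition Hm1norm (w : (R -> R) -> R) : \bar R :=
  ereal_sup [set `|w phi|%:E | phi in
    [set phi | exists2 dphi, H10 phi dphi & (L2norm dphi <= 1)%E]].

(* A functional is given on functions, not on classes; linearity and a finite
   dual norm force equal values on a.e. equal elements of H^1_0(0, 1).  Its
   values outside H^1_0(0, 1) are irrelevant. *)
Definition Hm1 (w : (R -> R) -> R) : Prop :=
  (forall (k : R) phi dphi psi dpsi, H10 phi dphi -> H10 psi dpsi ->
     w (fun x => k * phi x + psi x) = k * w phi + w psi) /\
  (Hm1norm w < +oo)%E.

(* L^q(0, T; L^p(0, 1)).  As L^p(0, 1) is separable for finite p, strongly
   measurable functions of time with values in it are those given by jointly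
   measurable functions of (t, x). *)
Definition LqLp (T : R) (q p : \bar R) u : Prop :=
  measurable_fun [set: R * R]
    (fun z => u z.1 z.2) /\
  ('N[leb 0 T]_q [(fun t => 'N[I]_p [EFin \o u t])] < +oo)%E.

(* L^q(0, T; H^1_0(0, 1)), where [ux t] is the weak derivative of [u t]. *)
Definition LqH10 (T : R) (q : \bar R) u ux : Prop :=
  [/\ LqLp T q 2%:E u, LqLp T q 2%:E ux &
      \forall t \ae leb 0 T, H10 (u t) (ux t)].

(* L^q(0, T; H^{-1}(0, 1)): by separability, strong measurability is weak
   measurability. *)
Definition LqHm1 (T : R) (q : \bar R) (w : R -> (R -> R) -> R) : Prop :=
  [/\ forall phi dphi, H10 phi dphi ->
        measurable_fun [set: R] (fun t => w t phi),
      \forall t \ae leb 0 T, Hm1 (w t) &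
      ('N[leb 0 T]_q [(fun t => Hm1norm (w t))] < +oo)%E].

(* [ut] is the derivative of [u] in the sense of H^{-1}(0, 1)-valued
   distributions on (0, T), L^2(0, 1) being embedded in H^{-1}(0, 1) by the
   inner product of L^2(0, 1). *)
Definition time_derivative (T : R) u (ut : R -> (R -> R) -> R) : Prop :=
  forall theta phi dphi, test_function 0 T theta -> H10 phi dphi ->
    \int[leb 0 T]_t (ut t phi * theta t) =
    - \int[leb 0 T]_t ((\int[I]_x (u t x * phi x)) * derive1 theta t).

(* [v] is the representative of [u] that is weakly continuous from [0, T] to
   L^2(0, 1). *)
Definition weakly_continuous_representative (T : R) u v : Prop :=
  [/\ forall t, 0 <= t <= T -> L2 (v t),
      forall phi, L2 phi ->
        {within `[0, T], continuous (fun t => \int[I]_x (v t x * phi x))} &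
      \forall t \ae leb 0 T, \forall x \ae I, v t x = u t x].

(* [u] is a weak solution, with weakly continuous representative [v], of
     u_t = u_xx - alpha u^delta u_x + beta u (1 - u^delta) (u^delta - gamma)
           + chi_omega f,
     u(t, 0) = u(t, 1) = 0,  u(0, x) = u0(x). *)
Definition weak_solution (alpha beta gamma : R) (delta : nat) (omega : set R)
    (T : R) (u0 : R -> R) (f : R * R -> R) u v : Prop :=
  exists (ux : R -> R -> R) (ut : R -> (R -> R) -> R),
  [/\ [/\ LqLp T +oo%E 2%:E u,
          LqH10 T 2%:E u ux &
          LqLp T (2 * (delta%:R + 1))%:E (2 * (delta%:R + 1))%:E u],
      time_derivative T u ut /\
        LqHm1 T (1 + (2 * delta%:R - 1)^-1)%:E ut,
      forall phi dphi, H10 phi dphi -> \forall t \ae leb 0 T,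
        ut t phi + \int[I]_x (ux t x * dphi x)
          + alpha * \int[I]_x (u t x ^+ delta * ux t x * phi x)
        = beta * \int[I]_x (u t x * (1 - u t x ^+ delta)
                              * (u t x ^+ delta - gamma) * phi x)
          + \int[I]_x (\1_omega x * f (t, x) * phi x),
      weakly_continuous_representative T u v &
      forall phi dphi, H10 phi dphi ->
        \int[I]_x (v t x * phi x) @[t --> 0^'+] --> \int[I]_x (u0 x * phi x)].

Definition approximately_controllable (alpha beta gamma : R) (delta : nat)
    (omega : set R) (T : R) : Prop :=
  forall u0 uT : R -> R, L2 u0 -> L2 uT -> forall e : R, 0 < e ->
  exists2 f : R * R -> R,
    f \in Lfun (leb 0 T \x I)%E 2%:E &
    exists u v, weak_solution alpha beta gamma delta omega T u0 f u v /\
      (L2norm (v T \- uT)%R <= e%:E)%E.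

End spaces.

(* Main.v *)
(* The control does not act on (0, b).  Let w be the power 2 delta + 2 of a bump
   function supported in (0, b), and E(t) the integral of w u(t)^2.  Formally
     E'/2 = - int u_x (w u)_x + alpha/(delta + 2) int w' u^(delta + 2)
            + beta int w u^2 (1 - u^delta) (u^delta - gamma),
   and the strong damping - beta int w u^(2 delta + 2) absorbs all other terms
   pointwise (Young), because w' is of order w^(1 - 1/(2 delta + 2)).  Hence
   E'/2 <= C with C independent of f; starting from u0 = 0, the integral of
   w u(T) is bounded independently of f, and u(T) cannot approach a large
   constant.

   As u_t only lies in L^p'(0, T; H^-1), the energy inequality is obtained by
   testing the equation at time r with the test function w u(t) for fixed t,
   integrating over t - h < r <= t, and averaging over t: replacing the
   coefficients at time r by those at time t costs o(h), by continuity of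
   translations. *)

From HB Require Import structures.
Require Import Defs.
From mathcomp Require Import all_boot all_order all_algebra.
From mathcomp Require Import all_classical all_reals all_analysis.
From mathcomp Require Import measurable_realfun ring lra zify.
Set Implicit Arguments.
Unset Strict Implicit.
Unset Printing Implicit Defensive.
Import Order.TTheory GRing.Theory Num.Theory.
Import numFieldNormedType.Exports.
Local Open Scope classical_set_scope.
Local Open Scope ring_scope.

(** * Smooth functions and bumps *)

Section smooth_functions.
Context {R : realType}.
Implicit Types (f g : R -> R) (p : {poly R}).

(** Once the test function [w u(t)] is frozen, the equation is scalar: the moment of [v(r)] against
    [w u(t)] has derivative [rate t r], so its increments are integrals of [rate t]. At [r = t] this
    moment is E(t); at [s < t] polarization bounds it by [(E(s) + E(t)) / 2]. The increment
    therefore controls [(E(t) - E(s)) / 2] without E ever being differentiated. The obstacle is that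
    all this holds only for almost every time and that E is not known to be continuous, so E(T)
    cannot be estimated directly. After integration in [t], the window averages of E cancel except
    near T: what survives is the integral of E over [(T - h/2, T)], whose mean is at most
    [8 (C T + 1)]. Windows reaching below time 0 are handled by the zero initial moment. A linear
    moment, unlike the energy, then passes to time T by weak continuity of [v]. The o(h) error is
    obtained by a truncation: Young's inequality, with an arbitrarily small factor on a fixed
    integrable weight, treats the part where the test function is large, and continuity of
    translations in [L^1] the part where it is bounded. *)

Definition smooth f := forall n x, derivable (derive1n n f) x 1.

(** Takes the first derivative and then recurses on it, so that the sum, product, affine and inverse
    rules go by induction on [n]. *)
Fixpoint ndiff n f : Prop :=
  if n is m.+1 then (forall x, derivable f x 1) /\ ndiff m (derive1 f) else True.

Lemma smoothP f : smooth f <-> forall n, ndiff n f.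
Proof.
split=> [+ n|].
  elim: n f => [//|n IH] f sf; split; first exact: (sf 0%N).
  by apply: IH => m x; rewrite -derive1Sn; exact: sf.
move=> + n; elim: n f => [|n IH] f nf x; first exact: (nf 1%N).1.
by rewrite derive1Sn; apply: IH => m; exact: (nf m.+1).2.
Qed.

Lemma ndiffW n f : ndiff n.+1 f -> ndiff n f.
Proof. by elim: n f => [//|n IH] f [df nf]; split => //; exact: IH. Qed.

Lemma ndiffD n f g : ndiff n f -> ndiff n g -> ndiff n (f \+ g).
Proof.
elim: n f g => [//|n IH] f g [df nf] [dg ng]; split.
  by move=> x; exact: derivableD.
have -> : derive1 (f \+ g) = (derive1 f) \+ (derive1 g).
  by apply/funext => x; rewrite /= !derive1E deriveD; [|exact: df|exact: dg].
exact: IH.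
Qed.

Lemma ndiffM n f g : ndiff n f -> ndiff n g -> ndiff n (f \* g).
Proof.
elim: n f g => [//|n IH] f g nf ng; have [df nf'] := nf; have [dg ng'] := ng.
split; first by move=> x; exact: derivableM.
have -> : derive1 (f \* g) = ((derive1 f) \* g) \+ (f \* (derive1 g)).
  apply/funext => x; rewrite /= !derive1E deriveM; [|exact: df|exact: dg].
  rewrite addrC.
  by congr (_ + _); rewrite /GRing.scale/= mulrC.
by apply: ndiffD; apply: IH => //; exact: ndiffW.
Qed.

Lemma ndiff_cst n (k : R) : ndiff n (cst k).
Proof.
elim: n k => [//|n IH] k; split; first by move=> x; exact: derivable_cst.
have -> : derive1 (cst k) = cst (0 : R).
  by apply/funext => x; rewrite derive1_cst.
exact: IH.
Qed.

Lemma is_derive_affine (k a x : R) : is_derive x (1 : R) (fun y => k * y + a) k.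
Proof.
have H : is_derive x (1 : R) (k \*: id \+ cst a) (k *: 1 + 0).
  exact: is_deriveD.
by have := H; rewrite addr0 [k *: 1]mulr1.
Qed.

Lemma derive1_affine f (k a : R) : (forall x, derivable f x 1) ->
  derive1 (fun x => f (k * x + a)) = fun x => k * (derive1 f) (k * x + a).
Proof.
move=> df; apply/funext => x.
have h := is_derive_affine k a x.
rewrite (derive1_comp (f := fun y => k * y + a) (g := f));
  [|exact: (ex_derive (is_derive := h))|exact: df].
by rewrite mulrC; congr (_ * _); rewrite derive1E; apply: derive_val.
Qed.

Lemma ndiff_affine n f (k a : R) :
  ndiff n f -> ndiff n (fun x => f (k * x + a)).
Proof.
elim: n f => [//|n IH] f [df nf]; split.
  move=> x; apply/derivable1_diffP.
  apply: (@differentiable_comp _ _ _ _ (fun y => k * y + a) f).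
    by apply/derivable1_diffP; have h := is_derive_affine k a x.
  exact/derivable1_diffP.
rewrite derive1_affine//.
apply: (@ndiffM n (cst k)); first exact: ndiff_cst.
exact: IH.
Qed.

Lemma smoothD f g : smooth f -> smooth g -> smooth (f \+ g).
Proof.
by move=> /smoothP sf /smoothP sg; apply/smoothP => n; exact: ndiffD.
Qed.

Lemma smoothM f g : smooth f -> smooth g -> smooth (f \* g).
Proof.
by move=> /smoothP sf /smoothP sg; apply/smoothP => n; exact: ndiffM.
Qed.

Lemma smooth_cst (k : R) : smooth (cst k).
Proof. by apply/smoothP => n; exact: ndiff_cst. Qed.

Lemma smoothX f n : smooth f -> smooth (fun x => f x ^+ n).
Proof.
move=> sf; elim: n => [|n IH].
  have -> : (fun x => f x ^+ 0) = cst 1 by apply/funext => x; rewrite expr0.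
  exact: smooth_cst.
have -> : (fun x => f x ^+ n.+1) = f \* (fun x => f x ^+ n).
  by apply/funext => x; rewrite exprS.
exact: smoothM.
Qed.

Lemma smooth_affine f (k a : R) : smooth f -> smooth (fun x => f (k * x + a)).
Proof.
by move=> /smoothP sf; apply/smoothP => n; apply: (@ndiff_affine n).
Qed.

Lemma smooth_derivable f x : smooth f -> derivable f x 1.
Proof. by move=> /(_ 0%N x). Qed.

Lemma smooth_derive1 f : smooth f -> smooth (derive1 f).
Proof. by move=> sf n x; rewrite -derive1Sn; exact: sf. Qed.

Lemma smooth_continuous f : smooth f -> continuous f.
Proof.
move=> sf x; apply: differentiable_continuous.
by apply/derivable1_diffP; exact: smooth_derivable.
Qed.

(* exp(-1/x) times a polynomial in 1/x, extended by 0 to x <= 0 : a family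
   stable under differentiation. *)
Definition flat p (x : R) : R :=
  if x <= 0 then 0 else p.[x^-1] * expR (- x^-1).

(** With [n = size p], the polynomial is at most a constant times [y ^+ n], while [expR y] exceeds
    [y ^+ n.+2 / n.+2!]. At [y = h^-1] the bound reads [C * h ^+ 2], which makes [flat p]
    differentiable at 0. *)
Lemma poly_expRN p : exists2 C : R, 0 <= C &
  forall y, 1 <= y -> `|p.[y] * expR (- y)| <= C / y ^+ 2.
Proof.
pose n := size p.
exists (n.+2`!%:R * \sum_(i < n) `|p`_i|).
  by rewrite mulr_ge0// sumr_ge0.
move=> y y1; have y0 : 0 < y by lra.
have hp : `|p.[y]| <= (\sum_(i < n) `|p`_i|) * y ^+ n.
  rewrite horner_coef (le_trans (ler_norm_sum _ _ _))// mulr_suml ler_sum//.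
  move=> i _; rewrite normrM ler_wpM2l// normrX (ger0_norm (ltW y0)).
  by apply: ler_weXn2l => //; exact: (ltnW (ltn_ord i)).
have he : expR (- y) <= n.+2`!%:R / y ^+ n.+2.
  rewrite expRN -[leRHS]invrK lef_pV2 ?posrE ?expR_gt0//; last first.
    by rewrite invr_gt0 divr_gt0// ?exprn_gt0// ltr0n fact_gt0.
  rewrite invf_div; apply: le_trans (expR_ge1Dxn n.+1 (ltW y0)) => /=.
  by rewrite lerDr ler01.
rewrite normrM (ger0_norm (expR_ge0 _)).
apply: (le_trans (ler_pM (normr_ge0 _) (expR_ge0 _) hp he)).
rewrite -addn2 exprD invfM le_eqVlt; apply/orP; left; apply/eqP.
have yn : y ^+ n != 0 by rewrite expf_neq0// gt_eqF.
have y2 : y ^+ 2 != 0 by rewrite expf_neq0// gt_eqF.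
by field; rewrite yn gt_eqF.
Qed.

(** For [x > 0], differentiating [p(1/x) exp(-1/x)] produces the factor [1/x^2], which is ['X^2] in
    the variable [1/x]. *)
Lemma is_derive_flat p x :
  is_derive x (1 : R) (flat p) (flat ('X^2 * (p - p^`())) x).
Proof.
have [x0|x0|->] := ltgtP x 0.
- apply: (@near_eq_is_derive _ _ _ (cst 0)); last first.
  + by rewrite /flat (ltW x0); exact: is_derive_cst.
  + near=> y; rewrite /flat ifT//; apply: ltW; near: y; exact: lt_nbhsl.
- have x0' : x != 0 by rewrite gt_eqF.
  apply: (@near_eq_is_derive _ _ _
     ((horner p \o (fun y : R => y^-1)) \* (expR \o (fun y => - y^-1)))) => //.
  + near=> y; rewrite /flat ifF//; apply/negbTE; rewrite -ltNge.
    by near: y; exact: lt_nbhsr.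
  + have dV : is_derive x (1 : R) (fun y : R => y^-1) (- x ^- 2).
      have := @is_deriveV _ (@id R) x 1 1 x0' (is_derive_id _ _).
      by rewrite [(- x ^- 2) *: 1]mulr1.
    have dp : is_derive x (1 : R) (horner p \o (fun y : R => y^-1))
        (- x ^- 2 * p^`().[x^-1]).
      by rewrite mulrC; exact: (@is_derive1_comp _ (horner p) (fun y : R => y^-1)).
    have de : is_derive x (1 : R) (expR \o (fun y : R => - y^-1))
        (x ^- 2 * expR (- x^-1)).
      rewrite mulrC; apply: (@is_derive1_comp _ expR (fun y : R => - y^-1)).
      by rewrite -[X in is_derive _ _ _ X]opprK; exact: is_deriveN.
    apply: is_derive_eq.
    rewrite /flat leNgt x0 !hornerE exprVn.
    rewrite -[LHS]/(p.[x^-1] * (x ^- 2 * expR (- x^-1)) +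
      expR (- x^-1) * (- x ^- 2 * p^`().[x^-1])).
    by ring.
(* At the origin [flat p h] is [O(h^2)], so the difference quotient tends to 0. *)
- have [C C0 hC] := poly_expRN p.
  have hflat h : `|h| <= 1 -> `|flat p h| <= C * h ^+ 2.
    move=> h1; rewrite /flat; case: ifPn => [_|].
      by rewrite normr0 mulr_ge0// sqr_ge0.
    rewrite -ltNge => h0; have := hC h^-1.
    rewrite exprVn invrK; apply.
    by rewrite invf_ge1//; rewrite gtr0_norm in h1.
  have dlim : (h^-1 *: ((flat p \o shift 0) (h *: (1 : R)) - flat p 0)) @[h --> 0^'] --> (0 : R).
    apply/cvgrPdist_le => e e0; near=> h.
    rewrite sub0r normrN /= addr0 /GRing.scale/= mulr1 {2}/flat lexx subr0.
    have h0 : h != 0 by near: h; exact: nbhs_dnbhs_neq.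
    rewrite normrM normfV ler_pdivrMl ?normr_gt0//.
    apply: (@le_trans _ _ (C * h ^+ 2)).
      apply: hflat; near: h.
      by apply: dnbhs0_le; rewrite ltr01.
    have hC1 : `|h| <= e / (C + 1).
      by near: h; apply: dnbhs0_le; rewrite divr_gt0// ltr_wpDl.
    rewrite -real_normK ?num_real// expr2 mulrCA ler_wpM2l//.
    apply: (le_trans (ler_wpM2l C0 hC1)).
    by rewrite mulrA ler_pdivrMr ?ltr_wpDl//; nra.
  have -> : flat ('X^2 * (p - p^`())) 0 = 0 by rewrite /flat lexx.
  apply: DeriveDef; first by apply/cvg_ex; exists 0.
  exact/cvg_lim.
Unshelve. all: by end_near. Qed.

Lemma smooth_flat p : smooth (flat p).
Proof.
apply/smoothP => n; elim: n p => [//|n IH] p; split.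
  by move=> x; have h := is_derive_flat p x.
have -> : derive1 (flat p) = flat ('X^2 * (p - p^`())).
  by apply/funext => x; rewrite derive1E; have h := is_derive_flat p x; apply: derive_val.
exact: IH.
Qed.

(** The derivative [- f' / f^2] involves [1/f] only to the order already reached, so the induction
    closes with the product rule. *)
Lemma ndiffV n f : (forall x, f x != 0) -> ndiff n f ->
  ndiff n (fun x => (f x)^-1).
Proof.
move=> f0; elim: n => [//|n IH] nf; have [df nf'] := nf; split.
  by move=> x; exact: derivableV.
have -> : derive1 (fun x => (f x)^-1) =
    (cst (-1) \* derive1 f) \* ((fun x => (f x)^-1) \* (fun x => (f x)^-1)).
  apply/funext => x /=; rewrite !derive1E deriveV; [|exact: f0|exact: df].
  rewrite -[LHS]/(- (f x) ^- 2 * 'D_1 f x) -exprVn; by ring.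
apply: ndiffM; first by apply: ndiffM => //; exact: ndiff_cst.
by apply: ndiffM; apply: IH; exact: ndiffW.
Qed.

Lemma smoothV f : (forall x, f x != 0) -> smooth f ->
  smooth (fun x => (f x)^-1).
Proof.
by move=> f0 /smoothP sf; apply/smoothP => n; exact: ndiffV.
Qed.

Definition bump (a b x : R) : R := flat 1 (x - a) * flat 1 (b - x).

Lemma flat_eq0 p x : x <= 0 -> flat p x = 0.
Proof. by rewrite /flat => ->. Qed.

Lemma flat1_gt0 x : 0 < x -> 0 < flat 1 x.
Proof. by move=> x0; rewrite /flat leNgt x0 /= hornerC mul1r expR_gt0. Qed.

Lemma flat1_ge0 x : 0 <= flat 1 x.
Proof.
by have [x0|x0] := leP x 0; [rewrite flat_eq0|exact/ltW/flat1_gt0].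
Qed.

Lemma flat1_le1 x : flat 1 x <= 1.
Proof.
rewrite /flat; case: ifPn => [_|]; first exact: ler01.
by rewrite -ltNge => x0; rewrite hornerC mul1r expR_le1 oppr_le0 invr_ge0 ltW.
Qed.

Lemma smooth_bump a b : smooth (bump a b).
Proof.
apply: (@smoothM (fun x => flat 1 (x - a)) (fun x => flat 1 (b - x))).
  have := @smooth_affine _ 1 (- a) (@smooth_flat 1).
  by under eq_fun do rewrite mul1r.
have := @smooth_affine _ (-1) b (@smooth_flat 1).
by under eq_fun do rewrite mulN1r addrC.
Qed.

Lemma bump_ge0 a b x : 0 <= bump a b x.
Proof. by rewrite mulr_ge0 ?flat1_ge0. Qed.

Lemma bump_le1 a b x : bump a b x <= 1.
Proof. by rewrite mulr_ile1 ?flat1_ge0 ?flat1_le1. Qed.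

Lemma bump_gt0 a b x : a < x < b -> 0 < bump a b x.
Proof. by move=> /andP[ax xb]; rewrite mulr_gt0 ?flat1_gt0 ?subr_gt0. Qed.

Lemma bump_neq0 a b x : bump a b x != 0 -> a <= x <= b.
Proof.
apply: contraR; rewrite negb_and -!ltNge => /orP[|] h; apply/eqP.
  by rewrite /bump flat_eq0 ?mul0r// subr_le0 ltW.
by rewrite /bump [X in _ * X]flat_eq0 ?mulr0// subr_le0 ltW.
Qed.

(** The usual smooth transition from 0 on [x <= 0] to 1 on [1 <= x]. Rescaled, it approximates
    indicators in time, and its derivative serves as a mollifier. *)
Definition step (x : R) : R := flat 1 x * (flat 1 x + flat 1 (1 - x))^-1.

Lemma smooth_step : smooth step.
Proof.
have s1 : smooth (fun x : R => flat 1 (1 - x)).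
  have := @smooth_affine _ (-1) 1 (@smooth_flat 1).
  by under eq_fun do rewrite mulN1r addrC.
apply: (smoothM (@smooth_flat 1)
  (g := fun x => (flat 1 x + flat 1 (1 - x))^-1)).
apply: smoothV => [x|]; last exact: smoothD (@smooth_flat 1) s1.
have [x0|x0] := ltP 0 x.
  by rewrite gt_eqF// ltr_pwDl ?flat1_gt0 ?flat1_ge0.
by rewrite gt_eqF// ltr_wpDl ?flat1_gt0 ?flat1_ge0// subr_gt0 (le_lt_trans x0).
Qed.

Lemma step0 x : x <= 0 -> step x = 0.
Proof. by move=> x0; rewrite /step flat_eq0// mul0r. Qed.

Lemma step1 x : 1 <= x -> step x = 1.
Proof.
move=> x1; rewrite /step [X in _ + X]flat_eq0 ?subr_le0// addr0 divff//.
by rewrite gt_eqF// flat1_gt0// (lt_le_trans _ x1).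
Qed.

Lemma step_ge0 x : 0 <= step x.
Proof. by rewrite mulr_ge0 ?invr_ge0 ?addr_ge0 ?flat1_ge0. Qed.

Lemma step_le1 x : step x <= 1.
Proof.
have [x0|x0] := leP x 0; first by rewrite step0.
by rewrite /step ler_pdivrMr ?ltr_pwDl ?flat1_gt0 ?flat1_ge0// mul1r lerDl flat1_ge0.
Qed.

Lemma derive1_eq0 f x : (\forall y \near x, f y = 0) -> derive1 f x = 0.
Proof.
move=> f0; rewrite derive1E (@near_eq_derive _ _ _ f (cst 0)) ?derive_cst//.
Qed.

Lemma closure_support_le f a b : (forall x, f x != 0 -> a <= x <= b) ->
  closure [set x | f x != 0] `<=` `[a, b].
Proof.
move=> fab; rewrite [X in _ `<=` X](closure_id _).1; last exact: itv_closed.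
apply: closureS => x /=.
by rewrite in_itv/=; exact: fab.
Qed.

Lemma test_functionI a b a' b' f : smooth f -> a < a' -> b' < b ->
  (forall x, f x != 0 -> a' <= x <= b') -> test_function a b f.
Proof.
move=> sf aa bb h; split=> //.
  apply: (subclosed_compact _ (@segment_compact R a' b')).
    exact: closed_closure.
  exact: closure_support_le.
move=> x /(closure_support_le h) /=; rewrite !in_itv/= => /andP[h1 h2].
by rewrite (lt_le_trans aa)//= (le_lt_trans h2).
Qed.

Lemma test_function_smooth a b f : test_function a b f -> smooth f.
Proof. by case. Qed.

Lemma test_function_near0 a b f x : test_function a b f -> ~ (a < x < b) ->
  \forall y \near x, f y = 0.
Proof.
move=> [_ _ sub] xab.
have : nbhs x (~` closure [set x | f x != 0]).
  apply: open_nbhs_nbhs; split; first exact/closed_openC/closed_closure.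
  by move=> /sub /=; rewrite in_itv.
apply: filterS => y yc; apply/eqP; apply: contrapT => /negP fy.
by apply: yc; exact: subset_closure.
Qed.

Lemma test_function_eq0 a b f x : test_function a b f -> ~ (a < x < b) ->
  f x = 0.
Proof. by move=> tf /(test_function_near0 tf) /nbhs_singleton. Qed.

Lemma test_function_derive_eq0 a b f x : test_function a b f ->
  ~ (a < x < b) -> derive1 f x = 0.
Proof. by move=> tf /(test_function_near0 tf) /derive1_eq0. Qed.

Lemma test_functionM a b f g : smooth f -> test_function a b g ->
  test_function a b (f \* g).
Proof.
move=> sf [sg cg subg].
have sub : closure [set x | (f \* g) x != 0] `<=` closure [set x | g x != 0].
  apply: closureS => x /=; apply: contra_neq => ->; exact: mulr0.
split; first exact: smoothM.
  by apply: subclosed_compact cg sub; exact: closed_closure.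
exact: subset_trans subg.
Qed.

Lemma continuous_supported_bounded f a b : continuous f ->
  (forall x, ~ (a < x < b) -> f x = 0) -> exists2 M, 0 <= M &
  forall x, `|f x| <= M.
Proof.
move=> cf f0.
have [ab|ba] := leP a b; last first.
  exists 0 => // x; rewrite f0 ?normr0// => /andP[h1 h2].
  by have := lt_trans h1 (lt_trans h2 ba); rewrite ltxx.
have cnf : {within `[a, b], continuous (fun x => `|f x|)}.
  by apply: continuous_subspaceT => x; apply: cvg_norm; exact: cf.
have [c _ hc] := EVT_max ab cnf.
exists `|f c| => // x; have [/andP[h1 h2]|h] := pselect (a < x < b).
  by apply: hc; rewrite in_itv/= !ltW.
by rewrite f0 ?normr0.
Qed.

Lemma test_function_bounded a b f : test_function a b f ->
  exists2 M, 0 <= M & forall x, `|f x| <= M.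
Proof.
move=> tf; apply: (@continuous_supported_bounded f a b).
  exact/smooth_continuous/(test_function_smooth tf).
by move=> x; exact: test_function_eq0.
Qed.

Lemma test_function_derive_bounded a b f : test_function a b f ->
  exists2 M, 0 <= M & forall x, `|derive1 f x| <= M.
Proof.
move=> tf; apply: (@continuous_supported_bounded _ a b).
  exact/smooth_continuous/smooth_derive1/(test_function_smooth tf).
by move=> x; exact: test_function_derive_eq0.
Qed.

End smooth_functions.

(** * Real-valued integrals and almost-everywhere comparison *)

Section real_integrals.
Context d (T : measurableType d) (R : realType) (mu : {measure set T -> \bar R}).
Implicit Types f g : T -> R.
Local Notation integ f := (mu.-integrable setT (EFin \o f)).

Lemma ae_imp (P Q : T -> Prop) : (forall x, P x -> Q x) ->
  (\forall x \ae mu, P x) -> \forall x \ae mu, Q x.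
Proof. by move=> PQ; apply: filterS. Qed.

Lemma ae_and (P Q : T -> Prop) : (\forall x \ae mu, P x) ->
  (\forall x \ae mu, Q x) -> \forall x \ae mu, P x /\ Q x.
Proof. by move=> h1 h2; apply: filterS2 h1 h2 => x. Qed.

Lemma integD f g : integ f -> integ g -> integ (fun x => f x + g x).
Proof. by move=> fi gi; exact: (integrableD measurableT fi gi). Qed.

Lemma integZ k f : integ f -> integ (fun x => k * f x).
Proof. by move=> fi; exact: (integrableZl measurableT k fi). Qed.

Lemma integB f g : integ f -> integ g -> integ (fun x => f x - g x).
Proof. by move=> fi gi; exact: (integrableB measurableT fi gi). Qed.

Lemma integ_dom f g : measurable_fun setT f -> integ g ->
  (forall x, `|f x| <= g x) -> integ f.
Proof.
move=> mf gi fg; apply: (le_integrable measurableT _ _ gi).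
  exact/measurable_EFinP.
by move=> x _; rewrite lee_fin (le_trans (fg x))// ler_norm.
Qed.

Lemma integ_norm f : integ f -> integ (fun x => `|f x|).
Proof. by move=> fi; exact: (integrable_abse fi). Qed.

Lemma integ_measurable f : integ f -> measurable_fun setT f.
Proof. by move=> /integrableP[/measurable_EFinP]. Qed.

Lemma integ_integral f : integ f ->
  (\int[mu]_x (f x)%:E)%E = (\int[mu]_x f x)%:E.
Proof.
by move=> fi; rewrite /Rintegral fineK//; exact: integrable_fin_num.
Qed.

Lemma integ_ltyP f : measurable_fun setT f -> (forall x, 0 <= f x) ->
  (\int[mu]_x (f x)%:E < +oo)%E -> integ f.
Proof.
move=> mf f0 foo; apply/integrableP; split; first exact/measurable_EFinP.
by under eq_integral do rewrite /= ger0_norm//.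
Qed.

Lemma ae_eq_Rintegral f g : measurable_fun setT f -> measurable_fun setT g ->
  (\forall x \ae mu, f x = g x) -> \int[mu]_x f x = \int[mu]_x g x.
Proof.
move=> mf mg fg; rewrite /Rintegral; congr fine.
apply: ae_eq_integral => //; [exact/measurable_EFinP|exact/measurable_EFinP|].
by apply: filterS fg => x /= -> _.
Qed.

(** Replacing [g] by [max f g], equal to it almost everywhere, makes the inequality hold at every
    point. *)
Lemma ae_le_Rintegral f g : integ f -> integ g ->
  (\forall x \ae mu, f x <= g x) -> \int[mu]_x f x <= \int[mu]_x g x.
Proof.
move=> fi gi fg.
have mf := integ_measurable fi; have mg := integ_measurable gi.
have mm : measurable_fun setT (fun x => Num.max (f x) (g x)).
  exact: measurable_maxr.
have ei : integ (fun x => Num.max (f x) (g x)).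
  apply: (integ_dom mm (integD (integ_norm fi) (integ_norm gi))) => x /=.
  by rewrite maxEle; case: ifP; rewrite ?lerDl ?lerDr.
rewrite [leRHS](ae_eq_Rintegral mg mm).
  by apply: le_Rintegral => // x _; rewrite le_max lexx.
by apply: filterS fg => x fgx; rewrite max_r.
Qed.

Lemma dominated_cvg_Rintegral (f_ : nat -> T -> R) f g :
  (forall n, measurable_fun setT (f_ n)) -> integ f -> integ g ->
  (forall x, f_ n x @[n --> \oo] --> f x) ->
  (forall n x, `|f_ n x| <= g x) ->
  \int[mu]_x f_ n x @[n --> \oo] --> \int[mu]_x f x.
Proof.
move=> mf fi gi ff fg.
have /fine_cvgP[_] : (\int[mu]_x (f_ n x)%:E)%E @[n --> \oo] -->
    (\int[mu]_x f x)%:E.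
  rewrite -(integ_integral fi).
  apply: (@dominated_cvg _ _ _ mu setT measurableT (fun n x => (f_ n x)%:E)
    (fun x => (f x)%:E) (fun x => (g x)%:E)) => //.
  - by move=> n; exact/measurable_EFinP.
  - by move=> x _; apply: cvg_EFin; [near=> n|exact: ff].
  - by move=> n x _; rewrite lee_fin.
by [].
Unshelve. all: by end_near. Qed.

Lemma integ_sqM f g : measurable_fun setT f -> measurable_fun setT g ->
  integ (fun x => f x ^+ 2) -> integ (fun x => g x ^+ 2) ->
  integ (fun x => f x * g x).
Proof.
move=> mf mg f2 g2; apply: (integ_dom _ (integD f2 g2)).
  exact: measurable_funM.
by move=> x; rewrite ler_norml; apply/andP; split; nra.
Qed.

(* AM-GM: [l |f g| <= l^2 f^2 + g^2] *)
Lemma Rintegral_sqM_le f g (l : R) : 0 < l ->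
  measurable_fun setT f -> measurable_fun setT g ->
  integ (fun x => f x ^+ 2) -> integ (fun x => g x ^+ 2) ->
  \int[mu]_x (g x ^+ 2) <= l ^+ 2 ->
  \int[mu]_x `|f x * g x| <= l * (\int[mu]_x (f x ^+ 2) + 1).
Proof.
move=> l0 mf mg f2 g2 gl.
have h : \int[mu]_x `|f x * g x| <=
    \int[mu]_x (l * f x ^+ 2 + l^-1 * g x ^+ 2).
  apply: le_Rintegral => //.
  - exact/integ_norm/integ_sqM.
  - by apply: integD; exact: integZ.
  - move=> x _; rewrite normrM -(ler_pM2l l0) mulrDr.
    rewrite [l * (l^-1 * _)]mulrA divff ?gt_eqF// mul1r.
    rewrite -(real_normK (num_real (f x))) -(real_normK (num_real (g x))).
    have := sqr_ge0 (l * `|f x| - `|g x|).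
    have : 0 <= l * (`|f x| * `|g x|) by rewrite mulr_ge0// ltW.
    nra.
apply: le_trans h _.
rewrite RintegralD//; [|exact: integZ|exact: integZ].
rewrite !RintegralZl// mulrDr mulr1 lerD2l mulrC ler_pdivrMr//.
Qed.

Lemma LnormX_fin (n : nat) f : (0 < n)%N ->
  (('N[mu]_(n%:R)%:E [EFin \o f]) `^ n%:R = \int[mu]_x (`|f x| ^+ n)%:E)%E.
Proof.
move=> n0; rewrite poweR_Lnorm ?pnatr_eq0 ?gtn_eqF//.
by apply: eq_integral => x _; rewrite /= powR_mulrn.
Qed.

End real_integrals.

(** * Lebesgue measure on an interval and the fundamental theorem of calculus *)

Section interval_measure.
Context (R : realType).
Implicit Types (a b : R).

Lemma lebE a b (A : set R) :
  leb a b A = lebesgue_measure (A `&` `]a, b[%classic).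
Proof. by []. Qed.

Lemma leb_setC a b : leb a b (~` `]a, b[) = 0.
Proof. by rewrite lebE setICl measure0. Qed.

Lemma ge0_integral_leb a b (f : R -> \bar R) :
  measurable_fun setT f -> (forall x, 0 <= f x)%E ->
  (\int[leb a b]_x f x = \int[lebesgue_measure]_(x in `]a, b[) f x)%E.
Proof.
move=> mf f0.
rewrite (@ge0_negligible_integral _ _ _ (leb a b) setT (~` `]a, b[%classic) f)//; last 2 first.
- by apply: measurableC.
- exact: leb_setC.
rewrite setTD setCK; apply: eq_measure_integral => A mA Aab.
by rewrite -[LHS]/(lebesgue_measure (A `&` `]a, b[%classic)) setIidl.
Qed.

Lemma integral_leb a b (f : R -> \bar R) : (leb a b).-integrable setT f ->
  (\int[leb a b]_x f x = \int[lebesgue_measure]_(x in `]a, b[) f x)%E.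
Proof.
move=> fi.
rewrite (@negligible_integral _ _ _ (leb a b) setT (~` `]a, b[%classic) f)//; last 2 first.
- by apply: measurableC.
- exact: leb_setC.
rewrite setTD setCK; apply: eq_measure_integral => A mA Aab.
by rewrite -[LHS]/(lebesgue_measure (A `&` `]a, b[%classic)) setIidl.
Qed.

Lemma ae_leb_itv a b : \forall x \ae leb a b, a < x < b.
Proof.
exists (~` `]a, b[); split; [by apply: measurableC|exact: leb_setC|].
by move=> x /= h; rewrite in_itv.
Qed.

Lemma continuous_integ_leb a b (f : R -> R) : continuous f ->
  (leb a b).-integrable setT (EFin \o f).
Proof.
move=> cf; have mf : measurable_fun setT f by exact: continuous_measurable_fun.
apply/integrableP; split; first exact/measurable_EFinP.
rewrite ge0_integral_leb//; last by apply: measurableT_comp => //; exact/measurable_EFinP.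
have /integrableP[_] : lebesgue_measure.-integrable `[a, b] (EFin \o f).
  apply: continuous_compact_integrable; first exact: segment_compact.
  exact: continuous_subspaceT.
apply: le_lt_trans; apply: ge0_subset_integral => //=.
- apply: measurable_funTS; apply/measurable_EFinP.
  exact: (measurableT_comp (@normr_measurable R setT) mf).
- by move=> x; rewrite /= !in_itv/= => /andP[/ltW -> /ltW ->].
Qed.

Lemma integral_derive1 a b (F : R -> R) : a < b -> smooth F ->
  \int[leb a b]_x derive1 F x = F b - F a.
Proof.
move=> ab sF; have cF' := smooth_continuous (smooth_derive1 sF).
rewrite /Rintegral integral_leb; last exact: continuous_integ_leb.
rewrite integral_itv_bndo_bndc; last first.
  by apply/measurable_EFinP/measurable_funTS; exact: continuous_measurable_fun.
rewrite integral_itv_obnd_cbnd; last first.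
  by apply/measurable_EFinP/measurable_funTS; exact: continuous_measurable_fun.
rewrite (@continuous_FTC2 _ (derive1 F) F)//.
- exact: continuous_subspaceT.
- split.
  + by move=> x _; exact: smooth_derivable.
  + exact/cvg_at_right_filter/smooth_continuous.
  + exact/cvg_at_left_filter/smooth_continuous.
Qed.

End interval_measure.

(** * Square-integrable functions and products in [H^1_0] *)

Section L2_functions.
Context (R : realType).
Implicit Types (phi dphi psi theta w : R -> R) (e : R).

Local Notation I := (leb (0 : R) 1).
Local Notation integ f := (I.-integrable setT (EFin \o f)).

Lemma L2norm_sq phi : ((L2norm phi) `^ 2 = \int[I]_x (phi x ^+ 2)%:E)%E.
Proof.
rewrite /L2norm (@LnormX_fin _ _ _ I 2)//; apply: eq_integral => x _.
by rewrite real_normK ?num_real.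
Qed.

Lemma L2P phi : L2 phi <->
  measurable_fun setT phi /\ integ (fun x => phi x ^+ 2).
Proof.
split=> [phi2|[mphi phi2]].
  have mphi : measurable_fun setT phi.
    by have /sub_Lfun_mfun := phi2; rewrite inE.
  split=> //; apply: integ_ltyP => [|x|]; [exact: measurable_funX|exact: sqr_ge0|].
  rewrite -L2norm_sq; apply: poweR_lty.
  by have /sub_Lfun_finLfun := phi2; rewrite inE.
rewrite /L2 /= inE; apply/andP; split; rewrite inE/=; first exact: mphi.
apply: (@lty_poweRy _ _ 2) => //.
rewrite -[X in (X < _)%E]/((L2norm phi) `^ 2)%E L2norm_sq.
by rewrite integ_integral// ltry.
Qed.

(** Trades the extended-real norm for a real integral of squares, the form in which all later
    estimates are made. *)
Lemma L2norm_le phi e : integ (fun x => phi x ^+ 2) -> 0 <= e ->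
  (L2norm phi <= e%:E)%E <-> \int[I]_x (phi x ^+ 2) <= e ^+ 2.
Proof.
move=> phi2 e0; rewrite -lee_fin -integ_integral// -L2norm_sq.
have n0 : (0 <= L2norm phi)%E by exact: Lnorm_ge0.
have <- : (e%:E `^ 2 = (e ^+ 2)%:E)%E by rewrite poweR_EFin powR_mulrn.
split=> [h|h].
  apply: gt0_ler_poweR => //; rewrite in_itv/= leey andbT ?lee_fin//.
have := @gt0_ler_poweR R 2^-1; rewrite invr_ge0 ler0n => /(_ isT).
move=> /(_ _ _ _ _ h); rewrite -!poweRrM divff// !poweRe1 ?lee_fin//.
by apply; rewrite in_itv; apply/andP; split;
  [exact: poweR_ge0|exact: leey|exact: poweR_ge0|exact: leey].
Qed.

Lemma L2_measurable phi : L2 phi -> measurable_fun setT phi.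
Proof. by move=> /L2P[]. Qed.

Lemma L2_sq phi : L2 phi -> integ (fun x => phi x ^+ 2).
Proof. by move=> /L2P[]. Qed.

Lemma L2M phi psi : L2 phi -> L2 psi -> integ (fun x => phi x * psi x).
Proof. by move=> /L2P[? ?] /L2P[? ?]; exact: integ_sqM. Qed.

Lemma L2D phi psi : L2 phi -> L2 psi -> L2 (fun x => phi x + psi x).
Proof.
move=> h1 h2; have /L2P[m1 i1] := h1; have /L2P[m2 i2] := h2.
apply/L2P; split; first exact: measurable_funD.
have := integD (integD i1 i2) (integZ 2 (L2M h1 h2)).
by congr integrable; apply/funext => x /=; congr EFin; ring.
Qed.

Lemma L2Z k phi : L2 phi -> L2 (fun x => k * phi x).
Proof.
move=> h1; have /L2P[m1 i1] := h1.
apply/L2P; split; first exact: measurable_funM.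
have := integZ (k ^+ 2) i1.
by congr integrable; apply/funext => x /=; congr EFin; ring.
Qed.

Lemma L2_cst (k : R) : L2 (fun=> k).
Proof.
by apply/L2P; split => //; exact: (finite_measure_integrable_cst I (k ^+ 2)).
Qed.

Lemma L2B phi psi : L2 phi -> L2 psi -> L2 (fun x => phi x - psi x).
Proof.
move=> h1 h2; have := L2D h1 (L2Z (-1) h2).
by congr L2; apply/funext => x; rewrite mulN1r.
Qed.

Lemma L2_bounded phi M : measurable_fun setT phi -> (forall x, `|phi x| <= M) ->
  L2 phi.
Proof.
move=> mphi phiM; apply/L2P; split=> //.
apply: (integ_dom _ (finite_measure_integrable_cst I (M ^+ 2) measurableT)).
  exact: measurable_funX.
by move=> x; rewrite normrX ler_sqr ?nnegrE// (le_trans _ (phiM x)).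
Qed.

Lemma bounded_L2M w phi M : measurable_fun setT w -> (forall x, `|w x| <= M) ->
  L2 phi -> L2 (fun x => w x * phi x).
Proof.
move=> mw wM /L2P[m1 i1]; apply/L2P; split; first exact: measurable_funM.
apply: (integ_dom _ (integZ (M ^+ 2) i1)) => [|x].
  by apply: measurable_funX; exact: measurable_funM.
rewrite exprMn normrM !normrX -[X in _ <= _ * X]real_normK ?num_real//.
by rewrite ler_wpM2r ?sqr_ge0// ler_sqr ?nnegrE// (le_trans _ (wM x)).
Qed.

Lemma smooth_measurable theta : smooth theta -> measurable_fun setT theta.
Proof. by move=> st; apply: continuous_measurable_fun; exact: smooth_continuous. Qed.

Lemma test_function_L2 theta : test_function 0 1 theta -> L2 theta.
Proof.
move=> tt; have [M M0 hM] := test_function_bounded tt.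
by apply: L2_bounded hM; exact: (smooth_measurable (test_function_smooth tt)).
Qed.

Lemma test_function_derive1_L2 theta : test_function 0 1 theta ->
  L2 (derive1 theta).
Proof.
move=> tt; have [M M0 hM] := test_function_derive_bounded tt.
by apply: L2_bounded hM; exact: (smooth_measurable (smooth_derive1 (test_function_smooth tt))).
Qed.

Lemma Rintegral_sqD_le phi psi : L2 phi -> L2 psi ->
  \int[I]_x ((phi x + psi x) ^+ 2) <=
  2 * \int[I]_x (phi x ^+ 2) + 2 * \int[I]_x (psi x ^+ 2).
Proof.
move=> h1 h2; have i1 := L2_sq h1; have i2 := L2_sq h2.
rewrite -!RintegralZl// -RintegralD//; [|exact: integZ..].
apply: le_Rintegral => //; first exact: (L2_sq (L2D h1 h2)).
  by apply: integD; exact: integZ.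
by move=> x _; have := sqr_ge0 (phi x - psi x); nra.
Qed.

Lemma Rintegral_bounded_sq_le w phi M : measurable_fun setT w ->
  (forall x, `|w x| <= M) -> L2 phi ->
  \int[I]_x ((w x * phi x) ^+ 2) <= M ^+ 2 * \int[I]_x (phi x ^+ 2).
Proof.
move=> mw wM h; have i := L2_sq h; rewrite -RintegralZl//.
apply: le_Rintegral => //; first exact: (L2_sq (bounded_L2M mw wM h)).
  exact: integZ.
move=> x _; rewrite exprMn ler_wpM2r ?sqr_ge0//.
by rewrite -(real_normK (num_real (w x))) ler_sqr ?nnegrE// (le_trans _ (wM x)).
Qed.

Lemma derive1M (f g : R -> R) x : smooth f -> smooth g ->
  derive1 (f \* g) x = derive1 f x * g x + f x * derive1 g x.
Proof.
move=> sf sg; rewrite !derive1E deriveM; [|exact: smooth_derivable..].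
by rewrite addrC; congr (_ + _); rewrite /GRing.scale/= mulrC.
Qed.

(** Testing the product with [theta] amounts to testing [phi] with [w theta], and [w theta]
    approximates [w phi] when [theta] approximates [phi]. This makes [w u(t)] an admissible test
    function. *)
Lemma H10_mul w phi dphi : test_function 0 1 w -> H10 phi dphi ->
  H10 (fun x => w x * phi x) (fun x => derive1 w x * phi x + w x * dphi x).
Proof.
move=> tw [phi2 dphi2 wd app]; have sw := test_function_smooth tw.
have mw := smooth_measurable sw.
have mw' := smooth_measurable (smooth_derive1 sw).
have [M M0 wM] := test_function_bounded tw.
have [N N0 wN] := test_function_derive_bounded tw.
have L1 := bounded_L2M mw wM phi2.
have L2' := L2D (bounded_L2M mw' wN phi2) (bounded_L2M mw wM dphi2).
split=> //.
- move=> theta tt; have st := test_function_smooth tt.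
  have := wd _ (test_functionM sw tt).
  have t2 := test_function_L2 tt; have t2' := test_function_derive1_L2 tt.
  have E1 : integ (fun x => (derive1 w x * phi x) * theta x).
    by apply: L2M => //; exact: bounded_L2M wN _.
  have E2 : integ (fun x => (w x * phi x) * derive1 theta x).
    by apply: L2M.
  have E3 : integ (fun x => (w x * dphi x) * theta x).
    by apply: L2M => //; exact: bounded_L2M wM _.
  under eq_Rintegral => x _.
    rewrite derive1M// mulrDr.
    rewrite (_ : _ * _ + _ = (derive1 w x * phi x) * theta x +
      (w x * phi x) * derive1 theta x); last by ring.
    over.
  under [X in _ = - X -> _]eq_Rintegral => x _.
    rewrite (_ : _ * _ = (w x * dphi x) * theta x); last by rewrite /=; ring.
    over.
  under [X in _ -> _ = - X]eq_Rintegral do rewrite mulrDl.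
  rewrite !RintegralD// => ?; lra.
- move=> e e0.
  have C0 : 0 < 2 * (M + N + 1) by rewrite mulr_gt0// ltr_wpDl// addr_ge0.
  (* The error in the derivative is at most [2 (N^2 + M^2) e'^2], which is below
     [(2 (M + N + 1) e')^2 = e^2]. *)
  pose e' := e / (2 * (M + N + 1)).
  have e'0 : 0 < e' by rewrite divr_gt0.
  have [theta [tt h1 h2]] := app e' e'0; have st := test_function_smooth tt.
  have d1 : L2 (fun x => phi x - theta x) by exact/L2B/test_function_L2.
  have d2 : L2 (fun x => dphi x - derive1 theta x).
    exact/L2B/test_function_derive1_L2.
  move: h1 => /(L2norm_le (L2_sq d1) (ltW e'0)) h1.
  move: h2 => /(L2norm_le (L2_sq d2) (ltW e'0)) h2.
  have ee : e ^+ 2 = (2 * (M + N + 1)) ^+ 2 * e' ^+ 2.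
    by rewrite -exprMn /e' mulrC divfK ?gt_eqF.
  exists (w \* theta); split; first exact: test_functionM.
  + have -> : (fun x => w x * phi x) \- (w \* theta) =
        fun x => w x * (phi x - theta x).
      by apply/funext => x; rewrite /= mulrBr.
    apply/(L2norm_le (L2_sq (bounded_L2M mw wM d1)) (ltW e0)).
    apply: (le_trans (Rintegral_bounded_sq_le mw wM d1)).
    apply: (le_trans (ler_wpM2l (sqr_ge0 M) h1)).
    rewrite ee ler_wpM2r ?sqr_ge0//; nra.
  + have -> : (fun x => derive1 w x * phi x + w x * dphi x) \-
        derive1 (w \* theta) = fun x => derive1 w x * (phi x - theta x) +
          w x * (dphi x - derive1 theta x).
      by apply/funext => x; rewrite /= derive1M//; ring.
    have d3 := bounded_L2M mw' wN d1; have d4 := bounded_L2M mw wM d2.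
    apply/(L2norm_le (L2_sq (L2D d3 d4)) (ltW e0)).
    apply: (le_trans (Rintegral_sqD_le d3 d4)).
    have k1 := Rintegral_bounded_sq_le mw' wN d1.
    have k2 := Rintegral_bounded_sq_le mw wM d2.
    have k3 := le_trans k1 (ler_wpM2l (sqr_ge0 N) h1).
    have k4 := le_trans k2 (ler_wpM2l (sqr_ge0 M) h2).
    apply: (@le_trans _ _ (2 * (N ^+ 2 * e' ^+ 2) + 2 * (M ^+ 2 * e' ^+ 2))).
      by rewrite lerD// ler_wpM2l.
    rewrite ee -!mulrDr -mulrDl mulrA ler_wpM2r ?sqr_ge0//.
    by nra.
Qed.

End L2_functions.

(** * The chain rule in H^1_0 *)

Section chain_rule.
Context (R : realType).
Implicit Types (u ux theta w : R -> R) (e : R).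

Local Notation I := (leb (0 : R) 1).
Local Notation integ f := (I.-integrable setT (EFin \o f)).

(** [theta] vanishes at 0, so the fundamental theorem of calculus applies on [(0, x)]. This is the
    source of the one-dimensional Sobolev bound. *)
Lemma test_function_le_derive1 theta x : test_function 0 1 theta ->
  `|theta x| <= \int[I]_x `|derive1 theta x|.
Proof.
move=> tt; have st := test_function_smooth tt.
have [/andP[x0 x1]|h] := pselect (0 < x < 1); last first.
  by rewrite (test_function_eq0 tt h) normr0; exact: Rintegral_ge0.
have -> : theta x = \int[leb 0 x]_y derive1 theta y.
  rewrite integral_derive1// (@test_function_eq0 _ 0 1 theta 0) ?subr0//.
  by rewrite ltxx.
have c' := smooth_continuous (smooth_derive1 st).
apply: (le_trans (le_normr_Rintegral measurableT (continuous_integ_leb 0 x c'))).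
have ni (a b : R) : (leb a b).-integrable setT
    (EFin \o (fun y => `|derive1 theta y|)).
  exact/integ_norm/continuous_integ_leb.
have mn : measurable_fun setT (fun y => `|derive1 theta y|%:E).
  by apply/measurable_EFinP; exact: integ_measurable (ni 0 1).
have E (a b : R) := ge0_integral_leb a b mn (fun y => normr_ge0 (derive1 theta y)).
rewrite -lee_fin -(integ_integral (ni 0 x)) -(integ_integral (ni 0 1)) !E.
apply: ge0_subset_integral => //=; first exact: measurable_funTS.
by move=> y; rewrite /= !in_itv/= => /andP[-> /lt_trans]; exact.
Qed.

Lemma exprn_lip n (B : R) : 0 <= B -> exists2 L : R, 0 <= L &
  forall x y, `|x| <= B -> `|y| <= B -> `|x ^+ n - y ^+ n| <= L * `|x - y|.
Proof.
move=> B0; elim: n => [|n [L L0 hL]].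
  by exists 0 => // x y _ _; rewrite !expr0 subrr normr0 mul0r.
exists (B * L + B ^+ n); first by rewrite addr_ge0 ?mulr_ge0 ?exprn_ge0.
move=> x y xB yB; rewrite !exprS.
have -> : x * x ^+ n - y * y ^+ n = x * (x ^+ n - y ^+ n) + (x - y) * y ^+ n.
  by ring.
rewrite [leRHS]mulrDl; apply: (le_trans (ler_normD _ _)); apply: lerD.
  by rewrite normrM -mulrA ler_pM// hL.
by rewrite normrM mulrC ler_wpM2r// normrX lerXn2r ?nnegrE.
Qed.

(** The approximating test functions share one sup bound [B], because their derivatives stay bounded
    in [L^2]; truncating [u] at height [B] then changes it only on a null set. Bounded approximants
    are what allows powers of [u] to pass to the limit. *)
Lemma H10_bounded u ux : H10 u ux -> exists (B : R) (v : R -> R),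
  [/\ 0 <= B, measurable_fun setT v, forall x, `|v x| <= B,
      \forall x \ae I, u x = v x &
      forall e, 0 < e -> exists theta, [/\ test_function 0 1 theta,
        forall x, `|theta x| <= B,
        \int[I]_x ((v x - theta x) ^+ 2) <= e ^+ 2 &
        \int[I]_x ((ux x - derive1 theta x) ^+ 2) <= e ^+ 2]].
Proof.
move=> [u2 ux2 _ app].
pose K : R := \int[I]_x 1.
(* [|theta|] is at most the integral of [|theta'| <= theta'^2 + 1], and [theta'^2] has integral at
   most [2 int ux^2 + 2] when [theta'] is within 1 of [ux] in [L^2]; [K] is the integral of 1. *)
pose B := 2 * \int[I]_x (ux x ^+ 2) + 2 + K.
have K0 : 0 <= K by exact: Rintegral_ge0.
have iux := L2_sq ux2.
have B0 : 0 <= B by rewrite !addr_ge0// mulr_ge0//;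
  apply: Rintegral_ge0 => ? _; exact: sqr_ge0.
have mu' := L2_measurable u2.
pose v x := Num.max (- B) (Num.min B (u x)).
have mv : measurable_fun setT v.
  by apply: measurable_maxr => //; exact: measurable_minr.
have vB x : `|v x| <= B.
  rewrite /v ler_norml le_max lexx/= ge_max ge_min lexx/= andbT.
  by rewrite -subr_ge0 opprK addr_ge0.
have vlip x (y : R) : `|y| <= B -> `|v x - y| <= `|u x - y|.
  move=> yB; have := yB; rewrite ler_norml => /andP[y1 y2].
  rewrite /v; case: (leP B (u x)) => h1.
    rewrite max_r; last lra.
    by rewrite !ger0_norm; lra.
  case: (leP (- B) (u x)) => // h2.
  by rewrite !ler0_norm; lra.
have app' e : 0 < e -> exists theta, [/\ test_function 0 1 theta,
        forall x, `|theta x| <= B,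
        \int[I]_x ((u x - theta x) ^+ 2) <= e ^+ 2 &
        \int[I]_x ((ux x - derive1 theta x) ^+ 2) <= e ^+ 2].
  (* Accuracy at most 1 keeps the bound [B] independent of [e]. *)
  move=> e0; pose e' := Num.min e 1.
  have e'0 : 0 < e' by rewrite lt_min e0 ltr01.
  have [theta [tt h1 h2]] := app e' e'0.
  have d1 : L2 (fun x => u x - theta x) by exact/L2B/test_function_L2.
  have d2 : L2 (fun x => ux x - derive1 theta x).
    exact/L2B/test_function_derive1_L2.
  move: h1 => /(L2norm_le (L2_sq d1) (ltW e'0)) h1.
  move: h2 => /(L2norm_le (L2_sq d2) (ltW e'0)) h2.
  have ee : e' ^+ 2 <= e ^+ 2.
    by rewrite ler_sqr ?nnegrE ?(ltW e0) ?(ltW e'0)// ge_min lexx.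
  have ee1 : e' ^+ 2 <= 1.
    by rewrite expr_le1 ?(ltW e'0)// ge_min lexx orbT.
  exists theta; split => //; [|exact: le_trans ee|exact: le_trans ee].
  move=> x; apply: (le_trans (test_function_le_derive1 x tt)).
  have t2 := L2_sq (test_function_derive1_L2 tt).
  have tb : \int[I]_x (derive1 theta x ^+ 2) <= 2 * \int[I]_x (ux x ^+ 2) + 2.
    have := Rintegral_sqD_le ux2 (L2Z (-1) d2).
    under eq_Rintegral do rewrite mulN1r opprB addrC subrK.
    under [X in _ <= _ + 2 * X -> _]eq_Rintegral do rewrite mulN1r sqrrN.
    move=> h; apply: (le_trans h); rewrite lerD2l; lra.
  apply: (@le_trans _ _ (\int[I]_x (derive1 theta x ^+ 2 + 1))).
    apply: le_Rintegral => //.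
    - apply/integ_norm/continuous_integ_leb/smooth_continuous/smooth_derive1.
      exact: test_function_smooth tt.
    - by apply: integD t2 _; exact: finite_measure_integrable_cst.
    - move=> y _; rewrite -(real_normK (num_real (derive1 theta y))).
      have := sqr_ge0 (`|derive1 theta y| - 1); have := normr_ge0 (derive1 theta y).
      nra.
  rewrite RintegralD//; first by rewrite lerD2r.
  exact: finite_measure_integrable_cst.
have L2v : L2 v by exact: L2_bounded vB.
exists B, v; split => //.
- have d0 : L2 (fun x => u x - v x) by exact: L2B.
  (* Truncation to [[-B, B]] moves [u x] by no more than its distance to any [theta x] in that
     interval, so [u] is as close to [v] as to every approximant. *)
  have i0 : \int[I]_x ((u x - v x) ^+ 2) = 0.
    apply/eqP; rewrite eq_le Rintegral_ge0 ?andbT; last by move=> ? _; exact: sqr_ge0.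
    apply/ler_addgt0Pl => e e0; rewrite addr0.
    have s0 : 0 < Num.sqrt e by rewrite sqrtr_gt0.
    have [theta [tt tB h1 h2]] := app' _ s0.
    rewrite (sqr_sqrtr (ltW e0)) in h1; apply: le_trans h1.
    have d1 : L2 (fun x => u x - theta x) by exact/L2B/test_function_L2.
    apply: le_Rintegral => //; [exact: L2_sq d0|exact: L2_sq d1|] => x _.
    rewrite -(real_normK (num_real (u x - v x))).
    rewrite -(real_normK (num_real (u x - theta x))).
    rewrite ler_sqr ?nnegrE//.
    have := tB x; rewrite ler_norml => /andP[y1 y2].
    rewrite /v; case: (leP B (u x)) => h3.
      rewrite max_r; last lra.
      by rewrite !ger0_norm; lra.
    case: (leP (- B) (u x)) => h4; first by rewrite subrr normr0.
    by rewrite !ler0_norm; lra.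
  have mi : measurable_fun setT (fun x => (u x - v x) ^+ 2).
    by have := integ_measurable (L2_sq d0).
  have := @ae_eq_integral_abs _ _ _ I setT measurableT
    (EFin \o (fun x => (u x - v x) ^+ 2)).
  move=> /(_ _)[|+ _]; first exact/measurable_EFinP.
  under eq_integral do rewrite /= ger0_norm ?sqr_ge0//.
  rewrite (integ_integral (L2_sq d0)) i0 => /(_ erefl).
  apply: filterS => x /(_ Logic.I) [] /eqP; rewrite sqrf_eq0 subr_eq0.
  by move/eqP.
- move=> e e0; have [theta [tt tB h1 h2]] := app' e e0.
  exists theta; split => //; apply: le_trans h1.
  have d1 : L2 (fun x => u x - theta x) by exact/L2B/test_function_L2.
  have d2 : L2 (fun x => v x - theta x) by exact/L2B/test_function_L2.
  apply: le_Rintegral => //; [exact: L2_sq d2|exact: L2_sq d1|] => x _.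
  rewrite -(real_normK (num_real (v x - theta x))).
  rewrite -(real_normK (num_real (u x - theta x))).
  by rewrite ler_sqr ?nnegrE// vlip.
Qed.

Lemma L2M_le (f g : R -> R) (l : R) : 0 < l -> L2 f -> L2 g ->
  \int[I]_x (g x ^+ 2) <= l ^+ 2 ->
  \int[I]_x `|f x * g x| <= l * (\int[I]_x (f x ^+ 2) + 1).
Proof.
by move=> l0 /L2P[? ?] /L2P[? ?] gl; exact: Rintegral_sqM_le.
Qed.

Lemma derive1X (f : R -> R) k x : smooth f ->
  derive1 (fun y => f y ^+ k.+1) x = k.+1%:R * (f x ^+ k * derive1 f x).
Proof.
move=> sf; rewrite !derive1E.
have -> : (fun y => f y ^+ k.+1) = f ^+ k.+1.
  by apply/funext => y; rewrite fctE.
rewrite deriveX; last exact: smooth_derivable.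
by rewrite /GRing.scale/= mulrA; congr (_ * _); rewrite mulr_natl.
Qed.

(** Says that the derivative of [w u^(k+1)] integrates to 0. For a test function in place of [u]
    this is the fundamental theorem of calculus, as [w] vanishes at both ends; the limit uses that
    powers are Lipschitz on [[-B, B]]. *)
Lemma H10_chain_rule u ux w k : H10 u ux -> test_function 0 1 w ->
  k.+1%:R * \int[I]_x (w x * u x ^+ k * ux x) =
  - \int[I]_x (derive1 w x * u x ^+ k.+1).
Proof.
move=> h tw; have [u2 ux2 _ _] := h; have sw := test_function_smooth tw.
have mu' := L2_measurable u2; have mux := L2_measurable ux2.
have mw := smooth_measurable sw.
have mw' := smooth_measurable (smooth_derive1 sw).
have [M M0 wM] := test_function_bounded tw.
have [N N0 wN] := test_function_derive_bounded tw.
have [B [v [B0 mv vB uv app]]] := H10_bounded h.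
have L2v : L2 v by exact: L2_bounded vB.
(* The derivative of [w f^(k+1)] when [df] is the derivative of [f]. *)
pose F (f df : R -> R) x :=
  derive1 w x * f x ^+ k.+1 + k.+1%:R * (w x * f x ^+ k * df x).
have vk j x : `|v x ^+ j| <= B ^+ j by rewrite normrX lerXn2r ?nnegrE.
have i1 (f : R -> R) : measurable_fun setT f -> (forall x, `|f x| <= B) ->
    integ (fun x => derive1 w x * f x ^+ k.+1).
  move=> mf fB; apply: (integ_dom (g := fun=> N * B ^+ k.+1)).
  - by apply: measurable_funM => //; exact: measurable_funX.
  - exact: finite_measure_integrable_cst.
  - by move=> x; rewrite normrM ler_pM// normrX lerXn2r ?nnegrE.
have i2 (f df : R -> R) : measurable_fun setT f -> (forall x, `|f x| <= B) ->
    L2 df -> integ (fun x => w x * f x ^+ k * df x).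
  move=> mf fB df2; apply: L2M => //.
  apply: (@bounded_L2M _ _ _ M) => //.
  apply: (@L2_bounded _ _ (B ^+ k)); first exact: measurable_funX.
  by move=> x; rewrite normrX lerXn2r ?nnegrE.
suff FX : \int[I]_x F v ux x = 0.
  have mX (f : R -> R) j : measurable_fun setT f ->
    measurable_fun setT (fun x => f x ^+ j) by move=> mf; exact: measurable_funX.
  have -> : \int[I]_x (w x * u x ^+ k * ux x) =
      \int[I]_x (w x * v x ^+ k * ux x).
    apply: ae_eq_Rintegral; last by apply: ae_imp uv => x ->.
      by apply: measurable_funM => //; apply: measurable_funM => //; exact: mX.
    by apply: measurable_funM => //; apply: measurable_funM => //; exact: mX.
  have -> : \int[I]_x (derive1 w x * u x ^+ k.+1) =
      \int[I]_x (derive1 w x * v x ^+ k.+1).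
    apply: ae_eq_Rintegral; last by apply: ae_imp uv => x ->.
      by apply: measurable_funM => //; exact: mX.
    by apply: measurable_funM => //; exact: mX.
  move: FX; rewrite RintegralD//; [|exact: i1|exact/integZ/i2].
  rewrite RintegralZl//; last exact: i2.
  by move=> FX; apply/eqP; rewrite -addr_eq0 addrC FX.
have [L1 L10 lip1] := exprn_lip k.+1 B0.
have [L2' L20 lip2] := exprn_lip k B0.
(* The coefficients of the three errors made in replacing [(v, ux)] by [(theta, theta')]: in the
   power [k.+1], in the power [k], and in the derivative. *)
pose C := N * L1 + k.+1%:R * M * L2' + k.+1%:R * M * B ^+ k.
have C0 : 0 <= C by rewrite !addr_ge0 ?mulr_ge0 ?exprn_ge0.
pose K : R := \int[I]_x (1 ^+ 2).
pose K1 : R := \int[I]_x (ux x ^+ 2).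
have K0 : 0 <= K by apply: Rintegral_ge0 => ? _; exact: sqr_ge0.
have K10 : 0 <= K1 by apply: Rintegral_ge0 => ? _; exact: sqr_ge0.
pose A := C * (2 * (K + 1) + (K1 + 1)).
have A0 : 0 <= A by rewrite mulr_ge0// addr_ge0 ?mulr_ge0 ?addr_ge0.
suff est e : 0 < e -> `|\int[I]_x F v ux x| <= A * e.
  apply/eqP; rewrite -normr_le0; apply/ler_addgt0Pl => e e0; rewrite addr0.
  have A1 : 0 < A + 1 by rewrite ltr_wpDl.
  apply: (le_trans (est (e / (A + 1)) _)); first by rewrite divr_gt0.
  rewrite mulrA ler_pdivrMr// mulrDr mulr1 mulrC lerDl; exact: ltW.
move=> e0; have [theta [tt tB h1 h2]] := app e e0.
have st := test_function_smooth tt; have mt := smooth_measurable st.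
have t2' := test_function_derive1_L2 tt.
have d1 : L2 (fun x => v x - theta x) by exact/L2B/test_function_L2.
have d2 : L2 (fun x => ux x - derive1 theta x) by exact/L2B.
have Ft : \int[I]_x F theta (derive1 theta) x = 0.
  have sp := @smoothM R w (fun x => theta x ^+ k.+1) sw (smoothX st).
  have := integral_derive1 (@ltr01 R) sp.
  rewrite /= (@test_function_eq0 _ 0 1 w 0)//; last by rewrite ltxx.
  rewrite (@test_function_eq0 _ 0 1 w 1)//; last by rewrite ltxx andbF.
  rewrite !mul0r subr0 => E0; rewrite -[RHS]E0; apply: eq_Rintegral => x _.
  rewrite (derive1M x sw (smoothX st)).
  by rewrite derive1X// /F; ring.
have iF (f df : R -> R) : measurable_fun setT f -> (forall x, `|f x| <= B) ->
    L2 df -> integ (F f df).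
  by move=> mf fB df2; apply: integD; [exact: i1|exact/integZ/i2].
have iFv := iF _ _ mv vB ux2; have iFt := iF _ _ mt tB t2'.
have -> : \int[I]_x F v ux x =
    \int[I]_x (F v ux x - F theta (derive1 theta) x).
  by rewrite RintegralB// Ft subr0.
apply: (le_trans (le_normr_Rintegral measurableT (integB iFv iFt))).
have L21 := L2_cst (1 : R).
have j1 : integ (fun x => 1 * (v x - theta x)) by exact: L2M.
have j2 : integ (fun x => ux x * (v x - theta x)) by exact: L2M.
have j3 : integ (fun x => 1 * (ux x - derive1 theta x)) by exact: L2M.
apply: (@le_trans _ _ (\int[I]_x (C * (`|1 * (v x - theta x)| +
    `|ux x * (v x - theta x)| + `|1 * (ux x - derive1 theta x)|)))).
  apply: le_Rintegral => //; first exact/integ_norm/integB.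
    by apply: integZ; apply: integD; [apply: integD|]; exact: integ_norm.
  move=> x _; rewrite !mul1r normrM.
  have -> : F v ux x - F theta (derive1 theta) x =
    derive1 w x * (v x ^+ k.+1 - theta x ^+ k.+1) +
    k.+1%:R * w x * (v x ^+ k - theta x ^+ k) * ux x +
    k.+1%:R * w x * theta x ^+ k * (ux x - derive1 theta x).
    by rewrite /F; ring.
  have q1 : `|derive1 w x * (v x ^+ k.+1 - theta x ^+ k.+1)| <=
      N * L1 * `|v x - theta x|.
    by rewrite normrM -mulrA ler_pM// lip1.
  have kw : `|k.+1%:R * w x| <= k.+1%:R * M.
    by rewrite normrM normr_nat ler_wpM2l.
  have q2 : `|k.+1%:R * w x * (v x ^+ k - theta x ^+ k) * ux x| <=
      k.+1%:R * M * L2' * (`|ux x| * `|v x - theta x|).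
    rewrite normrM [`|ux x| * _]mulrC mulrA ler_wpM2r//.
    by rewrite normrM -mulrA ler_pM// lip2.
  have q3 : `|k.+1%:R * w x * theta x ^+ k * (ux x - derive1 theta x)| <=
      k.+1%:R * M * B ^+ k * `|ux x - derive1 theta x|.
    rewrite normrM ler_wpM2r// normrM ler_pM//.
    by rewrite normrX lerXn2r ?nnegrE.
  have := ler_normD (derive1 w x * (v x ^+ k.+1 - theta x ^+ k.+1) +
    k.+1%:R * w x * (v x ^+ k - theta x ^+ k) * ux x)
    (k.+1%:R * w x * theta x ^+ k * (ux x - derive1 theta x)).
  have := ler_normD (derive1 w x * (v x ^+ k.+1 - theta x ^+ k.+1))
    (k.+1%:R * w x * (v x ^+ k - theta x ^+ k) * ux x).
  have a1 : 0 <= N * L1 by rewrite mulr_ge0.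
  have a2 : 0 <= k.+1%:R * M * L2' by rewrite !mulr_ge0.
  have a3 : 0 <= k.+1%:R * M * B ^+ k by rewrite !mulr_ge0 ?exprn_ge0.
  have b1 := normr_ge0 (v x - theta x).
  have b2 : 0 <= `|ux x| * `|v x - theta x| by rewrite mulr_ge0.
  have b3 := normr_ge0 (ux x - derive1 theta x).
  move: q1 q2 q3 a1 a2 a3 b1 b2 b3; rewrite /C.
  move: (N * L1) (k.+1%:R * M * L2') (k.+1%:R * M * B ^+ k).
  move: (`|ux x| * `|v x - theta x|) (`|v x - theta x|).
  move: (`|ux x - derive1 theta x|) => x3 x2 x1 c1 c2 c3 *.
  nra.
rewrite RintegralZl//; last first.
  by apply: integD; [apply: integD|]; exact: integ_norm.
rewrite RintegralD//; [|by apply: integD; exact: integ_norm|exact: integ_norm].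
rewrite RintegralD//; [|exact: integ_norm|exact: integ_norm].
have r1 := L2M_le e0 L21 d1 h1.
have r2 := L2M_le e0 ux2 d1 h1.
have r3 := L2M_le e0 L21 d2 h2.
rewrite /A -mulrA ler_wpM2l//.
apply: (le_trans (lerD (lerD r1 r2) r3)).
rewrite -/K -/K1; lra.
Qed.

End chain_rule.

(** * The fundamental lemma of the calculus of variations *)

Section fundamental_lemma.
Context (R : realType).
Implicit Types (f g F G : R -> R).

Lemma derive1_step_eq0 (x : R) : ~ (0 <= x <= 1) -> derive1 step x = 0.
Proof.
move=> /negP; rewrite negb_and -!ltNge => /orP[x0|x1].
  rewrite derive1E (@near_eq_derive _ _ _ step (cst 0)) ?derive_cst//.
  near=> y; apply: step0; apply: ltW; near: y; exact: lt_nbhsl.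
rewrite derive1E (@near_eq_derive _ _ _ step (cst 1)) ?derive_cst//.
near=> y; apply: step1; apply: ltW; near: y; exact: lt_nbhsr.
Unshelve. all: by end_near. Qed.

Lemma derive1_step_bounded : exists2 M : R, 0 <= M &
  forall x, `|derive1 step x| <= M.
Proof.
apply: (@continuous_supported_bounded _ _ (-1) 2).
  exact/smooth_continuous/smooth_derive1/smooth_step.
move=> x h; apply: derive1_step_eq0 => /andP[x0 x1]; apply: h.
by apply/andP; split; lra.
Qed.

Lemma leb_itv_le (a b c d : R) : c <= d -> (leb a b `[c, d]%classic <= (d - c)%:E)%E.
Proof.
move=> cd; rewrite lebE.
apply: (@le_trans _ _ (lebesgue_measure `[c, d]%classic)).
  by apply: le_measure; rewrite ?inE//=; exact: measurableI.
by rewrite lebesgue_measure_itv /= lte_fin; case: ifP => // _; rewrite lee_fin subr_ge0.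
Qed.

Section mollification.
Variable T : R.
Hypothesis T0 : 0 < T.
Local Notation I := (leb (0 : R) T).
Local Notation integ f := (I.-integrable setT (EFin \o f)).

(** The kernel is the derivative of a step squeezed into [[p, p + 1/(n+1)]]; it has integral 1 as
    soon as this interval lies inside [(0, T)]. Hence the limit is the value of the continuous
    representative at [p]. *)
Lemma mollify_cvg G g (p : R) : 0 < p < T -> integ G ->
  (\forall r \ae I, G r = g r) -> {for p, continuous g} ->
  \int[I]_r (G r * (n.+1%:R * derive1 step (n.+1%:R * r + - (n.+1%:R * p))))
    @[n --> \oo] --> g p.
Proof.
move=> /andP[p0 pT] iG Gg cg.
have mG := integ_measurable iG.
have [M M0 hM] := derive1_step_bounded.
have sk (n : nat) : smooth (fun r => step (n.+1%:R * r + - (n.+1%:R * p))).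
  exact: smooth_affine (@smooth_step R).
pose rho (n : nat) r := n.+1%:R * derive1 step (n.+1%:R * r + - (n.+1%:R * p)).
have rhoE n : derive1 (fun r => step (n.+1%:R * r + - (n.+1%:R * p))) = rho n.
  by rewrite derive1_affine// => x; exact/smooth_derivable/smooth_step.
have mrho n : measurable_fun setT (rho n).
  by rewrite -rhoE; exact: smooth_measurable (smooth_derive1 (sk n)).
have rhoM n r : `|rho n r| <= n.+1%:R * M.
  by rewrite normrM normr_nat ler_wpM2l.
have irho n : integ (rho n).
  by rewrite -rhoE; apply/continuous_integ_leb/smooth_continuous/smooth_derive1.
have iGrho n : integ (fun r => G r * rho n r).
  apply: (integ_dom _ (integZ (n.+1%:R * M) (integ_norm iG))).
    by apply: measurable_funM; [exact: mG|exact: mrho].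
  by move=> r; rewrite normrM mulrC ler_wpM2r.
apply/cvgrPdist_le => e e0.
have M1 : 0 < M + 1 by rewrite ltr_wpDl.
(* The sign of [derive1 step] is not recorded, so the [L^1] norm of the kernel is bounded by its sup
   [(n+1) M] times the length [1/(n+1)] of its support. *)
have : \forall r \near p, `|g p - g r| <= e / (M + 1).
  by move/cvgrPdist_le : cg; apply; rewrite divr_gt0.
move=> /nbhs_ballP[d /= d0 hd].
near=> n.
have n1 : n.+1%:R^-1 < d.
  by near: n; exact: (near_infty_natSinv_lt (PosNum d0)).
have nT : n.+1%:R^-1 < T - p.
  by near: n; apply: (near_infty_natSinv_lt (PosNum _)); rewrite subr_gt0.
have nn : 0 < n.+1%:R :> R by rewrite ltr0n.
have int1 : \int[I]_r rho n r = 1.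
  rewrite -rhoE (integral_derive1 T0 (sk n)) step1; last first.
    by rewrite -mulrBr mulrC -ler_pdivrMr// mul1r ltW.
  by rewrite step0 ?subr0// mulr0 add0r oppr_le0 mulr_ge0// ltW.
have igr : integ (fun r => g p * rho n r) by exact: integZ.
rewrite (_ : g p - _ = \int[I]_r (g p * rho n r - G r * rho n r)); last first.
  by rewrite (RintegralB measurableT igr (iGrho n)) RintegralZl// int1 mulr1.
have iD : integ (fun r => g p * rho n r - G r * rho n r).
  by exact: integB.
apply: (le_trans (le_normr_Rintegral measurableT iD)).
pose J : set R := `[p, p + n.+1%:R^-1]%classic.
have mJ : measurable J by exact: measurable_itv.
have i1J : integ (fun r => \1_J r) by exact: integrable_indic.
apply: (@le_trans _ _ (\int[I]_r (n.+1%:R * e * \1_J r))).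
  apply: ae_le_Rintegral; [exact: integ_norm|exact: integZ|].
  apply: ae_imp Gg => r Ggr; rewrite -mulrBl normrM Ggr.
  rewrite indicE; have [rJ|rJ] := boolP (r \in J); last first.
    rewrite /rho derive1_step_eq0 ?mulr0 ?normr0 ?mulr0// => /andP[h1 h2].
    move/negP: rJ; apply; rewrite inE /J /= in_itv/=.
    move: h1 h2; rewrite -mulrBr pmulr_rge0// subr_ge0 => ->/=.
    by rewrite mulrC -ler_pdivlMr// mul1r lerBlDl.
  rewrite mulr1 mulrC; move: rJ; rewrite inE /J /= in_itv/= => /andP[r1 r2].
  have gr : `|g p - g r| <= e / (M + 1).
    apply: hd; rewrite /ball/= distrC ger0_norm ?subr_ge0//.
    by rewrite (le_lt_trans _ n1)// lerBlDl.
  apply: (le_trans (ler_pM (normr_ge0 _) (normr_ge0 _) (rhoM n r) gr)).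
  rewrite -mulrA ler_wpM2l// mulrCA ger_pMr// ler_pdivrMr// mul1r lerDl.
  exact: ler01.
rewrite RintegralZl//.
have -> : \int[I]_r \1_J r = fine (I J).
  by rewrite /Rintegral integral_indic// setIT.
have IJ : fine (I J) <= n.+1%:R^-1.
  have := @leb_itv_le 0 T p (p + n.+1%:R^-1); rewrite lerDl invr_ge0 ltW//.
  move=> /(_ isT); rewrite addrAC subrr add0r.
  by rewrite -lee_fin fineK//; exact: fin_num_measure.
by rewrite mulrAC ger_pMl// mulrC -ler_pdivlMr// mul1r.
Unshelve. all: by end_near. Qed.

(** Smooth approximations of the indicator of []s, t]] are used as [theta]: the left side tends to
    the integral over []s, t]] by dominated convergence, and [theta'] is a difference of two
    mollifiers, at [s] and at [t]. *)
Lemma du_bois_reymond F G g (s t : R) : 0 < s -> s < t -> t < T ->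
  integ F -> integ G -> (\forall r \ae I, G r = g r) ->
  {for s, continuous g} -> {for t, continuous g} ->
  (forall theta, test_function 0 T theta ->
    \int[I]_r (F r * theta r) = - \int[I]_r (G r * derive1 theta r)) ->
  g t - g s = \int[I]_r (F r * \1_`]s, t] r).
Proof.
move=> s0 st tT iF iG Gg cs ct FG.
pose th (p : R) (n : nat) r := step (n.+1%:R * r + - (n.+1%:R * p)).
have sth p n : smooth (th p n) by exact: smooth_affine (@smooth_step R).
have dth p n r : derive1 (th p n) r =
    n.+1%:R * derive1 step (n.+1%:R * r + - (n.+1%:R * p)).
  by rewrite derive1_affine// => x; exact/smooth_derivable/smooth_step.
(* Each step starts to the right of its base point, so [theta n] tends to the indicator of []s, t]]
   at every point, with the value 0 at [s] and 1 at [t]. Its support lies in [(0, T)] only for large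
   [n]. *)
pose theta n r := th s n r + -1 * th t n r.
have stheta n : smooth (theta n).
  by apply: smoothD => //; apply: (@smoothM _ (cst (-1))) => //; exact: smooth_cst.
have dtheta n r : derive1 (theta n) r = derive1 (th s n) r - derive1 (th t n) r.
  have -> : theta n = th s n \- th t n.
    by apply/funext => x; rewrite /theta /= mulN1r.
  by rewrite derive1E deriveB ?derive1E//; exact: smooth_derivable.
have kpos n : 0 < n.+1%:R :> R by rewrite ltr0n.
have th0 p n r : r <= p -> th p n r = 0.
  by move=> rp; apply: step0; rewrite -mulrBr pmulr_rle0 ?subr_le0.
have th1 p n r : n.+1%:R^-1 <= r - p -> th p n r = 1.
  by move=> rp; apply: step1; rewrite -mulrBr mulrC -ler_pdivrMr ?mul1r.
have tht n : n.+1%:R^-1 < T - t -> test_function 0 T (theta n).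
  move=> nT; apply: (@test_functionI _ 0 T s (t + n.+1%:R^-1)) => //.
    by rewrite addrC -ltrBrDr.
  move=> r; apply: contraR; rewrite negb_and -!ltNge => /orP[rs|tr].
    by rewrite /theta !th0 ?mulr0 ?addr0// ltW// (lt_trans rs).
  rewrite /theta !th1 ?mulr1 ?subrr//.
    by rewrite lerBrDl ltW.
  by rewrite lerBrDl ltW// (le_lt_trans _ tr)// lerD2r ltW.
have mF := integ_measurable iF.
have mth p n : measurable_fun setT (th p n) by exact: smooth_measurable.
have mdth p n : measurable_fun setT (derive1 (th p n)).
  exact: smooth_measurable (smooth_derive1 (sth p n)).
have [M M0 hM] := derive1_step_bounded.
have iGth p n : integ (fun r => G r * derive1 (th p n) r).
  apply: (integ_dom _ (integZ (n.+1%:R * M) (integ_norm iG))).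
    apply: measurable_funM; [exact: integ_measurable iG|exact: mdth].
  by move=> r; rewrite dth !normrM normr_nat mulrC ler_wpM2r// ler_wpM2l.
have theta_le1 n r : `|theta n r| <= 1.
  rewrite /theta mulN1r ler_norml; apply/andP.
  have a1 : 0 <= th s n r by exact: step_ge0.
  have a2 : th s n r <= 1 by exact: step_le1.
  have b1 : 0 <= th t n r by exact: step_ge0.
  have b2 : th t n r <= 1 by exact: step_le1.
  split; lra.
have mFt n : measurable_fun setT (fun r => F r * theta n r).
  apply: measurable_funM; first exact: mF.
  exact: smooth_measurable (stheta n).
have iFt n : integ (fun r => F r * theta n r).
  apply: (integ_dom _ (integ_norm iF)) => [|r]; first exact: mFt.
  by rewrite normrM -[leRHS]mulr1 ler_wpM2l.
have lim1 : \int[I]_r (F r * theta n r) @[n --> \oo] -->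
    \int[I]_r (F r * \1_`]s, t] r).
  have mlim : measurable_fun setT (fun r => F r * \1_`]s, t] r).
    apply: measurable_funM; first exact: mF.
    by apply: measurable_indic; exact: measurable_itv.
  have ilim : integ (fun r => F r * \1_`]s, t] r).
    apply: (integ_dom _ (integ_norm iF)) => [|r]; first exact: mlim.
    by rewrite normrM indicE normr_nat; case: (_ \in _); rewrite ?mulr1 ?mulr0.
  apply: (dominated_cvg_Rintegral _ ilim (integ_norm iF)).
  - exact: mFt.
  - move=> r.
      apply: cvgM; first exact: cvg_cst.
      apply: (@cvg_near_cst _ _ _ _ _ _ _).
      rewrite indicE (_ : (r \in _) = (s < r <= t)); last first.
        by apply/idP/idP; rewrite inE /= in_itv.
      have [rs|sr] := leP r s.
        by near=> n; rewrite /theta /= !th0 ?mulr0 ?addr0// (le_trans rs)// ltW.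
      have [rt|tr] := leP r t.
        near=> n; rewrite /theta /= th1; last first.
          rewrite ltW//; near: n; apply: (near_infty_natSinv_lt (PosNum _)).
          by rewrite subr_gt0.
        by rewrite th0// mulr0 addr0.
      near=> n; rewrite /theta /= !th1 ?mulr1 ?subrr//.
        rewrite ltW//; near: n; apply: (near_infty_natSinv_lt (PosNum _)).
        by rewrite subr_gt0.
      rewrite ltW//; near: n; apply: (near_infty_natSinv_lt (PosNum _)).
      by rewrite subr_gt0.
  - by move=> n r; rewrite normrM -[leRHS]mulr1 ler_wpM2l.
have lim2 : (- \int[I]_r (G r * derive1 (theta n) r)) @[n --> \oo] --> - (g s - g t).
  apply: cvgN.
  have e n : \int[I]_r (G r * derive1 (theta n) r) =
     \int[I]_r (G r * (n.+1%:R * derive1 step (n.+1%:R * r + - (n.+1%:R * s)))) -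
     \int[I]_r (G r * (n.+1%:R * derive1 step (n.+1%:R * r + - (n.+1%:R * t)))).
    under eq_Rintegral do rewrite dtheta mulrBr.
    rewrite RintegralB//.
    by congr (_ - _); apply: eq_Rintegral => r _; rewrite dth.
  under eq_fun do rewrite e.
  apply: cvgB.
    by apply: mollify_cvg => //; rewrite s0/= (lt_trans st).
  by apply: mollify_cvg => //; rewrite tT (lt_trans s0 st).
have lim3 : (- \int[I]_r (G r * derive1 (theta n) r)) @[n --> \oo] -->
    \int[I]_r (F r * \1_`]s, t] r).
  apply: cvg_trans lim1; apply: near_eq_cvg; near=> n; rewrite FG//.
  apply: tht; near: n; apply: (near_infty_natSinv_lt (PosNum _)).
  by rewrite subr_gt0.
rewrite -(cvg_lim (@Rhausdorff R) lim3) (cvg_lim (@Rhausdorff R) lim2).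
by rewrite opprB.
Unshelve. all: by end_near. Qed.

Lemma integ_indicM F (J : set R) : measurable J -> integ F ->
  integ (fun r => F r * \1_J r).
Proof.
move=> mJ iF; apply: (integ_dom _ (integ_norm iF)) => [|r].
  apply: measurable_funM; first exact: integ_measurable iF.
  exact: measurable_indic.
by rewrite normrM indicE normr_nat; case: (_ \in _); rewrite ?mulr1 ?mulr0.
Qed.

(** The base point [s = 1/(n+1)] is sent to 0, where [g] tends to 0. This is how the initial datum
    enters. *)
Lemma du_bois_reymond0 F G g (t : R) : 0 < t < T ->
  integ F -> integ G -> (\forall r \ae I, G r = g r) ->
  (forall s, 0 < s < T -> {for s, continuous g}) ->
  g r @[r --> 0^'+] --> 0 ->
  (forall theta, test_function 0 T theta ->
    \int[I]_r (F r * theta r) = - \int[I]_r (G r * derive1 theta r)) ->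
  g t = \int[I]_r (F r * \1_`]0, t] r).
Proof.
move=> /andP[t0 tT] iF iG Gg cg g0 FG.
have mF := integ_measurable iF.
pose s n : R := n.+1%:R^-1.
have s0 n : 0 < s n by rewrite invr_gt0 ltr0n.
have cs : s n @[n --> \oo] --> (0 : R) by exact: cvg_harmonic.
have lim1 : (g t - g (s n)) @[n --> \oo] --> g t.
  rewrite -[X in _ --> X]subr0; apply: cvgB; first exact: cvg_cst.
  by move/cvg_at_rightP : g0; apply; split.
have lim2 : \int[I]_r (F r * \1_`]s n, t] r) @[n --> \oo] -->
    \int[I]_r (F r * \1_`]0, t] r).
  apply: (dominated_cvg_Rintegral _ _ (integ_norm iF)).
  - by move=> n; exact: (integ_measurable (integ_indicM (measurable_itv _) iF)).
  - exact: (integ_indicM (measurable_itv _) iF).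
  - move=> r; apply: cvgM; first exact: cvg_cst.
    apply: cvg_near_cst.
    have [r0|r0] := leP r 0.
      near=> n; rewrite !indicE; congr (_%:R).
      rewrite !memNset//= in_itv/= => /andP[]; first by rewrite ltNge r0.
      by rewrite ltNge (le_trans r0)// ltW.
    near=> n; rewrite !indicE; congr ((nat_of_bool _)%:R).
    have sr : s n < r by near: n; exact: (near_infty_natSinv_lt (PosNum r0)).
    by apply/idP/idP; rewrite !inE /= !in_itv/= => /andP[_ ->];
      rewrite ?r0 ?sr.
  - move=> n r; rewrite normrM indicE normr_nat.
    by case: (_ \in _); rewrite ?mulr1 ?mulr0.
have lim3 : (g t - g (s n)) @[n --> \oo] --> \int[I]_r (F r * \1_`]0, t] r).
  apply: cvg_trans lim2; apply: near_eq_cvg; near=> n.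
  have st : s n < t by near: n; exact: (near_infty_natSinv_lt (PosNum t0)).
  apply/esym/(@du_bois_reymond F G) => //.
    by apply: cg; rewrite s0 (lt_trans st).
  by apply: cg; rewrite t0.
by rewrite -(cvg_lim (@Rhausdorff R) lim1) (cvg_lim (@Rhausdorff R) lim3).
Unshelve. all: by end_near. Qed.

End mollification.

End fundamental_lemma.

(** * Continuity of time translations *)

Section triple_product.
Context d1 d2 d3 (T1 : measurableType d1) (T2 : measurableType d2)
  (T3 : measurableType d3) (R : realType).
Variable m1 : {finite_measure set T1 -> \bar R}.
Variable m2 : {finite_measure set T2 -> \bar R}.
Variable m3 : {finite_measure set T3 -> \bar R}.

(** Named so that the product can be declared a finite measure and serve as a factor of [prod3]. *)
Definition prod2 : set (T1 * T2) -> \bar R := (m1 \x m2)%E.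

HB.instance Definition _ := Measure.on prod2.

Let prod2_fin : fin_num_fun prod2.
Proof.
have e : prod2 setT = (m1 setT * m2 setT)%E.
  by rewrite -setXTT; exact: product_measure1E.
apply: lty_fin_num_fun; rewrite -[X in (X < _)%E]/(prod2 setT) e.
by rewrite ltey_eq fin_numM// fin_num_measure.
Qed.

HB.instance Definition _ := Measure_isFinite.Build _ _ _ prod2 prod2_fin.

Definition prod3 : set (T1 * T2 * T3) -> \bar R := (prod2 \x m3)%E.

HB.instance Definition _ := Measure.on prod3.

Variable f : T1 * T2 * T3 -> \bar R.
Hypothesis mf : measurable_fun setT f.
Hypothesis f0 : forall z, (0 <= f z)%E.

Lemma measurable_section_l x : measurable_fun setT (fun z => f (z, x)).
Proof. by apply: measurableT_comp => //; exact: pair2_measurable. Qed.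

(** Both orders of integration are needed: with [x] outermost, continuity of translations is applied
    for fixed [x]; with [t] outermost, the energy is averaged in time. *)
Lemma prod3_txr : (\int[prod3]_z f z =
  \int[m3]_x \int[m1]_t \int[m2]_r f (t, r, x))%E.
Proof.
rewrite (fubini_tonelli2 f mf f0); apply: eq_integral => x _.
by rewrite /fubini_G (fubini_tonelli1 _ (measurable_section_l x)).
Qed.

Lemma prod3_trx : (\int[prod3]_z f z =
  \int[m1]_t \int[m2]_r \int[m3]_x f (t, r, x))%E.
Proof.
rewrite (fubini_tonelli1 f mf f0).
rewrite (fubini_tonelli1 (fubini_F m3 f))//.
  exact: measurable_fun_fubini_tonelli_F.
by move=> z; exact: integral_ge0.
Qed.

Lemma measurable_prod3_txr :
  measurable_fun setT (fun x => \int[m1]_t \int[m2]_r f (t, r, x))%E.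
Proof.
have := @measurable_fun_fubini_tonelli_G _ _ _ _ _ prod2 f mf f0.
congr (measurable_fun setT); apply/funext => x.
by rewrite /fubini_G (fubini_tonelli1 _ (measurable_section_l x)).
Qed.

End triple_product.

(** * Averages over the time window [t - h < r <= t] *)

Section window.
Context (R : realType).
Implicit Types (g q : R -> R) (h e t r T : R).

Definition window h t r : R := \1_(`]t - h, t]%classic) r.

Lemma window_ge0 h t r : 0 <= window h t r.
Proof. by rewrite /window indicE ler0n. Qed.

Lemma window_in h t r : window h t r != 0 -> t - h < r <= t.
Proof.
rewrite /window indicE; have [|_] := boolP (r \in _); last by rewrite eqxx.
by rewrite inE /= in_itv.
Qed.

Lemma windowE h t r : window h t r = \1_(`[r, r + h[%classic) t.
Proof.
rewrite /window !indicE; congr ((nat_of_bool _)%:R).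
by apply/idP/idP; rewrite !inE /= !in_itv/= ltrBlDr => /andP[h1 h2]; apply/andP.
Qed.

Lemma measurable_window h :
  measurable_fun setT (fun z : R * R => window h z.1 z.2).
Proof.
have -> : (fun z : R * R => window h z.1 z.2) =
    \1_([set z | z.1 - h < z.2] `&` [set z | z.2 <= z.1]).
  apply/funext => z; rewrite /window !indicE; congr ((nat_of_bool _)%:R).
  apply/idP/idP; rewrite !inE /= in_itv/=; first by move/andP.
  by move=> [-> ->].
apply: measurable_indic; apply: measurableI; rewrite -[X in measurable X]setTI.
  apply: (@measurable_fun_ltr _ _ _ setT (fun z : R * R => z.1 - h) snd _ _
    measurableT [set true]) => //.
  exact: measurable_funB.
exact: (@measurable_fun_ler _ _ _ setT (@snd R R) fst _ _
    measurableT [set true]).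
Qed.

(** Only an upper bound, since the window may stick out of [(0, T)]. *)
Lemma window_int_r T h t : 0 <= h ->
  (\int[leb 0 T]_r (window h t r)%:E <= h%:E)%E.
Proof.
move=> h0; rewrite integral_indic ?setIT//.
apply: (@le_trans _ _ (leb 0 T `[t - h, t]%classic)).
  apply: le_measure; rewrite ?inE//=.
  by move=> x; rewrite /= !in_itv/= => /andP[/ltW -> ->].
apply: (le_trans (leb_itv_le _ _ _)); first by rewrite gerBl.
by rewrite opprB addrCA subrr addr0.
Qed.

Lemma window_int_t T h r : 0 <= h ->
  (\int[leb 0 T]_t (window h t r)%:E <= h%:E)%E.
Proof.
move=> h0; under eq_integral do rewrite windowE.
rewrite integral_indic ?setIT//.
apply: (@le_trans _ _ (leb 0 T `[r, r + h]%classic)).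
  apply: le_measure; rewrite ?inE//=.
  by move=> x; rewrite /= !in_itv/= => /andP[-> /ltW ->].
apply: (le_trans (leb_itv_le _ _ _)); first by rewrite lerDl.
by rewrite addrAC subrr add0r.
Qed.

Lemma measurable_window_r h t : measurable_fun setT (window h t).
Proof. exact: measurable_indic. Qed.

Lemma measurable_window_t h r : measurable_fun setT (window h ^~ r).
Proof.
have -> : window h ^~ r = \1_(`[r, r + h[%classic).
  by apply/funext => t; exact: windowE.
exact: measurable_indic.
Qed.

Lemma measurable_windowM h (f : R * R -> R) : measurable_fun setT f ->
  measurable_fun setT (fun z => (window h z.1 z.2 * f z)%:E).
Proof.
move=> mf; apply/measurable_EFinP; apply: measurable_funM => //.
exact: measurable_window.
Qed.

Lemma window_int2_t T h q : 0 <= h -> measurable_fun setT q ->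
  (forall r, 0 <= q r) ->
  (\int[leb 0 T]_t \int[leb 0 T]_r (window h t r * q t)%:E <=
   h%:E * \int[leb 0 T]_t (q t)%:E)%E.
Proof.
move=> h0 mq q0.
have mE : measurable_fun setT (fun t => (q t)%:E) by exact/measurable_EFinP.
have mf : measurable_fun setT (fun z : R * R => (window h z.1 z.2 * q z.1)%:E).
  apply: (@measurable_windowM h (fun z => q z.1)).
  exact: (measurableT_comp mq measurable_fst).
have f0 (z : R * R) : (0 <= (window h z.1 z.2 * q z.1)%:E)%E.
  by rewrite lee_fin mulr_ge0// window_ge0.
rewrite -ge0_integralZl//.
apply: ge0_le_integral => //.
- by move=> t _; apply: integral_ge0 => r _; rewrite lee_fin mulr_ge0// window_ge0.
- exact: (@measurable_fun_fubini_tonelli_F _ _ _ _ _ (leb 0 T) _ mf f0).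
- by apply: measurable_funeM.
- move=> t _; under eq_integral do rewrite mulrC EFinM.
  rewrite (@ge0_integralZl _ _ _ (leb 0 T) setT measurableT
    (fun r => (window h t r)%:E))//.
  + by rewrite muleC lee_wpmul2r// ?lee_fin// window_int_r.
  + by apply/measurable_EFinP; exact: measurable_window_r.
  + by move=> r _; rewrite lee_fin window_ge0.
  + by rewrite lee_fin.
by move=> r _; rewrite lee_fin.
Qed.

Lemma window_int2_r T h q : 0 <= h -> measurable_fun setT q ->
  (forall r, 0 <= q r) ->
  (\int[leb 0 T]_t \int[leb 0 T]_r (window h t r * q r)%:E <=
   h%:E * \int[leb 0 T]_r (q r)%:E)%E.
Proof.
move=> h0 mq q0.
have mE : measurable_fun setT (fun t => (q t)%:E) by exact/measurable_EFinP.
have mf : measurable_fun setT (fun z : R * R => (window h z.1 z.2 * q z.2)%:E).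
  apply: (@measurable_windowM h (fun z => q z.2)).
  exact: (measurableT_comp mq measurable_snd).
have f0 (z : R * R) : (0 <= (window h z.1 z.2 * q z.2)%:E)%E.
  by rewrite lee_fin mulr_ge0// window_ge0.
have -> := @fubini_tonelli _ _ _ _ _ (leb 0 T) (leb 0 T) _ mf f0.
rewrite -ge0_integralZl//.
apply: ge0_le_integral => //.
- by move=> t _; apply: integral_ge0 => r _; rewrite lee_fin mulr_ge0// window_ge0.
- exact: (@measurable_fun_fubini_tonelli_G _ _ _ _ _ (leb 0 T) _ mf f0).
- by apply: measurable_funeM.
- move=> r _ /=; under eq_integral do rewrite mulrC EFinM.
  rewrite (@ge0_integralZl _ _ _ (leb 0 T) setT measurableT
    (fun t => (window h t r)%:E))//.
  + by rewrite muleC lee_wpmul2r// ?lee_fin// window_int_t.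
  + by apply/measurable_EFinP; exact: measurable_window_t.
  + by move=> t _; rewrite lee_fin window_ge0.
  + by rewrite lee_fin.
by move=> r _; rewrite lee_fin.
Qed.

End window.

Section time_translation.
Context (R : realType).
Implicit Types (g k q : R -> R) (h e t r T : R).

(** Heine-Cantor by compactness, with only [r] confined to the segment: half the local radius is
    kept for the distance from [r] to [t]. *)
Lemma uniform_continuity_segment k (a b e : R) : continuous k -> 0 < e ->
  exists2 d, 0 < d & forall r t, r \in `[a, b] -> `|r - t| < d ->
    `|k r - k t| <= e.
Proof.
move=> ck e0.
have /compact_near_coveringP := @segment_compact R a b.
move=> /(_ R (0 : R)^'+ (fun d r => forall t, `|r - t| < d ->
  `|k r - k t| <= e)).
case.
- move=> x _.
  have : \forall y \near x, `|k x - k y| <= e / 2.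
    by move/cvgrPdist_le : (ck x); apply; rewrite divr_gt0.
  move=> /nbhs_ballP[d /= d0 hd].
  have d2 : 0 < d / 2 by rewrite divr_gt0.
  exists (ball x (d / 2), [set d' | d' < d / 2]).
    split; first exact: nbhsx_ballx.
    by apply: nbhs_right_lt.
  move=> [r d'] /= [xr d'd] t rt.
  have k1 : `|k x - k r| <= e / 2.
    by apply: hd; apply: le_ball xr; lra.
  have k2 : `|k x - k t| <= e / 2.
    apply: hd; rewrite /ball/= (splitr d) -(subrK r x) -addrA.
    rewrite (le_lt_trans (ler_normD _ _))// ltrD//.
    exact: lt_trans d'd.
  rewrite (_ : k r - k t = (k x - k t) - (k x - k r)); last by ring.
  rewrite (le_trans (ler_normB _ _))//; lra.
- move=> d /= d0 hd; exists (d / 2); first by rewrite divr_gt0.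
  move=> r t rab rt; apply: (hd (d / 2)) => //=.
  + by rewrite sub0r normrN gtr0_norm ?divr_gt0//; lra.
  + by rewrite divr_gt0.
Qed.

Lemma approx_uniformly_continuous g T e : 0 < T -> 0 < e ->
  (leb 0 T).-integrable setT (EFin \o g) ->
  exists k, [/\ measurable_fun setT k,
    (\int[leb 0 T]_r (`|g r - k r|)%:E <= e%:E)%E &
    exists2 d, 0 < d & forall r t, `|r - t| < d -> `|k r - k t| <= e].
Proof.
move=> T0 e0 ig; have mg := integ_measurable ig.
have igl : lebesgue_measure.-integrable `]0, T[%classic (EFin \o g).
  apply/integrableP; split.
    apply: measurable_funTS; exact/measurable_EFinP.
  rewrite -ge0_integral_leb//; first by have /integrableP[] := ig.
  by apply: measurableT_comp => //; exact/measurable_EFinP.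
have [k_ [ck _ lim]] := approximation_continuous_integrable
  (measurable_itv _) (lebesgue_itvoo_lty 0 T) igl.
have : \forall n \near \oo,
    (\int[lebesgue_measure]_(z in `]0%R, T[) `|(g z - k_ n z)%:E| < e%:E)%E.
  have e0' : (0 < e%:E)%E by rewrite lte_fin.
  exact: (lim _ (open_ereal_lt' e0')).
move=> [n _ /(_ n (leqnn n)) /= kn].
(* Composing with the 1-Lipschitz projection onto [[0, T]] makes the approximant uniformly
   continuous on the whole line without changing it on [(0, T)]. *)
pose c r := Num.max 0 (Num.min T r).
have cin r : c r \in `[0, T].
  rewrite in_itv/= /c le_max lexx/= ge_max ge_min lexx/= andbT.
  exact: ltW.
have clip r t : `|c r - c t| <= `|r - t|.
  have hm (x y : R) : `|Num.max 0 x - Num.max 0 y| <= `|x - y|.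
    case: (leP 0 x) => ?; case: (leP 0 y) => ?; rewrite ler_norml;
      apply/andP; have := ler_norm (x - y); have := ler_norm (y - x);
      rewrite (distrC y x) => *; split; lra.
  apply: (le_trans (hm _ _)).
  case: (leP T r) => ?; case: (leP T t) => ?; rewrite ler_norml;
      apply/andP; have := ler_norm (r - t); have := ler_norm (t - r);
      rewrite (distrC t r) => *; split; lra.
have mc : measurable_fun setT c.
  by apply: measurable_maxr => //; exact: measurable_minr.
have mk : measurable_fun setT (k_ n \o c).
  by apply: measurableT_comp => //; exact: continuous_measurable_fun.
exists (k_ n \o c); split => //.
- apply: ltW; apply: le_lt_trans kn; rewrite le_eqVlt; apply/orP; left.
  apply/eqP; rewrite ge0_integral_leb//; last first.
    apply/measurable_EFinP; apply: measurableT_comp => //.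
    exact: measurable_funB.
  apply: eq_integral => r; rewrite inE /= in_itv/= => /andP[r0 rT].
  by rewrite /c min_r ?(ltW rT)// max_r// ltW.
- have [d d0 hd] := uniform_continuity_segment 0 T (ck n) e0.
  exists d => // r t rt /=; apply: hd; first exact: cin.
  exact: le_lt_trans rt.
Qed.

Lemma leb_setT T : 0 < T -> leb 0 T setT = T%:E.
Proof.
move=> T0; rewrite -[LHS]/(lebesgue_measure (setT `&` `]0, T[%classic)) setTI.
by rewrite lebesgue_measure_itv/= lte_fin T0 oppr0 adde0.
Qed.

(** Continuity of translations in [L^1], averaged over the window: [g] is compared at both times
    with a uniformly continuous [k]. *)
Lemma time_translation_cvg g T e : 0 < T -> 0 < e ->
  (leb 0 T).-integrable setT (EFin \o g) ->
  exists2 h0, 0 < h0 & forall h, 0 < h < h0 ->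
  (\int[leb 0 T]_t \int[leb 0 T]_r (window h t r * `|g r - g t|)%:E <=
    (e * h)%:E)%E.
Proof.
move=> T0 e0 ig; have mg := integ_measurable ig.
have T2 : 0 < T + 2 by lra.
(* The two approximation errors cost [h e'] each, and the oscillation of [k] costs [h e' T]. *)
pose e' := e / (T + 2); have e'0 : 0 < e' by rewrite divr_gt0.
have [k [mk gk [d d0 hd]]] := approx_uniformly_continuous T0 e'0 ig.
exists d => // h /andP[h0 hd'].
pose q r := `|g r - k r|.
have mq : measurable_fun setT q.
  by apply: measurableT_comp => //; exact: measurable_funB.
have q0 r : 0 <= q r by exact: normr_ge0.
have b1 := window_int2_t T (ltW h0) mq q0.
have b2 := window_int2_r T (ltW h0) mq q0.
have b3 := @window_int2_t _ T h (fun=> e') (ltW h0) (measurable_cst _)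
  (fun=> ltW e'0).
have w0 t r (x : R) : 0 <= x -> (0 <= (window h t r * x)%:E)%E.
  by move=> x0; rewrite lee_fin mulr_ge0// window_ge0.
pose m2 := prod2 (leb 0 T) (leb 0 T).
have mw (f : R * R -> R) := @measurable_windowM _ h f.
have mg2 : measurable_fun setT (fun z : R * R => `|g z.2 - g z.1|).
  apply: measurableT_comp => //; apply: measurable_funB.
    exact: (measurableT_comp mg measurable_snd).
  exact: (measurableT_comp mg measurable_fst).
have mq1 := measurableT_comp mq (@measurable_fst _ _ R R).
have mq2 := measurableT_comp mq (@measurable_snd _ _ R R).
have E (f : R * R -> R) : measurable_fun setT f -> (forall z, 0 <= f z) ->
    (\int[leb 0 T]_t \int[leb 0 T]_r (window h t r * f (t, r))%:E =
     \int[m2]_z (window h z.1 z.2 * f z)%:E)%E.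
  move=> mf f0.
  by have -> := @fubini_tonelli1 _ _ _ _ _ (leb 0 T) (leb 0 T) _ (mw f mf)
    (fun z => w0 z.1 z.2 (f z) (f0 z)).
rewrite (E (fun z => `|g z.2 - g z.1|))//.
rewrite (E (fun z => q z.1))// in b1; rewrite (E (fun z => q z.2))// in b2.
rewrite (E (fun z => e') (measurable_cst _) (fun=> ltW e'0)) in b3.
apply: (@le_trans _ _ (\int[m2]_z ((window h z.1 z.2 * q z.1)%:E +
    ((window h z.1 z.2 * q z.2)%:E + (window h z.1 z.2 * e')%:E)))%E).
  apply: ge0_le_integral => //.
  - by move=> z _; exact: w0.
  - exact: mw.
  - by apply: emeasurable_funD; [exact: mw|apply: emeasurable_funD; exact: mw].
  - move=> [t r] _ /=; rewrite -!EFinD lee_fin -!mulrDr.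
    have [->|w1] := eqVneq (window h t r) 0; first by rewrite !mul0r.
    rewrite ler_wpM2l ?window_ge0//.
    have /andP[tr rt] := window_in w1.
    have : `|k r - k t| <= e'.
      by apply: hd; rewrite ler0_norm ?subr_le0//; lra.
    rewrite /q => kk.
    rewrite (_ : g r - g t = - (g t - k t) + ((g r - k r) + (k r - k t))); last by ring.
    apply: (le_trans (ler_normD _ _)); rewrite normrN lerD2l.
    by apply: (le_trans (ler_normD _ _)); rewrite lerD2l.
rewrite ge0_integralD//; last 4 first.
- by move=> z _; exact: w0.
- exact: mw.
- by move=> z _; rewrite adde_ge0 ?w0// ltW.
- by apply: emeasurable_funD; exact: mw.
rewrite ge0_integralD//; last 4 first.
- by move=> z _; exact: w0.
- exact: mw.
- by move=> z _; rewrite w0// ltW.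
- exact: mw.
have ie : (\int[leb 0 T]_t e'%:E = (e' * T)%:E)%E.
  by rewrite (EFinM e' T) -(leb_setT T0); exact: integral_cst.
rewrite ie in b3.
apply: (@le_trans _ _ (h%:E * e'%:E + (h%:E * e'%:E + h%:E * (e' * T)%:E))%E).
  apply: leeD; last apply: leeD => //.
    by apply: (le_trans b1); rewrite lee_wpmul2l// lee_fin ltW.
  by apply: (le_trans b2); rewrite lee_wpmul2l// lee_fin ltW.
rewrite -!EFinM -!EFinD lee_fin.
have -> : e = e' * (T + 2) by rewrite /e' divfK// gt_eqF.
lra.
Qed.

End time_translation.

Section space_time_translation.
Context (R : realType) d (X : measurableType d).
Variables (T : R) (mu : {finite_measure set X -> \bar R}).
Hypothesis T0 : 0 < T.
Implicit Types (g B D q : R * X -> R) (h e t r : R).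

Local Notation nu := (leb (0 : R) T).
Local Notation m := (nu \x mu)%E.
Local Notation P := (prod3 nu nu mu).
Local Notation integ f := (m.-integrable setT (EFin \o f)).

Lemma measurable_tx q : measurable_fun setT q ->
  measurable_fun setT (fun z : R * R * X => q (z.1.1, z.2)).
Proof.
move=> mq; apply: (measurableT_comp mq).
apply/measurable_fun_pairP; split => /=; last exact: measurable_snd.
exact: (measurableT_comp measurable_fst measurable_fst).
Qed.

Lemma measurable_rx q : measurable_fun setT q ->
  measurable_fun setT (fun z : R * R * X => q (z.1.2, z.2)).
Proof.
move=> mq; apply: (measurableT_comp mq).
apply/measurable_fun_pairP; split => /=; last exact: measurable_snd.
exact: (measurableT_comp measurable_snd measurable_fst).
Qed.

Lemma measurable_window3 h (f : R * R * X -> R) : measurable_fun setT f ->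
  measurable_fun setT (fun z => (window h z.1.1 z.1.2 * f z)%:E).
Proof.
move=> mf; apply/measurable_EFinP; apply: measurable_funM => //.
exact: (measurableT_comp (measurable_window h) measurable_fst).
Qed.

Lemma measurable_xsec q x : measurable_fun setT q ->
  measurable_fun setT (fun t => q (t, x)).
Proof. by move=> mq; apply: measurableT_comp => //; exact: pair2_measurable. Qed.

Lemma window3_ge0 h (f : R * R * X -> R) z : (forall z, 0 <= f z) ->
  (0 <= (window h z.1.1 z.1.2 * f z)%:E)%E.
Proof. by move=> f0; rewrite lee_fin mulr_ge0// window_ge0. Qed.

Lemma window_int3_t h q : 0 <= h -> measurable_fun setT q ->
  (forall z, 0 <= q z) ->
  (\int[P]_z (window h z.1.1 z.1.2 * q (z.1.1, z.2))%:E <=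
   h%:E * \int[m]_z (q z)%:E)%E.
Proof.
move=> h0 mq q0; have mq' := measurable_tx mq.
have mE : measurable_fun setT (fun z => (q z)%:E) by exact/measurable_EFinP.
have mw := measurable_window3 h mq'.
have w0 (z : R * R * X) := @window3_ge0 h (fun z => q (z.1.1, z.2)) z (fun=> q0 _).
have E0 (z : R * X) : (0 <= (q z)%:E)%E by rewrite lee_fin.
have -> := @prod3_txr _ _ _ _ _ _ _ nu nu mu _ mw w0.
have -> := @fubini_tonelli2 _ _ _ _ _ nu mu _ mE E0.
have mG := @measurable_fun_fubini_tonelli_G _ _ _ _ _ nu _ mE E0.
rewrite -ge0_integralZl//; last first.
  by move=> x _; exact: integral_ge0.
apply: ge0_le_integral => //.
- by move=> x _; do 2!apply: integral_ge0 => ? _; exact: (w0 (_, _, x)).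
- exact: (@measurable_prod3_txr _ _ _ _ _ _ _ nu nu _ mw w0).
- exact: measurable_funeM.
- by move=> x _ /=; apply: window_int2_t => //; exact: measurable_xsec.
Qed.

Lemma window_int3_r h q : 0 <= h -> measurable_fun setT q ->
  (forall z, 0 <= q z) ->
  (\int[P]_z (window h z.1.1 z.1.2 * q (z.1.2, z.2))%:E <=
   h%:E * \int[m]_z (q z)%:E)%E.
Proof.
move=> h0 mq q0; have mq' := measurable_rx mq.
have mE : measurable_fun setT (fun z => (q z)%:E) by exact/measurable_EFinP.
have mw := measurable_window3 h mq'.
have w0 (z : R * R * X) := @window3_ge0 h (fun z => q (z.1.2, z.2)) z (fun=> q0 _).
have E0 (z : R * X) : (0 <= (q z)%:E)%E by rewrite lee_fin.
have -> := @prod3_txr _ _ _ _ _ _ _ nu nu mu _ mw w0.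
have -> := @fubini_tonelli2 _ _ _ _ _ nu mu _ mE E0.
have mG := @measurable_fun_fubini_tonelli_G _ _ _ _ _ nu _ mE E0.
rewrite -ge0_integralZl//; last first.
  by move=> x _; exact: integral_ge0.
apply: ge0_le_integral => //.
- by move=> x _; do 2!apply: integral_ge0 => ? _; exact: (w0 (_, _, x)).
- exact: (@measurable_prod3_txr _ _ _ _ _ _ _ nu nu _ mw w0).
- exact: measurable_funeM.
- by move=> x _ /=; apply: window_int2_r => //; exact: measurable_xsec.
Qed.

(** For almost every [x] the section [g (_, x)] is integrable and the time lemma applies. Dominated
    convergence in [x] then concludes, the averages divided by [h] being at most twice the [L^1]
    norm of the section. *)
Lemma space_time_translation_cvg g e : 0 < e -> integ g ->
  \forall n \near \oo, (\int[P]_z (window n.+1%:R^-1 z.1.1 z.1.2 *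
    `|g (z.1.2, z.2) - g (z.1.1, z.2)|)%:E <= (e * n.+1%:R^-1)%:E)%E.
Proof.
move=> e0 ig; have mg := integ_measurable ig.
pose h n : R := n.+1%:R^-1.
have h0 n : 0 < h n by rewrite invr_gt0.
have mf : measurable_fun setT
    (fun z : R * R * X => `|g (z.1.2, z.2) - g (z.1.1, z.2)|).
  apply: measurableT_comp => //; apply: measurable_funB.
    exact: measurable_rx.
  exact: measurable_tx.
have mw n := measurable_window3 (h n) mf.
have w0 n (z : R * R * X) := @window3_ge0 (h n)
  (fun z => `|g (z.1.2, z.2) - g (z.1.1, z.2)|) z (fun=> normr_ge0 _).
pose phi n x := (\int[nu]_t \int[nu]_r
  (window (h n) t r * `|g (r, x) - g (t, x)|)%:E)%E.
have phi0 n x : (0 <= phi n x)%E.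
  by do 2!apply: integral_ge0 => ? _; exact: (w0 n (_, _, x)).
have mphi n : measurable_fun setT (phi n).
  exact: (@measurable_prod3_txr _ _ _ _ _ _ _ nu nu _ (mw n) (w0 n)).
pose G x := (\int[nu]_r `|g (r, x)|%:E)%E.
have mng : measurable_fun setT (fun z => `|g z|%:E).
  by apply/measurable_EFinP; exact: measurableT_comp.
have ng0 (z : R * X) : (0 <= `|g z|%:E)%E by rewrite lee_fin.
have mG : measurable_fun setT G.
  exact: (@measurable_fun_fubini_tonelli_G _ _ _ _ _ nu _ mng ng0).
have G0 x : (0 <= G x)%E by exact: integral_ge0.
have iG : mu.-integrable setT (fun x => (2%:E * G x)%E).
  apply: integrableZl => //; apply/integrableP; split => //.
  under eq_integral do rewrite gee0_abs//.
  have <- := @fubini_tonelli2 _ _ _ _ _ nu mu _ mng ng0.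
  by have /integrableP[] := ig.
have bound n x : (phi n x <= (h n)%:E * (2%:E * G x))%E.
  have mgx := measurable_xsec x mg.
  have mgn : measurable_fun setT (fun r => `|g (r, x)|).
    exact: measurableT_comp.
  have b1 := window_int2_t T (ltW (h0 n)) mgn (fun=> normr_ge0 _).
  have b2 := window_int2_r T (ltW (h0 n)) mgn (fun=> normr_ge0 _).
  have q1 : measurable_fun setT (fun z : R * R => `|g (z.1, x)|).
    exact: (measurableT_comp mgn measurable_fst).
  have q2 : measurable_fun setT (fun z : R * R => `|g (z.2, x)|).
    exact: (measurableT_comp mgn measurable_snd).
  have q3 : measurable_fun setT (fun z : R * R => `|g (z.2, x) - g (z.1, x)|).
    apply: measurableT_comp => //; apply: measurable_funB.
      exact: (measurableT_comp mgx measurable_snd).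
    exact: (measurableT_comp mgx measurable_fst).
  have E (f : R * R -> R) : measurable_fun setT f -> (forall z, 0 <= f z) ->
    (\int[nu]_t \int[nu]_r (window (h n) t r * f (t, r))%:E =
     \int[prod2 nu nu]_z (window (h n) z.1 z.2 * f z)%:E)%E.
    move=> mf' f0.
    have f0' (z : R * R) : (0 <= (window (h n) z.1 z.2 * f z)%:E)%E.
      by rewrite lee_fin mulr_ge0// window_ge0.
    by have -> := @fubini_tonelli1 _ _ _ _ _ nu nu _ (measurable_windowM (h n) mf') f0'.
  have n0 (f : R * R -> R) z : (0 <= (window (h n) z.1 z.2 * `|f z|)%:E)%E.
    by rewrite lee_fin mulr_ge0// window_ge0.
  rewrite /phi (E (fun z => `|g (z.2, x) - g (z.1, x)|))//.
  rewrite (E (fun z => `|g (z.1, x)|))// in b1.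
  rewrite (E (fun z => `|g (z.2, x)|))// in b2.
  apply: (@le_trans _ _ (\int[prod2 nu nu]_z
    ((window (h n) z.1 z.2 * `|g (z.1, x)|)%:E +
     (window (h n) z.1 z.2 * `|g (z.2, x)|)%:E))%E).
    apply: ge0_le_integral => //.
    - by move=> z _; exact: (n0 (fun z => g (z.2, x) - g (z.1, x))).
    - exact: measurable_windowM.
    - by apply: emeasurable_funD; exact: measurable_windowM.
    - move=> z _; rewrite -EFinD lee_fin -mulrDr ler_wpM2l ?window_ge0//.
      by rewrite [leRHS]addrC ler_normB.
  rewrite ge0_integralD//; last 4 first.
  - by move=> z _; exact: (n0 (fun z => g (z.1, x))).
  - exact: measurable_windowM.
  - by move=> z _; exact: (n0 (fun z => g (z.2, x))).
  - exact: measurable_windowM.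
  apply: (le_trans (leeD b1 b2)).
  rewrite -muleDr//; last by rewrite ge0_adde_def// inE; exact: G0.
  by rewrite -mule2n mule_natl.
have aeb : \forall x \ae mu, forall n : nat, [set: X] x ->
    (`|(h n)^-1%:E * phi n x| <= 2%:E * G x)%E.
  apply: aeW => x n _; rewrite gee0_abs; last first.
    by rewrite mule_ge0// lee_fin invr_ge0 ltW.
  by rewrite lee_pdivrMl.
have aec : \forall x \ae mu, [set: X] x ->
    ((h n)^-1%:E * phi n x)%E @[n --> \oo] --> 0%E.
  have := @ae_integrable2 _ _ _ _ _ nu mu _ ig; apply: ae_imp => x igx _.
  have Gfin : (G x < +oo)%E by have /integrableP[] := igx.
  have Gx : (2%:E * G x)%E \is a fin_num.
    by rewrite fin_numM// ge0_fin_numE.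
  have fin n : ((h n)^-1%:E * phi n x)%E \is a fin_num.
    rewrite ge0_fin_numE; last by rewrite mule_ge0// lee_fin invr_ge0 ltW.
    apply: (@le_lt_trans _ _ (2%:E * G x)%E); first by rewrite lee_pdivrMl.
    by rewrite ltey_eq Gx.
  apply/fine_cvgP; split; first by near=> n; exact: fin.
  apply/cvgrPdist_le => /= e1 e10.
  have [d0 d00 hd] := time_translation_cvg T0 e10 igx.
  near=> n.
  have hn : h n < d0 by near: n; exact: (near_infty_natSinv_lt (PosNum d00)).
  rewrite sub0r normrN ger0_norm; last first.
    by apply: fine_ge0; rewrite mule_ge0// lee_fin invr_ge0 ltW.
  rewrite -lee_fin fineK// lee_pdivrMl// -EFinM mulrC.
  by apply: hd; rewrite h0.
have [_ _ lim] := @dominated_convergence _ _ _ mu setT measurableT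
  (fun n x => ((h n)^-1%:E * phi n x)%E) (cst 0%E)
  (fun x => (2%:E * G x)%E) (fun n => measurable_funeM _ (mphi n))
  (measurable_cst _) aec iG aeb.
rewrite integral0 in lim.
have e0' : (0 < e%:E)%E by rewrite lte_fin.
have [N _ hN] := lim _ (open_ereal_lt' e0').
exists N => // n /hN /= hn.
have -> := @prod3_txr _ _ _ _ _ _ _ nu nu mu _ (mw n) (w0 n).
rewrite -[leLHS]/(\int[mu]_x phi n x)%E.
move: hn; rewrite ge0_integralZl//; last by rewrite lee_fin invr_ge0 ltW.
by move=> /ltW; rewrite lee_pdivrMl// -EFinM mulrC.
Unshelve. all: by end_near. Qed.

(** At each point the truncated function vanishes once [M] exceeds [|B z|]; dominated convergence
    applies along integers [M]. *)
Lemma integ_tail B p e : (0 < p)%N -> measurable_fun setT B ->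
  integ (fun z => `|B z| ^+ p) -> 0 < e ->
  exists2 M, 0 <= M & \int[m]_z (`|B z| * \1_[set z | M < `|B z|] z) ^+ p <= e.
Proof.
move=> p0 mB iB e0.
have mtail (M : R) : measurable [set z | M < `|B z|].
  rewrite -[X in measurable X]setTI.
  apply: (@measurable_fun_ltr _ _ _ setT (cst M) (fun z => `|B z|) _ _
    measurableT [set true]) => //.
  exact: measurableT_comp.
have mf (n : nat) : measurable_fun setT
    (fun z => (`|B z| * \1_[set z | n%:R < `|B z|] z) ^+ p).
  apply: measurable_funX; apply: measurable_funM; first exact: measurableT_comp.
  exact: measurable_indic.
have i0 : integ (fun=> 0) by exact: integrable0.
have : \int[m]_z ((`|B z| * \1_[set z | n%:R < `|B z|] z) ^+ p) @[n --> \oo]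
    --> \int[m]_z 0.
  apply: (dominated_cvg_Rintegral _ i0 iB); first exact: mf.
  - move=> z; apply: cvg_near_cst; near=> n.
    rewrite indicE memNset ?mulr0 ?expr0n ?gtn_eqF//= => /lt_geF/negbT/negP; apply.
    near: n; exact: nbhs_infty_ger.
  - move=> n z; rewrite normrX lerXn2r ?nnegrE// normrM normr_id.
    by rewrite -[leRHS]mulr1 ler_wpM2l// indicE normr_nat; case: (_ \in _).
rewrite {2}/Rintegral integral0 => /cvgrPdist_le /(_ e e0) [N _ /(_ N (leqnn N))].
rewrite sub0r normrN => h; exists N%:R => //.
by apply: le_trans h; exact: ler_norm.
Unshelve. all: by end_near. Qed.

(* As [h] tends to 0, the weight [g (r, x)] may be replaced by [g (t, x)] in
   the average over [t - h < r <= t] of the pairing with [B (t, x)]. *)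
Lemma translation_pairing g B D p e : (0 < p)%N ->
  measurable_fun setT g -> measurable_fun setT B -> (forall z, 0 <= D z) ->
  integ D -> integ (fun z => `|B z| ^+ p) ->
  (forall a, 0 < a -> exists2 C, 0 <= C &
     forall z b, `|g z * b| <= a * D z + C * `|b| ^+ p) ->
  0 < e ->
  \forall n \near \oo, (\int[P]_z (window n.+1%:R^-1 z.1.1 z.1.2 *
    (`|g (z.1.2, z.2) - g (z.1.1, z.2)| * `|B (z.1.1, z.2)|))%:E <=
    (e * n.+1%:R^-1)%:E)%E.
Proof.
move=> p0 mg mB D0 iD iB young e0.
have mD := integ_measurable iD.
pose K : R := \int[m]_z D z.
have K0 : 0 <= K by exact: Rintegral_ge0.
have K1 : 0 < K + 1 by rewrite ltr_wpDl.
(* Budget: [e/6] for each of the two terms in [D], [e/3] for the tail of [B], [e/3] for the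
   translation of [g]. Adding 1 to each denominator keeps it positive. *)
pose a := e / 6 / (K + 1).
have a0 : 0 < a by rewrite !divr_gt0.
have [C C0 hC] := young a a0.
have C1 : 0 < C + 1 by rewrite ltr_wpDl.
have e1 : 0 < e / 6 / (C + 1) by rewrite !divr_gt0.
have [M M0 hM] := integ_tail p0 mB iB e1.
have M1 : 0 < M + 1 by rewrite ltr_wpDl.
pose S := [set z | M < `|B z|].
have mS : measurable S.
  rewrite -[X in measurable X]setTI.
  apply: (@measurable_fun_ltr _ _ _ setT (cst M) (fun z => `|B z|) _ _
    measurableT [set true]) => //.
  exact: measurableT_comp.
pose Q z := (`|B z| * \1_S z) ^+ p.
have mQ : measurable_fun setT Q.
  apply: measurable_funX; apply: measurable_funM; first exact: measurableT_comp.
  exact: measurable_indic.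
have Q0 z : 0 <= Q z by rewrite exprn_ge0// mulr_ge0// indicE.
have iQ : integ Q.
  apply: (integ_dom _ iB) => [|z]; first exact: mQ.
  rewrite normrX lerXn2r ?nnegrE// normrM normr_id.
  by rewrite -[leRHS]mulr1 ler_wpM2l// indicE normr_nat; case: (_ \in _).
(* The Young hypothesis at [a = 1], [b = 1] bounds [|g|] by [D] plus a constant. *)
have ig : integ g.
  have [C' C'0 hC'] := young 1 ltr01.
  have iDC : integ (fun z => D z + C').
    apply: integD => //.
    exact: (@finite_measure_integrable_cst _ _ _ (prod2 nu mu)).
  apply: (integ_dom _ iDC) => [|z]; first exact: mg.
  by have := hC' z 1; rewrite mulr1 normr1 expr1n mulr1 mul1r.
have e3 : 0 < e / 3 / (M + 1) by rewrite !divr_gt0.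
have := space_time_translation_cvg e3 ig.
move=> [N _ hN]; exists N => // n /hN /=.
set h := n.+1%:R^-1 => htr.
have h0 : 0 <= h by rewrite invr_ge0.
have aD0 z : 0 <= a * D z by rewrite mulr_ge0// ltW.
have CQ0 z : 0 <= 2 * C * Q z by rewrite !mulr_ge0.
have maD : measurable_fun setT (fun z => a * D z) by exact: measurable_funM.
have mCQ : measurable_fun setT (fun z => 2 * C * Q z) by exact: measurable_funM.
have b1 := window_int3_r h0 maD aD0.
have b2 := window_int3_t h0 maD aD0.
have b3 := window_int3_t h0 mCQ CQ0.
have mDg : measurable_fun setT
    (fun z : R * R * X => `|g (z.1.2, z.2) - g (z.1.1, z.2)|).
  apply: measurableT_comp => //; apply: measurable_funB.
    exact: measurable_rx.
  exact: measurable_tx.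
(* On the tail [|B| > M] the triangle inequality and Young's inequality at both times give [F1],
   [F2] and twice the [Q] term, [F3]. Elsewhere [|B| <= M], and only the increment of [g], in [F4],
   has to be small. *)
pose F1 (z : R * R * X) := (window h z.1.1 z.1.2 * (a * D (z.1.2, z.2)))%:E.
pose F2 (z : R * R * X) := (window h z.1.1 z.1.2 * (a * D (z.1.1, z.2)))%:E.
pose F3 (z : R * R * X) := (window h z.1.1 z.1.2 * (2 * C * Q (z.1.1, z.2)))%:E.
pose F4 (z : R * R * X) := (window h z.1.1 z.1.2 *
  `|g (z.1.2, z.2) - g (z.1.1, z.2)|)%:E.
have mF1 : measurable_fun setT F1.
  exact: (measurable_window3 h (measurable_rx maD)).
have mF2 : measurable_fun setT F2.
  exact: (measurable_window3 h (measurable_tx maD)).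
have mF3 : measurable_fun setT F3.
  exact: (measurable_window3 h (measurable_tx mCQ)).
have mF4 : measurable_fun setT F4 by exact: (measurable_window3 h mDg).
have F10 z : (0 <= F1 z)%E by rewrite lee_fin mulr_ge0// window_ge0.
have F20 z : (0 <= F2 z)%E by rewrite lee_fin mulr_ge0// window_ge0.
have F30 z : (0 <= F3 z)%E by rewrite lee_fin mulr_ge0// window_ge0.
have F40 z : (0 <= F4 z)%E by rewrite lee_fin mulr_ge0// window_ge0.
apply: (@le_trans _ _ (\int[P]_z (F1 z + (F2 z + (F3 z + M%:E * F4 z)))))%E.
  apply: ge0_le_integral => //.
  - by move=> z _; rewrite lee_fin mulr_ge0 ?mulr_ge0// window_ge0.
  - apply: (measurable_window3 h
      (f := fun z => `|g (z.1.2, z.2) - g (z.1.1, z.2)| * `|B (z.1.1, z.2)|)).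
    apply: measurable_funM => //; apply: measurableT_comp => //.
    exact: measurable_tx.
  - apply: emeasurable_funD => //; apply: emeasurable_funD => //.
    by apply: emeasurable_funD => //; exact: measurable_funeM.
  - move=> [[t r] x] _; rewrite -EFinM -!EFinD lee_fin /=.
    rewrite [M * _]mulrCA -!mulrDr ler_wpM2l ?window_ge0//.
    have y1 := hC (r, x) (`|B (t, x)| * \1_S (t, x)).
    have y2 := hC (t, x) (`|B (t, x)| * \1_S (t, x)).
    have b0 : 0 <= `|B (t, x)| * \1_S (t, x) by rewrite mulr_ge0// indicE.
    rewrite !normrM normr_id in y1 y2.
    have s0 : 0 <= \1_S (t, x) :> R by rewrite indicE.
    rewrite (ger0_norm s0) -/(Q (t, x)) in y1 y2.
    have Bs : `|B (t, x)| <= `|B (t, x)| * \1_S (t, x) + M.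
      rewrite indicE; have [|] := boolP ((t, x) \in S).
        by rewrite mulr1 lerDl.
      rewrite notin_setE /S /= mulr0 add0r => /negP; by rewrite -leNgt.
    have tri := ler_normB (g (r, x)) (g (t, x)).
    have d0 := normr_ge0 (g (r, x) - g (t, x)).
    move: y1 y2 b0 Bs tri d0.
    move: (`|B (t, x)| * \1_S (t, x)) => b.
    move: (`|g (r, x) - g (t, x)|) (`|B (t, x)|).
    move: (`|g (r, x)|) (`|g (t, x)|) (a * D (r, x)) (a * D (t, x)) (Q (t, x)).
    move=> gr gt Dr Dt q dg bb y1 y2 b0 Bs tri d0.
    apply: (@le_trans _ _ (dg * (b + M))); first by rewrite ler_wpM2l.
    apply: (@le_trans _ _ ((gr + gt) * b + M * dg)).
      by rewrite mulrDr [dg * M]mulrC lerD2r ler_wpM2r.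
    rewrite mulrDl; lra.
have mMF4 : measurable_fun setT (fun z => M%:E * F4 z)%E by exact: measurable_funeM.
have MF40 z : (0 <= M%:E * F4 z)%E by rewrite mule_ge0// lee_fin.
have F340 z : (0 <= F3 z + M%:E * F4 z)%E by rewrite adde_ge0.
have mF34 : measurable_fun setT (fun z => F3 z + M%:E * F4 z)%E by exact: emeasurable_funD.
rewrite ge0_integralD//; last 2 first.
- by move=> z _; rewrite adde_ge0.
- exact: emeasurable_funD.
rewrite ge0_integralD// ge0_integralD// ge0_integralZl//.
have cD : (\int[m]_z (a * D z)%:E <= (e / 6)%:E)%E.
  rewrite (integ_integral (integZ a iD)) lee_fin RintegralZl//.
  rewrite /a -!mulrA [_^-1 * K]mulrC ler_pM2l//.
  by rewrite ger_pMr// ler_pdivrMr// mul1r lerDl.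
have cQ : (\int[m]_z (2 * C * Q z)%:E <= (e / 3)%:E)%E.
  rewrite (integ_integral (integZ _ iQ)) lee_fin RintegralZl//.
  apply: (le_trans (ler_wpM2l _ hM)); first by rewrite mulr_ge0.
  rewrite (_ : 2 * C * _ = (e / 3) * (C / (C + 1))); last by field; rewrite gt_eqF.
  by rewrite ger_pMr ?divr_gt0// ler_pdivrMr// mul1r lerDl.
have c4 : (M%:E * \int[P]_z F4 z <= (h * (e / 3))%:E)%E.
  apply: (@le_trans _ _ (M%:E * (e / 3 / (M + 1) * h)%:E)%E).
    by rewrite lee_wpmul2l// lee_fin.
  rewrite -EFinM lee_fin mulrA mulrC ler_wpM2l//.
  rewrite mulrA ler_pdivrMr// mulrC; apply: ler_wpM2l; last by rewrite lerDl.
  by rewrite divr_ge0// ltW.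
apply: (@le_trans _ _ ((h * (e / 6))%:E + ((h * (e / 6))%:E +
  ((h * (e / 3))%:E + (h * (e / 3))%:E)))%E).
  apply: leeD; [|apply: leeD; [|apply: leeD => //]].
  - by apply: (le_trans b1); rewrite EFinM lee_wpmul2l// lee_fin.
  - by apply: (le_trans b2); rewrite EFinM lee_wpmul2l// lee_fin.
  - by apply: (le_trans b3); rewrite EFinM lee_wpmul2l// lee_fin.
by rewrite -!EFinD lee_fin le_eqVlt; apply/orP; left; apply/eqP; field.
Qed.

End space_time_translation.

(** * The pointwise energy estimate *)

Section pointwise_estimates.
Context (R : realType).
Implicit Types (x y a b e : R).

Lemma young_mix (m l : nat) e : (0 < l)%N -> 0 < e ->
  exists2 C, 0 <= C & forall x y, 0 <= x -> 0 <= y ->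
    x ^+ m * y ^+ l <= e * x ^+ (m + l) + C * y ^+ (m + l).
Proof.
move=> l0 e0; pose c := Num.min e 1.
have c0 : 0 < c by rewrite lt_min e0 ltr01.
have c1 : c <= 1 by rewrite ge_min lexx orbT.
have ce : c <= e by rewrite ge_min lexx.
exists (c^-1 ^+ m); first by rewrite exprn_ge0// invr_ge0 ltW.
move=> x y x0 y0.
have [yx|xy] := leP y (c * x).
  apply: (@le_trans _ _ (e * x ^+ (m + l))); last first.
    by rewrite lerDl mulr_ge0// exprn_ge0// invr_ge0 ltW.
  rewrite exprD mulrCA ler_wpM2l ?exprn_ge0//.
  apply: (@le_trans _ _ ((c * x) ^+ l)).
    by rewrite lerXn2r ?nnegrE ?mulr_ge0// ltW.
  rewrite exprMn ler_wpM2r ?exprn_ge0//.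
  by apply: le_trans ce; case: l l0 => // l _; rewrite exprS ger_pMr// exprn_ile1// ltW.
apply: (@le_trans _ _ (c^-1 ^+ m * y ^+ (m + l))); last first.
  by rewrite lerDr mulr_ge0 ?exprn_ge0// ltW.
rewrite exprD mulrA ler_wpM2r ?exprn_ge0// -exprMn lerXn2r ?nnegrE//.
  by rewrite mulr_ge0// invr_ge0 ltW.
by rewrite mulrC ler_pdivlMr// mulrC ltW.
Qed.

(** The case [y = 1] of [young_mix], with [e / (K + 1)] so that the factor [K] is absorbed. *)
Lemma absorb_power (m n : nat) (K e : R) : (m < n)%N -> 0 <= K -> 0 < e ->
  exists2 C, 0 <= C & forall y, 0 <= y -> K * y ^+ m <= e * y ^+ n + C.
Proof.
move=> mn K0 e0.
have n0 : (0 < n - m)%N by rewrite subn_gt0.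
have K1 : 0 < K + 1 by rewrite ltr_wpDl.
have e1 : 0 < e / (K + 1) by rewrite divr_gt0.
have [C C0 hC] := young_mix m n0 e1.
exists (K * C); first by rewrite mulr_ge0.
move=> y y0; have := hC y 1 y0 ler01; rewrite !expr1n !mulr1 subnKC ?(ltnW mn)//.
move=> /(ler_wpM2l K0) h; apply: (le_trans h); rewrite mulrDr lerD2r mulrA.
rewrite ler_wpM2r ?exprn_ge0// mulrCA ger_pMr//.
by rewrite ler_pdivrMr// mul1r lerDl.
Qed.

Lemma young_sq e : 0 < e -> exists2 C, 0 <= C & forall x b,
  `|x * b| <= e * x ^+ 2 + C * `|b| ^+ 2.
Proof.
move=> e0; have e2 : 0 < e by [].
have [C C0 hC] := @young_mix 1 1 e isT e0.
exists C => // x b; rewrite normrM -[x ^+ 2]real_normK ?num_real//.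
by have := hC `|x| `|b| (normr_ge0 _) (normr_ge0 _); rewrite !expr1.
Qed.

(** For [|a| <= 1] the constant dominates, for [|a| > 1] the top power does. *)
Lemma reaction_bound (gamma : R) (delta : nat) a : 0 < gamma ->
  `|a * (1 - a ^+ delta) * (a ^+ delta - gamma)| <=
  2 * (1 + gamma) * (1 + `|a| ^+ (2 * delta + 1)).
Proof.
move=> g0; rewrite !normrM.
have h1 : `|1 - a ^+ delta| <= 1 + `|a| ^+ delta.
  by rewrite (le_trans (ler_normB _ _))// normr1 normrX.
have h2 : `|a ^+ delta - gamma| <= `|a| ^+ delta + gamma.
  by rewrite (le_trans (ler_normB _ _))// normrX (gtr0_norm g0).
have h3 := ler_pM (normr_ge0 _) (normr_ge0 _) h1 h2.
rewrite -mulrA; apply: (le_trans (ler_wpM2l (normr_ge0 a) h3)).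
have x0 := normr_ge0 a; move: (`|a|) x0 => x x0.
have xd : 0 <= x ^+ delta by rewrite exprn_ge0.
have -> : x ^+ (2 * delta + 1) = x * (x ^+ delta * x ^+ delta).
  by rewrite addn1 exprS mul2n -addnn exprD.
have [x1|x1] := leP x 1.
  have xd1 : x ^+ delta <= 1 by rewrite exprn_ile1.
  move: (x ^+ delta) xd xd1 => z z0 z1.
  have k1 : (1 + z) * (z + gamma) <= 2 * (1 + gamma) by nra.
  have k2 : x * ((1 + z) * (z + gamma)) <= 1 * (2 * (1 + gamma)).
    by apply: ler_pM => //; rewrite mulr_ge0//; lra.
  have k3 : 0 <= 2 * (1 + gamma) * (x * (z * z)) by rewrite !mulr_ge0//; lra.
  rewrite mul1r in k2; rewrite [leRHS]mulrDr mulr1; lra.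
have xd1 : 1 <= x ^+ delta by rewrite exprn_ege1// ltW.
move: (x ^+ delta) xd xd1 => z z0 z1.
have k1 : (1 + z) * (z + gamma) <= (2 * z) * ((1 + gamma) * z).
  by apply: ler_pM; nra.
have k2 : x * ((1 + z) * (z + gamma)) <= x * ((2 * z) * ((1 + gamma) * z)).
  by rewrite ler_wpM2l.
have k3 : 0 <= 2 * (1 + gamma) by lra.
apply: (le_trans k2); rewrite [leRHS]mulrDr mulr1.
rewrite [leLHS](_ : _ = 2 * (1 + gamma) * (x * (z * z))); last by ring.
by rewrite lerDr.
Qed.

(** Supplies the Young hypothesis of [translation_pairing]. The transport term takes two steps:
    [|d|] is first separated from [|a|^delta |b|], then [|a|^(2 delta) |b|^2] is split with total
    exponent [2 delta + 2]. *)
Lemma young_flux (alpha beta gamma : R) (delta : nat) e :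
  0 < alpha -> 0 < beta -> 0 < gamma -> (0 < delta)%N -> 0 < e ->
  exists2 C, 0 <= C & forall a d b,
  `|(- (alpha * (a ^+ delta * d)) +
     beta * (a * (1 - a ^+ delta) * (a ^+ delta - gamma))) * b| <=
  e * (d ^+ 2 + `|a| ^+ (2 * delta + 2) + 1) + C * `|b| ^+ (2 * delta + 2).
Proof.
move=> al0 be0 ga0 de0 e0.
have ea : 0 < e / alpha by rewrite divr_gt0.
have [C1 C10 hC1] := @young_mix 1 1 _ isT ea.
(* The second splitting is multiplied by [alpha * C1]; this choice leaves at most [e/2] on the power
   of [a]. *)
have e1 : 0 < e / (2 * alpha * (C1 + 1)) by rewrite divr_gt0 ?mulr_gt0// ltr_wpDl.
have [C2 C20 hC2] := @young_mix (2 * delta) 2 _ isT e1.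
have [G [G0 GE]] : exists G : R, 0 < G /\ 2 * (1 + gamma) = G.
  by exists (2 * (1 + gamma)); split => //; rewrite mulr_gt0//; lra.
have e2 : 0 < e / (2 * (beta * G)) by rewrite divr_gt0 ?mulr_gt0.
have [C3 C30 hC3] := @young_mix (2 * delta + 1) 1 _ isT e2.
exists (alpha * C1 * C2 + 2 * (beta * G) * C3).
  by rewrite addr_ge0 ?mulr_ge0// ltW.
move=> a d b.
have x0 := normr_ge0 a; have y0 := normr_ge0 d; have z0 := normr_ge0 b.
have c1 := hC1 `|d| (`|a| ^+ delta * `|b|) y0 (mulr_ge0 (exprn_ge0 _ x0) z0).
have c2 := hC2 `|a| `|b| x0 z0.
have c3 := hC3 `|a| `|b| x0 z0.
(* The constant part of the reaction bound is the same inequality at [x = 1]; it accounts for the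
   [+ 1] in the weight and for the factor 2 before [C3]. *)
have c4 := hC3 1 `|b| ler01 z0.
have := reaction_bound delta a ga0; rewrite GE => re.
rewrite !expr1 in c1.
have E1 : (`|a| ^+ delta * `|b|) ^+ (1 + 1) = `|a| ^+ (2 * delta) * `|b| ^+ 2.
  by rewrite exprMn -exprM mulnC.
have E2 : `|d| ^+ (1 + 1) = d ^+ 2 by rewrite real_normK ?num_real.
rewrite E1 E2 in c1.
rewrite !expr1n mul1r mulr1 -addnA !expr1 in c4.
rewrite -addnA !expr1 in c3.
have t1 : `|(alpha * (a ^+ delta * d)) * b| <=
    alpha * (`|d| * (`|a| ^+ delta * `|b|)).
  by rewrite !normrM (gtr0_norm al0) normrX -mulrA ler_wpM2l ?(ltW al0)//
    mulrAC mulrC mulrA.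
have t2 : `|beta * (a * (1 - a ^+ delta) * (a ^+ delta - gamma)) * b| <=
    beta * (G * (1 + `|a| ^+ (2 * delta + 1)) * `|b|).
  rewrite normrM normrM (gtr0_norm be0) -mulrA ler_wpM2l ?(ltW be0)//.
  by rewrite ler_wpM2r.
rewrite mulrDl mulNr; apply: (le_trans (ler_normD _ _)); rewrite normrN.
apply: (le_trans (lerD t1 t2)).
have s1 : alpha * (`|d| * (`|a| ^+ delta * `|b|)) <=
    e * d ^+ 2 + e / 2 * `|a| ^+ (2 * delta + 2) +
    alpha * C1 * C2 * `|b| ^+ (2 * delta + 2).
  apply: (le_trans (ler_wpM2l (ltW al0) c1)).
  have := ler_wpM2l (mulr_ge0 (ltW al0) C10) c2.
  rewrite [leRHS]mulrDr [X in _ -> X <= _]mulrDr => c2'.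
  have : alpha * C1 * (e / (2 * alpha * (C1 + 1)) * `|a| ^+ (2 * delta + 2)) <=
      e / 2 * `|a| ^+ (2 * delta + 2).
    rewrite mulrA ler_wpM2r ?exprn_ge0//.
    rewrite (_ : _ * _ = e / 2 * (C1 / (C1 + 1))); last first.
      by field; rewrite (gt_eqF al0) gt_eqF// ltr_wpDl.
    rewrite ger_pMr ?divr_gt0// ler_pdivrMr ?ltr_wpDl// mul1r lerDl.
    exact: ler01.
  have -> : alpha * (e / alpha * d ^+ 2) = e * d ^+ 2.
    by field; rewrite gt_eqF.
  move: c2'; move: (`|a| ^+ (2 * delta) * `|b| ^+ 2) => X.
  move: (`|a| ^+ (2 * delta + 2)) (`|b| ^+ (2 * delta + 2)) => Y Z c2' k1.
  have -> : alpha * (C1 * X) = alpha * C1 * X by rewrite mulrA.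
  have -> : alpha * C1 * C2 * Z = alpha * C1 * (C2 * Z) by rewrite -mulrA.
  lra.
have s2 : beta * (G * (1 + `|a| ^+ (2 * delta + 1)) * `|b|) <=
    e / 2 * (1 + `|a| ^+ (2 * delta + 2)) +
    2 * (beta * G) * C3 * `|b| ^+ (2 * delta + 2).
  have bG : 0 < beta * G by rewrite mulr_gt0.
  rewrite (_ : beta * _ = beta * G * (`|b| + `|a| ^+ (2 * delta + 1) * `|b|));
    last by ring.
  apply: (le_trans (ler_wpM2l (ltW bG) (lerD c4 c3))).
  rewrite le_eqVlt; apply/orP; left; apply/eqP; field.
  by rewrite (gt_eqF be0) gt_eqF.
apply: (le_trans (lerD s1 s2)); rewrite [X in _ <= _ + X]mulrDl.
move: (alpha * C1 * C2 * _) (2 * (beta * G) * C3 * _) (`|a| ^+ _) => u v A.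
rewrite !mulrDr; lra.
Qed.

(** The splittings of [p], with [delta = k.+1], that turn [y^p |a|^j] into powers of [y |a|] times
    spare powers of [y <= 1]. *)
Lemma energy_exponents (k : nat) : let p := (2 * k.+1 + 2)%N in
  [/\ p = (k.+3 + k.+1)%N, p = (2 * k + 4)%N, p.-1 = (2 * k + 3)%N,
      p = (k.+2 * 2)%N & p.-1 = (k.+3 + k)%N].
Proof. by split; lia. Qed.

(** In terms of [z = y |a|] the damping is exactly [- beta z^p], and every other term is at most a
    multiple of [z^2] or of [z^(delta + 2)]. Both exponents are below [p], so half of the damping
    absorbs each. *)
Lemma energy_dissipation (alpha beta gamma L : R) (delta : nat) :
  0 < alpha -> 0 < beta -> 0 < gamma -> (0 < delta)%N -> 0 <= L ->
  exists2 C, 0 <= C & forall y dy a d, 0 <= y <= 1 -> `|dy| <= L ->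
  let p := (2 * delta + 2)%N in
  let w := y ^+ p in let dw := p%:R * (y ^+ p.-1 * dy) in
  - d * (dw * a + w * d) + alpha / (delta.+2)%:R * (dw * a ^+ delta.+2) +
  beta * (a * (1 - a ^+ delta) * (a ^+ delta - gamma)) * (w * a) <= C.
Proof.
case: delta => // k al0 be0 ga0 _ L0.
have [pE pE4 pE3 pEd pE1] := energy_exponents k.
set p := (2 * k.+1 + 2)%N in pE pE4 pE3 pEd pE1 *.
(* Left over after completing the square in [d]: the term [w d^2] absorbs [dw a d]. *)
pose A2 := p%:R ^+ 2 * L ^+ 2 / 4.
(* The first summand comes from transport, the second from the middle term
   [(1 + gamma) a^(delta + 2)] of the expanded reaction. *)
pose A3 := alpha / k.+3%:R * (p%:R * L) + beta * (1 + gamma).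
have A20 : 0 <= A2 by rewrite divr_ge0// mulr_ge0 ?sqr_ge0.
have A30 : 0 <= A3.
  by rewrite addr_ge0 ?mulr_ge0// ?invr_ge0//; lra.
have b2 : 0 < beta / 2 by rewrite divr_gt0.
have p2 : (2 < p)%N by rewrite pE4 addnC.
have p3 : (k.+3 < p)%N by rewrite pE -addn1 leq_add2l.
have [C2 C20 hC2] := absorb_power p2 A20 b2.
have [C3 C30 hC3] := absorb_power p3 A30 b2.
exists (C2 + C3); first exact: addr_ge0.
move=> y dy a d /andP[y0 y1] hdy /=.
set w := y ^+ p; set dw := p%:R * (y ^+ p.-1 * dy).
pose z := y * `|a|.
have z0 : 0 <= z by rewrite mulr_ge0.
have yX j : 0 <= y ^+ j <= 1 by rewrite exprn_ge0//= exprn_ile1.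
have e2 : - d * (dw * a + w * d) <= A2 * z ^+ 2.
  have -> : - d * (dw * a + w * d) = y ^+ (2 * k) *
      (- (p%:R * y * dy * (y * a) * (y * d) + (y * (y * d)) ^+ 2)).
    by rewrite /dw /w pE3 [y ^+ p](_ : _ = y ^+ (2 * k + 4)) ?pE4// !exprD; ring.
  have za : z ^+ 2 = (y * a) ^+ 2.
    by rewrite /z !exprMn real_normK ?num_real.
  apply: (@le_trans _ _ (y ^+ (2 * k) * (p%:R ^+ 2 * dy ^+ 2 / 4 * (y * a) ^+ 2))).
    rewrite ler_wpM2l ?exprn_ge0//.
    have := sqr_ge0 (p%:R * dy * (y * a) / 2 + y * (y * d)).
    move: (y * a) (y * d) => A DD; nra.
  have dL : dy ^+ 2 <= L ^+ 2.
    by rewrite -(real_normK (num_real dy)) lerXn2r ?nnegrE.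
  rewrite -za; apply: (@le_trans _ _ (1 * (p%:R ^+ 2 * dy ^+ 2 / 4 * z ^+ 2))).
    rewrite ler_wpM2r//; last by case/andP: (yX (2 * k)%N).
    by rewrite mulr_ge0 ?sqr_ge0// divr_ge0// mulr_ge0 ?sqr_ge0.
  rewrite mul1r ler_wpM2r ?sqr_ge0// /A2 ler_wpM2r// ler_wpM2l// sqr_ge0//.
have wz : w * `|a| ^+ p = z ^+ p by rewrite /z exprMn.
have e3 : alpha / k.+3%:R * (dw * a ^+ k.+3) <=
    alpha / k.+3%:R * (p%:R * L) * z ^+ k.+3.
  rewrite -[leRHS]mulrA ler_wpM2l//; first by rewrite divr_ge0// ltW.
  have yz : y ^+ p.-1 * `|a| ^+ k.+3 <= z ^+ k.+3.
    rewrite pE1 exprD /z exprMn mulrAC; apply: ler_piMr.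
      by apply: mulr_ge0; exact: exprn_ge0.
    by case/andP: (yX k).
  apply: (le_trans (ler_norm _)).
  rewrite /dw normrM [`|p%:R * _|]normrM [`|y ^+ p.-1 * dy|]normrM normr_nat.
  rewrite !normrX (ger0_norm y0).
  rewrite (_ : _ * _ * _ = p%:R * (`|dy| * (y ^+ p.-1 * `|a| ^+ k.+3))); last first.
    by move: (y ^+ p.-1) (`|a| ^+ k.+3) => Y A; ring.
  by rewrite -mulrA ler_wpM2l// ler_pM//; apply: mulr_ge0; exact: exprn_ge0.
(* The product with [a] expands to [(1 + gamma) a^(delta + 2) - a^(2 delta + 2) - gamma a^2]; the
   last term has a favourable sign and is dropped. *)
have e4 : beta * (a * (1 - a ^+ k.+1) * (a ^+ k.+1 - gamma)) * (w * a) <=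
    beta * (1 + gamma) * z ^+ k.+3 - beta * z ^+ p.
  have -> : beta * (a * (1 - a ^+ k.+1) * (a ^+ k.+1 - gamma)) * (w * a) =
      beta * (1 + gamma) * (w * a ^+ k.+3) - beta * (w * (a ^+ k.+2) ^+ 2) -
      beta * gamma * (w * a ^+ 2).
    by rewrite !exprS; ring.
  have w0 : 0 <= w by exact: exprn_ge0.
  have -> : w * (a ^+ k.+2) ^+ 2 = z ^+ p.
    by rewrite -wz pEd !exprM -normrX real_normK ?num_real.
  have h1 : 0 <= beta * gamma * (w * a ^+ 2).
    by apply: mulr_ge0; [exact/ltW/mulr_gt0|apply: mulr_ge0 => //; exact: sqr_ge0].
  have h2 : w * a ^+ k.+3 <= z ^+ k.+3.
    apply: (le_trans (ler_norm _)); rewrite normrM (ger0_norm w0) normrX.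
    rewrite /w pE exprD /z exprMn mulrAC; apply: ler_piMr.
      by apply: mulr_ge0; exact: exprn_ge0.
    by case/andP: (yX k.+1).
  have bg : 0 <= beta * (1 + gamma) by rewrite mulr_ge0//; lra.
  have := ler_wpM2l bg h2; lra.
apply: (le_trans (lerD (lerD e2 e3) e4)).
have := hC3 z z0; rewrite {1}/A3 mulrDl; have := hC2 z z0.
move: (A2 * _) (alpha / _ * _ * _) (beta * (1 + gamma) * _) (z ^+ p).
by move=> u v x zp h2 h3; lra.
Qed.

End pointwise_estimates.

(** * Sections of product-integrable functions and mixed-norm spaces *)

Section product_integrals.
Context d1 d2 (T1 : measurableType d1) (T2 : measurableType d2) (R : realType).
Variable m1 : {finite_measure set T1 -> \bar R}.
Variable m2 : {finite_measure set T2 -> \bar R}.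
Local Notation m := (m1 \x m2)%E.

Lemma integ_snd (q : T2 -> R) : m2.-integrable setT (EFin \o q) ->
  m.-integrable setT (EFin \o (fun z => q z.2)).
Proof.
move=> iq; have mq := integ_measurable iq.
have mq2 : measurable_fun setT (fun z : T1 * T2 => q z.2).
  exact: (measurableT_comp mq measurable_snd).
have mn : measurable_fun setT (fun z : T1 * T2 => `|q z.2|%:E).
  by apply/measurable_EFinP; exact: measurableT_comp.
apply/integrableP; split; first exact/measurable_EFinP.
have -> := @fubini_tonelli1 _ _ _ _ _ m1 m2 _ mn (fun=> normr_ge0 _).
rewrite /fubini_F /= integral_cst//.
have /integrableP[_ qoo] := iq.
by rewrite lte_mul_pinfty// ?ltey_eq ?fin_num_measure//; [exact: integral_ge0|
  rewrite ge0_fin_numE//; exact: integral_ge0].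
Qed.

Lemma integ_fine (F : T1 -> \bar R) : m1.-integrable setT F ->
  m1.-integrable setT (EFin \o (fine \o F)).
Proof.
move=> iF; have /integrableP[mF _] := iF.
apply: (le_integrable measurableT _ _ iF).
  by apply/measurable_EFinP; exact: measurableT_comp.
by move=> x _ /=; case: (F x) => [r||] //=; rewrite ?normr0 ?leey.
Qed.

Lemma integ_fubini (q : T1 * T2 -> R) : m.-integrable setT (EFin \o q) ->
  m1.-integrable setT (EFin \o (fun r => \int[m2]_x q (r, x))).
Proof.
by move=> iq; exact: (integ_fine (integrable_fubini_F iq)).
Qed.

Lemma integ_sections (q : T1 * T2 -> R) : m.-integrable setT (EFin \o q) ->
  \forall r \ae m1, m2.-integrable setT (EFin \o (fun x => q (r, x))).
Proof. by move=> iq; exact: (ae_integrable1 iq). Qed.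

End product_integrals.

Section Rintegral_bounds.
Context d (T : measurableType d) (R : realType) (mu : {measure set T -> \bar R}).

(** The majorant may be infinite, as the defects below may be; passing to the positive part of [f]
    reduces to integrals of nonnegative functions. *)
Lemma Rintegral_le_integral (f : T -> R) (q : T -> \bar R) :
  mu.-integrable setT (EFin \o f) -> measurable_fun setT q ->
  (forall x, 0 <= q x)%E -> (\forall x \ae mu, (f x)%:E <= q x)%E ->
  ((\int[mu]_x f x)%:E <= \int[mu]_x q x)%E.
Proof.
move=> fi mq q0 fq; have mf := integ_measurable fi.
pose f1 x := Num.max (f x) 0.
have mf1 : measurable_fun setT f1 by exact: measurable_maxr.
have if1 : mu.-integrable setT (EFin \o f1).
  apply: (integ_dom mf1 (integ_norm fi)) => x; rewrite /f1.
  by case: (leP (f x) 0) => h; rewrite ?normr0.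
apply: (@le_trans _ _ (\int[mu]_x (f1 x)%:E)%E).
  rewrite (integ_integral if1) lee_fin; apply: le_Rintegral => // x _.
  by rewrite /f1 le_max lexx.
apply: ae_ge0_le_integral => //.
- by move=> x _; rewrite lee_fin /f1 le_max lexx orbT.
- exact/measurable_EFinP.
- apply: ae_imp fq => x h _; rewrite /f1 /=.
  by case: (leP (f x) 0) => ?.
Qed.

End Rintegral_bounds.

Section LqLp_spaces.
Context (R : realType).
Local Notation I := (leb (0 : R) 1).

(** With equal exponents, the [n]-th power of the iterated norm is a double integral, by Tonelli. *)
Lemma LqLp_integ (T : R) (n : nat) (u : R -> R -> R) : (0 < n)%N ->
  LqLp T (n%:R)%:E (n%:R)%:E u ->
  (leb 0 T \x I)%E.-integrable setT (EFin \o (fun z => `|u z.1 z.2| ^+ n)).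
Proof.
move=> n0 [mu' fin].
have mf : measurable_fun setT (fun z : R * R => `|u z.1 z.2| ^+ n).
  by apply: measurable_funX; exact: measurableT_comp.
have mE : measurable_fun setT (fun z : R * R => (`|u z.1 z.2| ^+ n)%:E).
  exact/measurable_EFinP.
have f0 (z : R * R) : (0 <= (`|u z.1 z.2| ^+ n)%:E)%E.
  by rewrite lee_fin exprn_ge0.
apply: integ_ltyP => [|z|]; [exact: mf|by rewrite exprn_ge0|].
have -> := @fubini_tonelli1 _ _ _ _ _ (leb 0 T) I _ mE f0.
have nn : n%:R != 0 :> R by rewrite pnatr_eq0 -lt0n.
have -> : (\int[leb 0 T]_t fubini_F I (fun z => (`|u z.1 z.2| ^+ n)%:E) t =
  ('N[leb 0 T]_(n%:R)%:E [(fun t => 'N[I]_(n%:R)%:E [EFin \o u t])]) `^ n%:R)%E.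
  rewrite poweR_Lnorm//; apply: eq_integral => t _.
  rewrite gee0_abs ?Lnorm_ge0//.
  by rewrite (@LnormX_fin _ _ _ I)//.
exact: poweR_lty.
Qed.

Lemma within_continuous_interior (g : R -> R) (a b s : R) : a < s < b ->
  {within `[a, b], continuous g} -> {for s, continuous g}.
Proof.
move=> sab cg.
have cg' : {within `]a, b[, continuous g}.
  apply: continuous_subspaceW cg => x /=.
  by rewrite !in_itv/= => /andP[/ltW -> /ltW ->].
move: cg'; rewrite (continuous_open_subspace g (itv_open a b)) => /(_ s).
by rewrite inE /= in_itv/=; exact.
Qed.

End LqLp_spaces.

(** * Loss of window mass near the final time *)

Section window_averages.
Context (R : realType).
Implicit Types (h t s T : R).

Lemma window_full T h t : 0 <= h -> h <= t -> t < T ->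
  (\int[leb 0 T]_r (window h t r)%:E = h%:E)%E.
Proof.
move=> h0 ht tT; rewrite integral_indic ?setIT//.
rewrite -[LHS]/(lebesgue_measure (`]t - h, t]%classic `&` `]0, T[%classic)).
rewrite setIidl; last first.
  move=> x; rewrite /= !in_itv/= => /andP[x1 x2].
  by rewrite (le_lt_trans _ x1) ?subr_ge0//= (le_lt_trans x2).
rewrite lebesgue_measure_itv/= lte_fin; case: ifPn => [_|].
  by rewrite -EFinD opprB addrCA subrr addr0.
rewrite -leNgt lerBrDl -lerBrDr subrr => h1; congr EFin; lra.
Qed.

(** A window containing [s] ends at some [t >= s], and less than [h/2] of time remains before
    [T]. *)
Lemma window_tail T h s : 0 <= h -> T - h / 2 < s -> s < T ->
  (\int[leb 0 T]_t (window h t s)%:E <= (h / 2)%:E)%E.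
Proof.
move=> h0 hs sT; under eq_integral do rewrite windowE.
rewrite integral_indic ?setIT//.
apply: (@le_trans _ _ (lebesgue_measure `[s, T]%classic)).
  apply: le_measure; rewrite ?inE//=; first exact: measurableI.
  by move=> x; rewrite /= !in_itv/= => -[/andP[-> _] /andP[_ /ltW ->]].
rewrite lebesgue_measure_itv/= lte_fin sT -EFinD lee_fin; lra.
Qed.

(** By Tonelli, each [r] is weighted by the measure of the [t] whose window contains it: at most
    [h], and at most [h/2] for [r] in the last half window. This deficit is what later isolates the
    energy near [T]. *)
Lemma window_int2_tail T h q : 0 <= h ->
  (leb 0 T).-integrable setT (EFin \o q) -> (forall r, 0 <= q r) ->
  (\int[leb 0 T]_t \int[leb 0 T]_r (window h t r * q r)%:E <=
   (\int[leb 0 T]_r (h * q r - h / 2 * (q r * \1_(`]T - h / 2, T[%classic) r)))%:E)%E.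
Proof.
move=> h0 iq q0; have mq := integ_measurable iq.
have mf : measurable_fun setT (fun z : R * R => (window h z.1 z.2 * q z.2)%:E).
  apply: (@measurable_windowM _ h (fun z => q z.2)).
  exact: (measurableT_comp mq measurable_snd).
have f0 (z : R * R) : (0 <= (window h z.1 z.2 * q z.2)%:E)%E.
  by rewrite lee_fin mulr_ge0// window_ge0.
have -> := @fubini_tonelli _ _ _ _ _ (leb 0 T) (leb 0 T) _ mf f0.
pose k r := h * q r - h / 2 * (q r * \1_(`]T - h / 2, T[%classic) r).
have ik : (leb 0 T).-integrable setT (EFin \o k).
  by apply: integB; apply: integZ => //; exact: integ_indicM.
have k0 r : 0 <= k r.
  rewrite /k indicE; move: (q r) (q0 r) => a a0.
  by case: (r \in _); rewrite ?mulr1 ?mulr0; nra.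
rewrite -(integ_integral ik).
apply: (ae_ge0_le_integral measurableT).
- by move=> t _; apply: integral_ge0 => r _; exact: (f0 (r, t)).
- exact: (@measurable_fun_fubini_tonelli_G _ _ _ _ _ (leb 0 T) _ mf f0).
- by move=> r _; rewrite lee_fin.
- by apply/measurable_EFinP; exact: integ_measurable ik.
apply: ae_imp (ae_leb_itv (0 : R) T) => r /andP[r0 rT] _ /=.
under eq_integral do rewrite mulrC EFinM.
rewrite (@ge0_integralZl _ _ _ (leb 0 T) setT measurableT
  (fun t => (window h t r)%:E)); last 3 first.
- by apply/measurable_EFinP; exact: measurable_window_t.
- by move=> t _; rewrite lee_fin window_ge0.
- by rewrite lee_fin.
have kE : k r = q r * (if r \in `]T - h / 2, T[ then h / 2 else h).
  rewrite /k indicE mem_setE; move: (q r) => a.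
  by case: ifP => _; rewrite ?mulr1 ?mulr0; lra.
rewrite kE EFinM lee_wpmul2l ?lee_fin//; case: ifPn => [|_].
  by rewrite in_itv /= => /andP[hr _]; exact: window_tail.
exact: window_int_t.
Qed.


End window_averages.

(** * The localized energy of weak solutions *)

Section weak_solutions.
Context (R : realType) (alpha beta gamma T : R) (delta : nat).
Hypotheses (al0 : 0 < alpha) (be0 : 0 < beta) (ga0 : 0 < gamma).
Hypotheses (de0 : (0 < delta)%N) (T0 : 0 < T).

Local Notation I := (leb (0 : R) 1).
Local Notation nu := (leb (0 : R) T).
Local Notation m := (nu \x I)%E.
Local Notation p := (2 * delta + 2)%N.
Local Notation integ mu f := (mu.-integrable setT (EFin \o f)).

Variables (omega : set R) (f : R * R -> R) (u v ux : R -> R -> R).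
Variable ut : R -> (R -> R) -> R.
Hypothesis hu : LqLp T (p%:R)%:E (p%:R)%:E u.
Hypothesis hux : LqLp T (2%:R)%:E (2%:R)%:E ux.
Hypothesis hH : \forall t \ae nu, H10 (u t) (ux t).
Hypothesis htd : time_derivative T u ut.
Hypothesis hut : forall phi dphi, H10 phi dphi ->
  measurable_fun [set: R] (fun t => ut t phi).
Hypothesis hweak : forall phi dphi, H10 phi dphi -> \forall t \ae nu,
  ut t phi + \int[I]_x (ux t x * dphi x)
    + alpha * \int[I]_x (u t x ^+ delta * ux t x * phi x)
  = beta * \int[I]_x (u t x * (1 - u t x ^+ delta)
                        * (u t x ^+ delta - gamma) * phi x)
    + \int[I]_x (\1_omega x * f (t, x) * phi x).
Hypothesis hv : weakly_continuous_representative T u v.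
Hypothesis hv0 : forall phi dphi, H10 phi dphi ->
  \int[I]_x (v t x * phi x) @[t --> 0^'+] --> (0 : R).

Variables (w : R -> R) (C : R).
Hypothesis tw : test_function 0 1 w.
Hypothesis w0 : forall x, 0 <= w x.
Hypothesis womega : forall x, omega x -> w x = 0.
Hypothesis C0 : 0 <= C.
Hypothesis dissipation : forall x a d,
  - d * (derive1 w x * a + w x * d)
  + alpha / (delta.+2)%:R * (derive1 w x * a ^+ delta.+2)
  + beta * (a * (1 - a ^+ delta) * (a ^+ delta - gamma)) * (w x * a) <= C.

Let mw := smooth_measurable (test_function_smooth tw).
Let mdw := smooth_measurable (smooth_derive1 (test_function_smooth tw)).

Let mu2 : measurable_fun setT (fun z : R * R => u z.1 z.2) := hu.1.
Let mux2 : measurable_fun setT (fun z : R * R => ux z.1 z.2) := hux.1.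

Let sec (q : R -> R -> R) : measurable_fun setT (fun z : R * R => q z.1 z.2) ->
  forall t, measurable_fun setT (q t).
Proof.
by move=> mq t; exact: (measurableT_comp mq (pair1_measurable t)).
Qed.

Definition reaction (a : R) := a * (1 - a ^+ delta) * (a ^+ delta - gamma).
Definition flux1 (z : R * R) := - ux z.1 z.2.
(** Tested with a [phi] that vanishes on [omega], the equation says that [ut t phi] is the integral
    of [flux1] against [phi'] plus that of [flux2] against [phi]. [flux1] is square integrable, and
    [flux2] pairs with functions in [L^(2 delta + 2)]. *)
Definition flux2 (z : R * R) :=
  - (alpha * (u z.1 z.2 ^+ delta * ux z.1 z.2)) + beta * reaction (u z.1 z.2).
(** The weak space derivative of [test2], which is [w u]. *)
Definition test1 (z : R * R) := derive1 w z.2 * u z.1 z.2 + w z.2 * ux z.1 z.2.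
Definition test2 (z : R * R) := w z.2 * u z.1 z.2.
(** The integrable weight that dominates [flux2] in [young_flux]. *)
Definition dominant (z : R * R) := ux z.1 z.2 ^+ 2 + `|u z.1 z.2| ^+ p + 1.

Definition good t := [/\ 0 < t < T, H10 (u t) (ux t),
  integ I (fun x => `|u t x| ^+ p) & \forall x \ae I, v t x = u t x].

Let iu : integ m (fun z => `|u z.1 z.2| ^+ p).
Proof. by apply: LqLp_integ => //; rewrite addn2. Qed.

Let iux : integ m (fun z => ux z.1 z.2 ^+ 2).
Proof.
have := @LqLp_integ R T 2 ux isT hux.
by congr (integrable _ _ _); apply/funext => z /=; rewrite real_normK ?num_real.
Qed.

Let icst (k : R) : integ m (fun=> k).
Proof. exact: (@finite_measure_integrable_cst _ _ _ (prod2 nu I)). Qed.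

Let iD : integ m dominant.
Proof. by apply: integD (icst 1); exact: integD. Qed.

Lemma ae_good : \forall t \ae nu, good t.
Proof.
have h1 := integ_sections iu.
have [_ _ h2] := hv.
have h3 := ae_leb_itv (0 : R) T.
have := ae_and (ae_and h1 h2) (ae_and h3 hH).
by apply: ae_imp => t [[? ?] [? ?]].
Qed.

Lemma measurable_reaction (q : R * R -> R) : measurable_fun setT q ->
  measurable_fun setT (fun z => reaction (q z)).
Proof.
move=> mq; apply: measurable_funM; last first.
  by apply: measurable_funB => //; exact: measurable_funX.
by apply: measurable_funM => //; apply: measurable_funB => //; exact: measurable_funX.
Qed.

Let mw2 : measurable_fun setT (fun z : R * R => w z.2).
Proof. exact: (measurableT_comp mw measurable_snd). Qed.

Let mdw2 : measurable_fun setT (fun z : R * R => derive1 w z.2).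
Proof. exact: (measurableT_comp mdw measurable_snd). Qed.

Lemma measurable_flux1 : measurable_fun setT flux1.
Proof. exact: (measurableT_comp _ mux2). Qed.

Lemma measurable_flux2 : measurable_fun setT flux2.
Proof.
apply: measurable_funD.
  apply: measurableT_comp => //; apply: measurable_funM => //.
  by apply: measurable_funM => //; exact: measurable_funX.
by apply: measurable_funM => //; exact: measurable_reaction.
Qed.

Lemma measurable_test1 : measurable_fun setT test1.
Proof. by apply: measurable_funD; exact: measurable_funM. Qed.

Lemma measurable_test2 : measurable_fun setT test2.
Proof. exact: measurable_funM. Qed.

Lemma H10_test t : good t -> H10 (fun x => test2 (t, x)) (fun x => test1 (t, x)).
Proof. by case=> _ h _ _; exact: H10_mul. Qed.

Lemma integ_test2 t : good t -> integ I (fun x => `|test2 (t, x)| ^+ p).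
Proof.
move=> [_ _ ip _]; have [M M0 wM] := test_function_bounded tw.
apply: (integ_dom _ (integZ (M ^+ p) ip)) => [|x].
  apply: measurable_funX; apply: measurableT_comp => //.
  by apply: measurable_funM => //; exact: sec.
rewrite normrX normr_id /test2 /= normrM exprMn ler_wpM2r ?exprn_ge0//.
by rewrite lerXn2r ?nnegrE.
Qed.

Let msnd (q : R * R -> R) t : measurable_fun setT q ->
  measurable_fun setT (fun z : R * R => q (t, z.2)).
Proof.
move=> mq; apply: (measurableT_comp mq).
apply/measurable_fun_pairP; split => /=; first exact: measurable_cst.
exact: measurable_snd.
Qed.

Lemma integ_pairing1 t : good t ->
  integ m (fun z => flux1 z * test1 (t, z.2)).
Proof.
move=> gt; have [_ H2 _ _] := H10_test gt.
have i1 := @integ_snd _ _ _ _ R nu I _ (L2_sq H2).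
apply: (integ_dom _ (integD iux i1)) => [|z].
  apply: measurable_funM; first exact: measurable_flux1.
  exact: msnd measurable_test1.
rewrite /flux1 normrM normrN; set x := ux _ _; set y := test1 _.
rewrite -(real_normK (num_real x)) -(real_normK (num_real y)).
have := sqr_ge0 (`|x| - `|y|); have := normr_ge0 x; have := normr_ge0 y.
by move: (`|x|) (`|y|) => a b; nra.
Qed.

Let flux_bound e : 0 < e -> exists2 K, 0 <= K & forall a d b : R,
  `|(- (alpha * (a ^+ delta * d)) + beta * reaction a) * b| <=
  e * (d ^+ 2 + `|a| ^+ p + 1) + K * `|b| ^+ p.
Proof. exact: young_flux. Qed.

Lemma integ_pairing2 t : good t ->
  integ m (fun z => flux2 z * test2 (t, z.2)) /\
  integ m (fun z => reaction (u z.1 z.2) * test2 (t, z.2)).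
Proof.
move=> gt; have [K K0 hK] := flux_bound ltr01.
have i1 := @integ_snd _ _ _ _ R nu I _ (integ_test2 gt).
have i2 := integD (integZ 1 iD) (integZ K i1).
split.
  apply: (integ_dom _ i2) => [|z]; last exact: hK.
  apply: measurable_funM; first exact: measurable_flux2.
  exact: msnd measurable_test2.
apply: (integ_dom _ (integZ beta^-1 i2)) => [|z].
  apply: measurable_funM; first exact: measurable_reaction.
  exact: msnd measurable_test2.
rewrite ler_pdivlMl// -{1}(gtr0_norm be0) -normrM mulrA.
(* At [d = 0] the flux bound isolates the reaction. *)
have := hK (u z.1 z.2) 0 (test2 (t, z.2)).
rewrite !mulr0 oppr0 add0r => h; apply: (le_trans h).
by rewrite !mul1r lerD2r /dominant lerD2r lerD2r expr0n /= sqr_ge0.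
Qed.

Definition density t z := flux1 z * test1 (t, z.2) + flux2 z * test2 (t, z.2).
(** The pairing of [u_t] at time [r] with [w u] frozen at time [t], as computed from the
    equation. *)
Definition rate t r := \int[I]_x density t (r, x).

Lemma integ_density t : good t -> integ m (density t).
Proof.
by move=> gt; apply: integD; [exact: integ_pairing1|exact: (integ_pairing2 gt).1].
Qed.

(** The control disappears here, because [test2 (t, _)] vanishes on [omega] by [womega]. *)
Lemma ae_rate t : good t ->
  \forall r \ae nu, ut r (fun x => test2 (t, x)) = rate t r.
Proof.
have aux (y a b c : R) : y + -1 * a + 1 * (c - b) = c -> y = a + b by lra.
move=> gt; have i1 := integ_sections (integ_pairing1 gt).
have [/integ_sections i2 /integ_sections i3] := integ_pairing2 gt.
have := ae_and (hweak (H10_test gt)) (ae_and i1 (ae_and i2 i3)).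
apply: ae_imp => r [e [{}i1 [{}i2 {}i3]]].
have e1 : \int[I]_x (ux r x * test1 (t, x)) =
    -1 * \int[I]_x (flux1 (r, x) * test1 (t, x)).
  rewrite -RintegralZl//; apply: eq_Rintegral => x _.
  by rewrite /flux1 /=; ring.
(* The transport integral is recovered from the reaction and [flux2] pairings, whose integrability
   is at hand. *)
have e2 : \int[I]_x (u r x ^+ delta * ux r x * test2 (t, x)) =
    alpha^-1 * (beta * \int[I]_x (reaction (u r x) * test2 (t, x)) -
                \int[I]_x (flux2 (r, x) * test2 (t, x))).
  rewrite -RintegralZl// -RintegralB//; last exact: integZ.
  rewrite -RintegralZl//; last by apply: integB => //; exact: integZ.
  apply: eq_Rintegral => x _; rewrite /flux2 /=.
  by field; rewrite gt_eqF.
have e3 : \int[I]_x (\1_omega x * f (r, x) * test2 (t, x)) = 0.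
  rewrite (_ : (fun x => _) = fun=> 0) ?Rintegral_cst//; last first.
    apply/funext => x; rewrite indicE /test2 /=.
    have [/set_mem/womega ->|_] := boolP (x \in omega); last by rewrite !mul0r.
    by rewrite mul0r mulr0.
  by rewrite mul0r.
move: e; rewrite e1 e2 e3 /rate /density RintegralD//= addr0 mulrA divff ?gt_eqF//.
exact: aux.
Qed.

(** * Increments of the moments against a frozen test function *)

Definition moment t r := \int[I]_x (u r x * test2 (t, x)).
(** [moment] is built on [u], which satisfies the equation; [vmoment] is built on [v], so that it is
    continuous in [r] and can be evaluated at given times. *)
Definition vmoment t r := \int[I]_x (v r x * test2 (t, x)).

Lemma exprn_le1D n (a : R) : (n <= p)%N -> `|a| ^+ n <= 1 + `|a| ^+ p.
Proof.
move=> np; have [a1|/ltW a1] := leP `|a| 1.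
  by apply: ler_wpDr; [exact: exprn_ge0|exact: exprn_ile1].
by apply: ler_wpDl => //; exact: ler_weXn2l.
Qed.

Lemma integ_rate t : good t -> integ nu (rate t).
Proof. by move=> gt; exact: (integ_fubini (integ_density gt)). Qed.

Lemma integ_moment t : good t -> integ nu (moment t).
Proof.
move=> gt; apply: (@integ_fubini _ _ _ _ R nu I (fun z => u z.1 z.2 * test2 (t, z.2))).
have [/L2_sq h _ _ _] := H10_test gt.
have i1 := @integ_snd _ _ _ _ R nu I _ h.
apply: (integ_dom _ (integD (integD (icst 1) iu) i1)) => [|z].
  by apply: measurable_funM => //; exact: msnd measurable_test2.
have := @exprn_le1D 2 (u z.1 z.2) ltac:(by rewrite addn2).
move: (u _ _) (test2 _) (`|u _ _| ^+ p) => a b c.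
rewrite normrM -(real_normK (num_real b)).
by move: (`|a|) (`|b|) (normr_ge0 a) (normr_ge0 b) => x y; nra.
Qed.

Let v_L2 r : 0 <= r <= T -> L2 (v r).
Proof. by move: r; case: hv. Qed.

Lemma ae_moment t : good t -> \forall r \ae nu, moment t r = vmoment t r.
Proof.
move=> gt; have [_ _ h] := hv; have [/L2_measurable mt _ _ _] := H10_test gt.
have := ae_and h (ae_leb_itv (0 : R) T).
apply: ae_imp => r [e /andP[r0 rT]].
have /v_L2/L2_measurable mv : 0 <= r <= T by rewrite (ltW r0) (ltW rT).
apply: ae_eq_Rintegral; [by apply: measurable_funM mt; exact: sec|exact: measurable_funM|].
by apply: ae_imp e => x ->.
Qed.

Lemma continuous_vmoment t r : good t -> 0 < r < T ->
  {for r, continuous (vmoment t)}.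
Proof.
move=> gt r0T; have [_ h _] := hv; have [h2 _ _ _] := H10_test gt.
exact: (within_continuous_interior r0T (h _ h2)).
Qed.

Lemma rate_test t theta : good t -> test_function 0 T theta ->
  \int[nu]_r (rate t r * theta r) = - \int[nu]_r (moment t r * derive1 theta r).
Proof.
move=> gt tt; have ht := H10_test gt; rewrite -(htd tt ht).
have mth := smooth_measurable (test_function_smooth tt).
apply: ae_eq_Rintegral.
- by apply: measurable_funM mth; exact: integ_measurable (integ_rate gt).
- by apply: measurable_funM mth; exact: hut ht.
- by apply: ae_imp (ae_rate gt) => r ->.
Qed.

Lemma vmoment_increment s t : good t -> 0 < s -> s < t ->
  vmoment t t - vmoment t s = \int[nu]_r (rate t r * \1_(`]s, t]%classic) r).
Proof.
move=> gt s0 st; have [/andP[t0 tT] _ _ _] := gt.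
apply: (du_bois_reymond T0 s0 st tT (integ_rate gt) (integ_moment gt) (ae_moment gt)).
- by apply: continuous_vmoment => //; rewrite s0 (lt_trans st).
- by apply: continuous_vmoment => //; rewrite t0.
- by move=> theta; exact: rate_test.
Qed.

Lemma vmoment_increment0 t : good t ->
  vmoment t t = \int[nu]_r (rate t r * \1_(`]0, t]%classic) r).
Proof.
move=> gt; have [t0T _ _ _] := gt.
apply: (du_bois_reymond0 T0 t0T (integ_rate gt) (integ_moment gt) (ae_moment gt)).
- by move=> s s0T; exact: continuous_vmoment.
- exact: hv0 (H10_test gt).
- by move=> theta; exact: rate_test.
Qed.


(** * The rate on the diagonal [r = t] *)

Lemma integ_diagonal t : good t ->
  [/\ integ I (fun x => flux1 (t, x) * test1 (t, x)),
      integ I (fun x => flux2 (t, x) * test2 (t, x)) &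
      integ I (fun x => reaction (u t x) * test2 (t, x))].
Proof.
move=> gt; have [_ hut' ip _] := gt; have [mu' mux'] := (sec mu2 t, sec mux2 t).
have [_ /[dup] hux2 /L2_sq iux2 _ _] := hut'; have [_ ht _ _] := H10_test gt.
have [K K0 hK] := flux_bound ltr01; have i2 := integ_test2 gt.
have idom : integ I (fun x => 1 * dominant (t, x) + K * `|test2 (t, x)| ^+ p).
  apply: integD; last exact: integZ.
  apply: integZ; apply: integD; first exact: integD.
  exact: finite_measure_integrable_cst.
have mt2 : measurable_fun setT (fun x => test2 (t, x)).
  by apply: measurable_funM => //; exact: sec.
split.
- have := L2M (L2Z (-1) hux2) ht.
  by under eq_fun do rewrite mulN1r.
- apply: (integ_dom _ idom) => [|x]; last exact: hK.
  apply: measurable_funM => //.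
  exact: (measurableT_comp measurable_flux2 (pair1_measurable t)).
- apply: (integ_dom _ (integZ beta^-1 idom)) => [|x].
    apply: measurable_funM => //.
    exact: (measurableT_comp (measurable_reaction mu2) (pair1_measurable t)).
  rewrite ler_pdivlMl// -{1}(gtr0_norm be0) -normrM mulrA.
  have := hK (u t x) 0 (test2 (t, x)).
  rewrite !mulr0 oppr0 add0r => h; apply: (le_trans h).
  by rewrite !mul1r lerD2r /dominant lerD2r lerD2r expr0n /= sqr_ge0.
Qed.

Let I_prob (k : R) : \int[I]_x k = k.
Proof.
rewrite Rintegral_cst//; transitivity (k * fine (1%:E : \bar R)); last exact: mulr1.
by congr (_ * fine _); exact: (leb_setT ltr01).
Qed.

Let I_icst (k : R) : integ I (fun=> k).
Proof. exact: finite_measure_integrable_cst. Qed.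

(** At [r = t] the chain rule with exponent [delta.+2] turns the transport term into
    [alpha / (delta + 2)] times the integral of [w' u^(delta + 2)]. The integrand is then the one
    bounded pointwise by [dissipation], and the space interval has length 1. *)
Lemma rate_diagonal t : good t -> rate t t <= C.
Proof.
move=> gt; have [_ hut' ip _] := gt; have [j1 j2 j3] := integ_diagonal gt.
have chain := H10_chain_rule delta.+1 hut' tw.
have [M M0 dwM] := test_function_derive_bounded tw.
have j4 : integ I (fun x => derive1 w x * u t x ^+ delta.+2).
  have i1 := integD (I_icst 1) ip.
  apply: (integ_dom _ (integZ M i1)) => [|x].
    by apply: measurable_funM => //; apply: measurable_funX; exact: sec.
  rewrite normrM normrX ler_pM ?exprn_ge0//; apply: exprn_le1D.
  by rewrite -[X in (X <= _)%N]addn2 leq_add2r leq_pmull.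
(* As in [ae_rate], the transport integrand is a combination of the reaction and [flux2]
   pairings. *)
have j5 : integ I (fun x => w x * u t x ^+ delta.+1 * ux t x).
  have h := integZ alpha^-1 (integB (integZ beta j3) j2).
  rewrite (_ : (fun x => _) = fun x => alpha^-1 *
    (beta * (reaction (u t x) * test2 (t, x)) - flux2 (t, x) * test2 (t, x)))//.
  by apply/funext => x; rewrite /flux2 /test2 /= exprS; field; rewrite gt_eqF.
rewrite -(I_prob C).
have -> : rate t t = \int[I]_x (flux1 (t, x) * test1 (t, x) +
    alpha / delta.+2%:R * (derive1 w x * u t x ^+ delta.+2) +
    beta * (reaction (u t x) * test2 (t, x))).
  have j6 := integZ (alpha / delta.+2%:R) j4.
  have j7 := integZ beta j3.
  have j8 := integZ (- alpha) j5.
  rewrite /rate /density RintegralD//=.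
  rewrite RintegralD//=; last exact: integD.
  rewrite RintegralD//= -addrA; congr (_ + _).
  transitivity (\int[I]_x (- alpha * (w x * u t x ^+ delta.+1 * ux t x) +
      beta * (reaction (u t x) * test2 (t, x)))).
    apply: eq_Rintegral => x _; rewrite /flux2 /test2 /= exprS; ring.
  rewrite RintegralD//=; congr (_ + _).
  rewrite RintegralZl// RintegralZl//.
  have -> : \int[I]_x (derive1 w x * u t x ^+ delta.+2) =
      - (delta.+2%:R * \int[I]_x (w x * u t x ^+ delta.+1 * ux t x)).
    by rewrite chain opprK.
  by rewrite mulrN mulrA divfK ?pnatr_eq0// mulNr.
apply: ae_le_Rintegral; last first.
- apply: aeW => x; have := dissipation x (u t x) (ux t x).
  by rewrite -(mulrA beta).
- exact: finite_measure_integrable_cst.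
- by apply: integD; [apply: integD => //; exact: integZ|exact: integZ].
Qed.

(** * Cost of replacing coefficients at time [r] by those at time [t] *)

Definition defect1 z := `|flux1 (z.1.2, z.2) - flux1 (z.1.1, z.2)| * `|test1 (z.1.1, z.2)|.
Definition defect2 z := `|flux2 (z.1.2, z.2) - flux2 (z.1.1, z.2)| * `|test2 (z.1.1, z.2)|.
Definition defect z : R := defect1 z + defect2 z.
(** Kept extended-real: at an individual [t] it may be infinite, and only its integral over [t] is
    shown to be small. *)
Definition total_defect h t : \bar R :=
  (\int[nu]_r \int[I]_x (window h t r * defect (t, r, x))%:E)%E.

Let measurable_increment (q b : R * R -> R) : measurable_fun setT q ->
  measurable_fun setT b ->
  measurable_fun setT (fun z : R * R * R =>
    `|q (z.1.2, z.2) - q (z.1.1, z.2)| * `|b (z.1.1, z.2)|).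
Proof.
move=> mq mb; apply: measurable_funM; apply: measurableT_comp => //.
  by apply: measurable_funB; [exact: measurable_rx|exact: measurable_tx].
exact: measurable_tx.
Qed.

Lemma measurable_defect1 : measurable_fun setT defect1.
Proof. exact: measurable_increment measurable_flux1 measurable_test1. Qed.

Lemma measurable_defect2 : measurable_fun setT defect2.
Proof. exact: measurable_increment measurable_flux2 measurable_test2. Qed.

Lemma measurable_defect : measurable_fun setT defect.
Proof. exact: measurable_funD measurable_defect1 measurable_defect2. Qed.

Lemma defect_ge0 z : 0 <= defect z.
Proof. by rewrite addr_ge0// mulr_ge0. Qed.

Let window_defect_ge0 h t r x : (0 <= (window h t r * defect (t, r, x))%:E)%E.
Proof. by rewrite lee_fin mulr_ge0 ?window_ge0 ?defect_ge0. Qed.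

Let mwd h : measurable_fun setT (fun z : R * R * R =>
  (window h z.1.1 z.1.2 * defect z)%:E).
Proof. by apply: measurable_window3; exact: measurable_defect. Qed.

Let mwd_t h t : measurable_fun setT (fun z : R * R =>
  (window h t z.1 * defect (t, z.1, z.2))%:E).
Proof.
have mq : measurable_fun setT (fun z : R * R => (t, z.1, z.2)).
  apply/measurable_fun_pairP; split => /=; last exact: measurable_snd.
  by apply/measurable_fun_pairP; split => /=; [exact: measurable_cst|exact: measurable_fst].
exact: (measurableT_comp (mwd h) mq).
Qed.

Lemma measurable_defect_r h t : measurable_fun setT
  (fun r => \int[I]_x (window h t r * defect (t, r, x))%:E)%E.
Proof.
exact: (@measurable_fun_fubini_tonelli_F _ _ _ _ _ I
  (fun z : R * R => (window h t z.1 * defect (t, z.1, z.2))%:E) (mwd_t h t)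
  (fun z => window_defect_ge0 h t z.1 z.2)).
Qed.
Lemma density_increment t r x : density t (r, x) - density t (t, x) <= defect (t, r, x).
Proof.
rewrite /density /defect /defect1 /defect2 /=.
have -> : flux1 (r, x) * test1 (t, x) + flux2 (r, x) * test2 (t, x) -
    (flux1 (t, x) * test1 (t, x) + flux2 (t, x) * test2 (t, x)) =
  (flux1 (r, x) - flux1 (t, x)) * test1 (t, x) + (flux2 (r, x) - flux2 (t, x)) * test2 (t, x).
  move: (flux1 _) (flux2 _) (flux1 _) (flux2 _) (test1 _) (test2 _) => *; ring.
by rewrite lerD// -normrM ler_norm.
Qed.

Lemma rate_le t r : good t -> integ I (fun x => density t (r, x)) ->
  ((rate t r)%:E <= C%:E + \int[I]_x (defect (t, r, x))%:E)%E.
Proof.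
move=> gt ir; have [j1 j2 _] := integ_diagonal gt.
have it : integ I (fun x => density t (t, x)) by exact: integD.
have -> : rate t r = rate t t + \int[I]_x (density t (r, x) - density t (t, x)).
  by rewrite RintegralB//= /rate addrC subrK.
rewrite EFinD leeD//; first by rewrite lee_fin rate_diagonal.
apply: Rintegral_le_integral; first exact: integB.
- have mp : measurable_fun setT (fun x : R => (t, r, x)).
    by apply/measurable_fun_pairP; split => /=; [exact: measurable_cst|exact: measurable_id].
  by apply/measurable_EFinP; exact: (measurableT_comp measurable_defect mp).
- by move=> x; rewrite lee_fin defect_ge0.
- by apply: aeW => x; rewrite lee_fin density_increment.
Qed.

(** On []s, t]] the window equals 1 and the rate is at most [C] plus the defect; outside, the left
    integrand vanishes while the majorant is nonnegative, so the whole window may be used. *)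
Lemma increment_le h s t : good t -> 0 <= h -> t - h <= s ->
  ((\int[nu]_r (rate t r * \1_(`]s, t]%classic) r))%:E <=
   (C * h)%:E + total_defect h t)%E.
Proof.
move=> gt h0 ths.
pose q r := ((window h t r * C)%:E + \int[I]_x (window h t r * defect (t, r, x))%:E)%E.
have q1 r : (0 <= (window h t r * C)%:E)%E by rewrite lee_fin mulr_ge0// window_ge0.
have q2 r : (0 <= \int[I]_x (window h t r * defect (t, r, x))%:E)%E.
  by apply: integral_ge0 => x _; exact: window_defect_ge0.
have m1 : measurable_fun setT (fun r => (window h t r * C)%:E).
  by apply/measurable_EFinP; apply: measurable_funM => //; exact: measurable_window_r.
have m2 := measurable_defect_r h t.
have mq : measurable_fun setT q by exact: emeasurable_funD.
apply: (@le_trans _ _ (\int[nu]_r q r)%E).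
  apply: Rintegral_le_integral => //.
  - by apply: integ_indicM => //; exact: integ_rate.
  - by move=> r; exact: adde_ge0.
  apply: ae_imp (integ_sections (integ_density gt)) => r ir.
  rewrite indicE; have [/set_mem|_] := boolP (r \in _); last first.
    by rewrite mulr0; exact: adde_ge0.
  rewrite /= in_itv /= => /andP[sr rt]; rewrite mulr1 /q.
  have -> : window h t r = 1.
    by rewrite /window indicE mem_set//= in_itv /= rt (le_lt_trans ths).
  under eq_integral do rewrite mul1r.
  by rewrite mul1r; exact: rate_le.
rewrite /q ge0_integralD//; apply: leeD => //.
under eq_integral do rewrite EFinM muleC.
rewrite ge0_integralZl_EFin//; last 2 first.
- by move=> r _; rewrite lee_fin window_ge0.
- by apply/measurable_EFinP; exact: measurable_window_r.
by rewrite EFinM lee_wpmul2l ?lee_fin//; exact: window_int_r.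
Qed.

(** * The averaged energy inequality *)

Definition energy t := \int[I]_x (w x * u t x ^+ 2).

Let integ_wu2 : integ m (fun z => w z.2 * u z.1 z.2 ^+ 2).
Proof.
have [M M0 wM] := test_function_bounded tw.
apply: (integ_dom _ (integZ M (integD (icst 1) iu))) => [|z].
  by apply: measurable_funM => //; exact: measurable_funX.
rewrite normrM normrX ler_pM ?exprn_ge0//; apply: exprn_le1D.
by rewrite addn2.
Qed.

Lemma integ_energy_density t : good t -> integ I (fun x => w x * u t x ^+ 2).
Proof.
move=> [_ _ ip _]; have [M M0 wM] := test_function_bounded tw.
apply: (integ_dom _ (integZ M (integD (I_icst 1) ip))) => [|x].
  by apply: measurable_funM => //; apply: measurable_funX; exact: sec.
rewrite normrM normrX ler_pM ?exprn_ge0//; apply: exprn_le1D.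
by rewrite addn2.
Qed.

Lemma integ_energy : integ nu energy.
Proof. exact: (integ_fubini integ_wu2). Qed.

Lemma energy_ge0 t : 0 <= energy t.
Proof.
by apply: Rintegral_ge0 => x _; rewrite mulr_ge0 ?sqr_ge0.
Qed.

Let vmomentE s t : good s -> good t ->
  vmoment t s = \int[I]_x (u s x * test2 (t, x)).
Proof.
move=> [/andP[s0 sT] _ _ e] gt; have [/L2_measurable mt _ _ _] := H10_test gt.
have /v_L2/L2_measurable mv : 0 <= s <= T by rewrite (ltW s0) (ltW sT).
apply: ae_eq_Rintegral; [exact: measurable_funM|by apply: measurable_funM mt; exact: sec|].
by apply: ae_imp e => x ->.
Qed.

Lemma vmoment_diagonal t : good t -> vmoment t t = energy t.
Proof.
move=> gt; rewrite vmomentE//; apply: eq_Rintegral => x _.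
by rewrite /test2 /=; ring.
Qed.

(** Polarization: [2 u(s) u(t) <= u(s)^2 + u(t)^2], weighted by [w >= 0]. *)
Lemma vmoment_le s t : good s -> good t ->
  vmoment t s <= energy s / 2 + energy t / 2.
Proof.
move=> gs gt; have is_ := integ_energy_density gs; have it := integ_energy_density gt.
rewrite vmomentE// [energy s / 2]mulrC [energy t / 2]mulrC.
rewrite -RintegralZl// -RintegralZl// -RintegralD//; try exact: integZ.
apply: ae_le_Rintegral; last first.
- apply: aeW => x; rewrite /test2 /=.
  have := sqr_ge0 (u s x - u t x); have := w0 x.
  by move: (w x) (u s x) (u t x) => a b c; nra.
- by apply: integD; exact: integZ.
have [us _ _ _] : H10 (u s) (ux s) by case: gs.
have [ht _ _ _] := H10_test gt.
exact: (L2M us ht).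
Qed.

(** The moment against [w u(t)] goes from at most [(E(s) + E(t)) / 2] at time [s] to exactly [E(t)]
    at time [t], so half of [E(t) - E(s)] is bounded by the increment. *)
Lemma energy_le h s t : good s -> good t -> s < t -> 0 <= h -> t - h <= s ->
  ((energy t / 2)%:E <= (energy s / 2)%:E + ((C * h)%:E + total_defect h t))%E.
Proof.
move=> gs gt st h0 ths; have [/andP[s0 _] _ _ _] := gs.
apply: le_trans (leeD (lexx _) (increment_le gt h0 ths)).
rewrite -(vmoment_increment gt s0 st) -EFinD lee_fin vmoment_diagonal//.
by have := vmoment_le gs gt; lra.
Qed.

Lemma energy_le0 h t : good t -> 0 <= h -> t <= h ->
  ((energy t / 2)%:E <= (C * h)%:E + total_defect h t)%E.
Proof.
move=> gt h0 th; have th0 : t - h <= 0 by rewrite subr_le0.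
apply: le_trans (increment_le gt h0 th0).
rewrite -(vmoment_increment0 gt) lee_fin vmoment_diagonal//.
by have := energy_ge0 t; lra.
Qed.

Let total_defect_ge0 h t : (0 <= total_defect h t)%E.
Proof. by apply: integral_ge0 => r _; apply: integral_ge0 => x _. Qed.

(** Averages [energy_le] over the [s] in the window. If [t <= h], the window reaches below 0 and
    [energy_le0] is used instead, so that no initial energy appears. *)
Lemma energy_average h t : good t -> 0 < h ->
  ((h * (energy t / 2))%:E <=
   \int[nu]_s (window h t s * (energy s / 2))%:E +
   h%:E * ((C * h)%:E + total_defect h t))%E.
Proof.
move=> gt h0; have [/andP[t0 tT] _ _ _] := gt.
have P0 : (0 <= \int[nu]_s (window h t s * (energy s / 2))%:E)%E.
  apply: integral_ge0 => s _.
  by rewrite lee_fin mulr_ge0 ?window_ge0// divr_ge0// energy_ge0.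
have D0 : (0 <= (C * h)%:E + total_defect h t)%E.
  by rewrite adde_ge0// lee_fin mulr_ge0// (ltW h0).
have [th|ht] := leP t h.
  apply: le_trans (leeDr _ P0); rewrite EFinM lee_pmul2l ?lte_fin//.
  by apply: energy_le0 => //; exact: ltW.
(* If the defect is infinite, so is the right-hand side; otherwise it is replaced by a real number
   [k]. *)
have [->|Dfin] := eqVneq ((C * h)%:E + total_defect h t)%E +oo%E.
  by rewrite gt0_muley ?lte_fin// addey ?leey// gt_eqF// (lt_le_trans _ P0)// ltNy0.
set D := ((C * h)%:E + total_defect h t)%E in D0 Dfin *.
have {Dfin} : D = (fine D)%:E by rewrite fineK// ge0_fin_numE// ltey.
move: (fine D) => k Dk; rewrite Dk in D0 *; rewrite lee_fin in D0.
have k0 s : (0 <= (window h t s * k)%:E)%E.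
  by rewrite lee_fin mulr_ge0 ?window_ge0.
have mwin c : measurable_fun setT (fun s => (window h t s * c)%:E).
  by apply/measurable_EFinP; apply: measurable_funM => //; exact: measurable_window_r.
have int_win c : 0 <= c -> (\int[nu]_s (window h t s * c)%:E = h%:E * c%:E)%E.
  move=> c0; rewrite -(window_full (ltW h0) (ltW ht) tT) muleC.
  under eq_integral do rewrite EFinM muleC.
  rewrite ge0_integralZl_EFin//; last by apply/measurable_EFinP; exact: measurable_window_r.
  by move=> s _; rewrite lee_fin window_ge0.
have e0 : 0 <= energy t / 2 by rewrite divr_ge0// energy_ge0.
have me : measurable_fun setT (fun s => (window h t s * (energy s / 2))%:E).
  apply/measurable_EFinP; apply: measurable_funM; first exact: measurable_window_r.
  by apply: measurable_funM => //; exact: integ_measurable integ_energy.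
have E0 s : (0 <= (window h t s * (energy s / 2))%:E)%E.
  by rewrite lee_fin mulr_ge0 ?window_ge0// divr_ge0// energy_ge0.
rewrite -(int_win _ D0) EFinM -(int_win _ e0) -ge0_integralD//; last exact: mwin.
apply: (ae_ge0_le_integral measurableT).
- by move=> s _; rewrite lee_fin mulr_ge0 ?window_ge0.
- exact: mwin.
- by move=> s _; apply: adde_ge0; [exact: E0|exact: k0].
- exact: emeasurable_funD me (mwin k).
apply: ae_imp ae_good => s gs _.
have [->|/window_in/andP[ts st]] := eqVneq (window h t s) 0.
  by rewrite !mul0r adde0.
rewrite -EFinD lee_fin -mulrDr ler_wpM2l ?window_ge0//.
have [->|st'] := eqVneq s t; first by rewrite lerDl.
have {}st : s < t by rewrite lt_neqAle st'.
have := energy_le gs gt st (ltW h0) (ltW ts).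
by rewrite -/D Dk -EFinD lee_fin.
Qed.
Lemma measurable_total_defect h : measurable_fun setT (total_defect h).
Proof.
have g0 (z : R * R * R) : (0 <= (window h z.1.1 z.1.2 * defect z)%:E)%E.
  by rewrite lee_fin mulr_ge0 ?window_ge0 ?defect_ge0.
have m1 := @measurable_fun_fubini_tonelli_F _ _ _ _ _ I _ (mwd h) g0.
apply: (@measurable_fun_fubini_tonelli_F _ _ _ _ _ nu _ m1) => z.
by apply: integral_ge0 => x _.
Qed.

Let integ_test1_sq : integ m (fun z => `|test1 z| ^+ 2).
Proof.
have [M M0 wM] := test_function_bounded tw.
have [M' M'0 dwM] := test_function_derive_bounded tw.
apply: (integ_dom _ (integD (integZ (2 * M' ^+ 2) (integD (icst 1) iu))
  (integZ (2 * M ^+ 2) iux))) => [|z].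
  by apply: measurable_funX; apply: measurableT_comp => //; exact: measurable_test1.
have h1 : (derive1 w z.2 * u z.1 z.2) ^+ 2 <= M' ^+ 2 * (1 + `|u z.1 z.2| ^+ p).
  rewrite exprMn -real_normK ?num_real// -[X in _ * X]real_normK ?num_real//.
  rewrite ler_pM ?exprn_ge0//; first by rewrite lerXn2r ?nnegrE.
  by apply: exprn_le1D; rewrite addn2.
have h2 : (w z.2 * ux z.1 z.2) ^+ 2 <= M ^+ 2 * ux z.1 z.2 ^+ 2.
  rewrite exprMn ler_wpM2r ?sqr_ge0// -real_normK ?num_real//.
  by rewrite lerXn2r ?nnegrE.
rewrite normrX normr_id real_normK ?num_real// /test1.
move: h1 h2; set a := derive1 w _ * _; set b := w _ * _.
by have := sqr_ge0 (a - b); nra.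
Qed.

Let integ_test2_pow : integ m (fun z => `|test2 z| ^+ p).
Proof.
have [M M0 wM] := test_function_bounded tw.
apply: (integ_dom _ (integZ (M ^+ p) iu)) => [|z].
  by apply: measurable_funX; apply: measurableT_comp => //; exact: measurable_test2.
rewrite normrX normr_id normrM exprMn ler_wpM2r ?exprn_ge0//.
by rewrite lerXn2r ?nnegrE.
Qed.

(** [translation_pairing] is applied twice with tolerance 1/2: at exponent 2 to [flux1] with weight
    [ux^2], and at exponent [2 delta + 2] to [flux2] with weight [dominant]. *)
Lemma total_defect_small : \forall n \near \oo,
  (\int[nu]_t total_defect n.+1%:R^-1 t <= (n.+1%:R^-1)%:E)%E.
Proof.
have h2 : 0 < 2^-1 :> R by rewrite invr_gt0.
have t1 := @translation_pairing R _ _ T I T0 flux1 test1 (fun z => ux z.1 z.2 ^+ 2) 2 2^-1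
  isT measurable_flux1 measurable_test1 (fun z => sqr_ge0 _) iux integ_test1_sq.
have t2 := @translation_pairing R _ _ T I T0 flux2 test2 dominant p 2^-1.
have {}t1 := t1 _ h2.
have {}t1 := t1 ltac:(by move=> a /young_sq[K K0 hK]; exists K => // z b;
  rewrite -[X in _ <= _ * X + _]sqrrN; exact: hK).
have {}t2 := t2 ltac:(by rewrite addn2) measurable_flux2 measurable_test2.
have {}t2 := t2 ltac:(by move=> z; rewrite /dominant !addr_ge0 ?sqr_ge0// exprn_ge0)
  iD integ_test2_pow.
have {}t2 := t2 ltac:(by move=> a /flux_bound[K K0 hK]; exists K => // z b; exact: hK) h2.
apply: filterS2 t1 t2 => n; set h := n.+1%:R^-1 => s1 s2.
have g0 (z : R * R * R) : (0 <= (window h z.1.1 z.1.2 * defect z)%:E)%E.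
  by rewrite lee_fin mulr_ge0 ?window_ge0 ?defect_ge0.
rewrite -(prod3_trx nu nu I (mwd h) g0).
have -> : h%:E = ((2^-1 * h)%:E + (2^-1 * h)%:E)%E.
  by rewrite -EFinD; congr EFin; move: h {s1 s2 g0} => h; lra.
apply: le_trans (leeD s1 s2); rewrite -ge0_integralD//; last 4 first.
- by move=> z _; rewrite lee_fin mulr_ge0 ?window_ge0// mulr_ge0.
- exact: measurable_window3 measurable_defect1.
- by move=> z _; rewrite lee_fin mulr_ge0 ?window_ge0// mulr_ge0.
- exact: measurable_window3 measurable_defect2.
by rewrite le_eqVlt; apply/orP; left; apply/eqP/eq_integral => z _; rewrite -EFinD -mulrDr.
Qed.

(** After integration of [energy_average] over [t], the term [h int E/2] occurs on both sides and
    cancels. What remains is the deficit of [window_int2_tail], so [h/4] times the tail integral is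
    at most [h (C h T + h)]. *)
Lemma energy_tail h : 0 < h -> (\int[nu]_t total_defect h t <= h%:E)%E ->
  \int[nu]_t (energy t * \1_(`]T - h / 2, T[%classic) t) <= 4 * (C * T + 1) * h.
Proof.
move=> h0 hd; have ie := integ_energy.
have ij : integ nu (fun t => energy t * \1_(`]T - h / 2, T[%classic) t) by exact: integ_indicM.
have i2 : integ nu (fun t => energy t / 2).
  by under eq_fun do rewrite mulrC; exact: integZ.
have e0 t : 0 <= energy t / 2 by rewrite divr_ge0// energy_ge0.
have tail := window_int2_tail (ltW h0) i2 e0.
pose P t := (\int[nu]_s (window h t s * (energy s / 2))%:E)%E.
pose Q t := (h%:E * ((C * h)%:E + total_defect h t))%E.
have P0 t : (0 <= P t)%E.
  by apply: integral_ge0 => s _; rewrite lee_fin mulr_ge0 ?window_ge0.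
have D0 t : (0 <= (C * h)%:E + total_defect h t)%E.
  by rewrite adde_ge0// lee_fin mulr_ge0// (ltW h0).
have Q0 t : (0 <= Q t)%E by rewrite mule_ge0// lee_fin (ltW h0).
have mD : measurable_fun setT (fun t => (C * h)%:E + total_defect h t)%E.
  by apply: emeasurable_funD => //; exact: measurable_total_defect.
have mQ : measurable_fun setT Q by exact: measurable_funeM.
have mP : measurable_fun setT P.
  have me : measurable_fun setT (fun s => energy s / 2) by exact: integ_measurable i2.
  have mf : measurable_fun setT (fun z : R * R => (window h z.1 z.2 * (energy z.2 / 2))%:E).
    apply: (@measurable_windowM _ h (fun z => energy z.2 / 2)).
    exact: (measurableT_comp me measurable_snd).
  apply: (@measurable_fun_fubini_tonelli_F _ _ _ _ _ nu _ mf) => z.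
  by rewrite lee_fin mulr_ge0 ?window_ge0.
have iL : integ nu (fun t => h * (energy t / 2)) by exact: integZ.
have le1 : ((\int[nu]_t (h * (energy t / 2)))%:E <= \int[nu]_t P t + \int[nu]_t Q t)%E.
  rewrite -ge0_integralD//; apply: Rintegral_le_integral => //.
  - exact: emeasurable_funD.
  - by move=> t; exact: adde_ge0.
  - by apply: ae_imp ae_good => t gt; exact: energy_average.
have le2 : (\int[nu]_t Q t <= (h * (C * h * T + h))%:E)%E.
  rewrite /Q ge0_integralZl//; last by rewrite lee_fin (ltW h0).
  rewrite [leRHS]EFinM lee_wpmul2l ?lee_fin ?(ltW h0)//.
  rewrite ge0_integralD//; last 2 first.
  - by move=> t _; rewrite lee_fin mulr_ge0// (ltW h0).
  - exact: measurable_total_defect.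
  have -> : (\int[nu]_t (C * h)%:E)%E = (C * h * T)%:E.
    by rewrite integral_cst// [RHS]EFinM; congr (_ * _)%E; exact: leb_setT.
  by rewrite EFinD leeD.
have := le_trans le1 (leeD tail le2).
rewrite -EFinD lee_fin RintegralB//; last by apply: integZ; exact: integ_indicM.
rewrite !RintegralZl//; last exact: integ_indicM.
have -> : \int[nu]_t (energy t / 2 * \1_(`]T - h / 2, T[%classic) t) =
    2^-1 * \int[nu]_t (energy t * \1_(`]T - h / 2, T[%classic) t).
  by rewrite -RintegralZl//; apply: eq_Rintegral => t _; ring.
move: (\int[nu]_t (energy t / 2))
  (\int[nu]_t (energy t * \1_(`]T - h / 2, T[%classic) t)) => a b le3.
have {le3} : h * (b / 4) <= h * (C * h * T + h) by nra.
by rewrite ler_pM2l//; nra.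
Qed.

(** * Bound on the weighted mean at the final time *)

Let g t := \int[I]_x (v t x * w x).

(** Just before [T] the moment is at least its final value minus 1, and [u <= (1 + u^2) / 2] bounds
    it by half of [int w + E]. Averaging over the last [h/2] and using [energy_tail] gives the
    constant [4 (C T + 1)]. *)
Lemma final_moment_le :
  \int[I]_x (v T x * w x) <= 1 + (\int[I]_x w x) / 2 + 4 * (C * T + 1).
Proof.
have Lw := test_function_L2 tw.
have iw : integ I w.
  by have := L2M Lw (L2_cst 1); under eq_fun do rewrite mulr1.
have [_ cv _] := hv.
have /(continuous_within_itvP _ T0)[_ _ gT] : {within `[0, T], continuous g} by exact: cv.
have [d /= d0 hd] : \forall t \near T^'-, g T - 1 < g t.
  by apply: (cvgr_gt _ gT); rewrite ltrBlDr ltrDl.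
(* [h < d] keeps the last half window where weak continuity is effective, and [h < T] keeps it
   inside [(0, T)]. *)
have m0 : 0 < Num.min d T by rewrite lt_min d0.
have hn := near_infty_natSinv_lt (PosNum m0).
have [n [{}hn dn]] : exists n : nat, n.+1%:R^-1 < Num.min d T /\
    (\int[nu]_t total_defect n.+1%:R^-1 t <= (n.+1%:R^-1)%:E)%E.
  exact: (filter_ex (filterI hn total_defect_small)).
set h := n.+1%:R^-1 in hn dn.
have h0 : 0 < h by rewrite invr_gt0.
have tail := energy_tail h0 dn.
move: hn; rewrite lt_min => /andP[hltd hltT].
set J := `]T - h / 2, T[%classic in tail.
have mJ : measurable (J : set (measurableTypeR R)) by exact: measurable_itv.
have iJ (k : R) : integ nu (fun t => k * \1_J t).
  by apply: integ_indicM => //; exact: finite_measure_integrable_cst.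
have left (t : R) : T - h / 2 < t -> t < T -> g T - 1 <= g t.
  by move=> t1 t2; apply/ltW/hd => //=; rewrite ger0_norm; lra.
have muJ : leb 0 T J = (h / 2)%:E.
  rewrite lebE (_ : J `&` _ = J); last first.
    apply/setIidPl => t; rewrite /J /= !in_itv /= => /andP[t1 ->]; rewrite andbT.
    by apply: lt_trans t1; lra.
  rewrite /J lebesgue_measure_itv /= lte_fin ifT; last by lra.
  by rewrite -EFinB; congr EFin; lra.
have intJ : \int[nu]_t \1_J t = h / 2.
  rewrite /Rintegral integral_indic// setIT.
  by transitivity (fine (h / 2)%:E) => //; congr fine; exact: muJ.
have : \int[nu]_t ((g T - 1) * \1_J t) <=
    \int[nu]_t (2^-1 * ((\int[I]_x w x) * \1_J t + energy t * \1_J t)).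
  apply: ae_le_Rintegral => //.
    apply: integZ; apply: integD => //; apply: integ_indicM => //; exact: integ_energy.
  apply: ae_imp ae_good => t gt; rewrite indicE.
  have [/set_mem|_] := boolP (t \in J); last by rewrite !mulr0 addr0 mulr0.
  rewrite /J /= in_itv /= => /andP[t1 t2]; rewrite !mulr1.
  apply: (@le_trans _ _ (g t)).
    exact: left.
  have [/andP[t0 _] [Lu _ _ _] _ e] := gt.
  have iwu := integ_energy_density gt.
  have /v_L2/L2_measurable mv : 0 <= t <= T by rewrite (ltW t0) (ltW t2).
  have -> : g t = \int[I]_x (u t x * w x).
    apply: ae_eq_Rintegral; [exact: measurable_funM| |].
      exact: measurable_funM (L2_measurable Lu) mw.
    by apply: ae_imp e => x ->.
  rewrite /energy -RintegralD// -RintegralZl//; last exact: integD.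
  apply: ae_le_Rintegral; last first.
  - apply: aeW => x; have := sqr_ge0 (u t x - 1); have := w0 x.
    by move: (w x) (u t x) => a b; nra.
  - by apply: integZ; exact: integD.
  - exact: L2M.
have ie := integ_indicM mJ integ_energy.
rewrite RintegralZl//; last by have := iJ 1; under eq_fun do rewrite mul1r.
rewrite RintegralZl//; last exact: integD.
rewrite RintegralD// RintegralZl//; last by have := iJ 1; under eq_fun do rewrite mul1r.
rewrite intJ -/(g T).
move: tail; move: (\int[nu]_t (energy t * \1_J t)) (\int[I]_x w x) (g T) => a b c' t1 t2.
have : (h / 2) * (c' - 1) <= (h / 2) * (b / 2 + 4 * (C * T + 1)) by nra.
by rewrite ler_pM2l ?divr_gt0//; lra.
Qed.

End weak_solutions.

(** * Choice of the weight and of an unreachable target *)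

Lemma Rintegral_leb_gt0 (R : realType) (q : R -> R) (a b : R) :
  0 < a -> a < b -> b < 1 ->
  (leb (0 : R) 1).-integrable setT (EFin \o q) -> (forall x, 0 <= q x) ->
  (forall x, a < x < b -> 0 < q x) -> 0 < \int[leb (0 : R) 1]_x q x.
Proof.
move=> a0 ab b1 iq q0 qab; rewrite lt_neqAle Rintegral_ge0// andbT.
apply/eqP => e.
have mq := measurable_int _ iq.
have : (\int[leb (0 : R) 1]_x `|(EFin \o q) x| = 0)%E.
  under eq_integral do rewrite gee0_abs ?lee_fin//.
  by rewrite (integ_integral iq) -e.
move=> q_eq0; have [A [mA A0 hA]] : ae_eq (leb 0 1) setT (EFin \o q) (cst 0%E).
  exact: (ae_eq_integral_abs _ measurableT mq).1 q_eq0.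
have : (leb 0 1 `]a, b[%classic <= leb 0 1 A)%E.
  apply: le_measure; rewrite ?inE//=.
  move=> x xab; apply: hA => /= /(_ I)[] qx.
  by have := qab x; rewrite qx ltxx => /(_ xab).
rewrite A0 lebE (setIidl (_ : `]a, b[%classic `<=` `]0, 1[%classic)); last first.
  move=> x; rewrite /= !in_itv /= => /andP[ax xb].
  by rewrite (lt_trans a0 ax) (lt_trans xb b1).
by rewrite lebesgue_measure_itv /= lte_fin ab -EFinB lee_fin subr_le0 leNgt ab.
Qed.

Theorem theorem1p2 (R : realType) (alpha beta gamma : R) (delta : nat)
  (b c T : R) (halpha : 0 < alpha) (hbeta : 0 < beta) (hgamma : 0 < gamma)
  (hdelta : (1 <= delta)%N) (hb : 0 < b) (hbc : b < c) (hc : c < 1)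
  (hT : 0 < T) :
  ~ approximately_controllable alpha beta gamma delta `]b, c[ T.
Proof.
move=> controllable.
(* The support [[b/3, b/2]] lies inside [(0, b)], away from both the boundary and the control
   region. *)
pose p := (2 * delta + 2)%N; pose psi := bump (b / 3) (b / 2).
have psi_in x : psi x != 0 -> b / 3 <= x <= b / 2 by exact: bump_neq0.
have tpsi : test_function 0 1 psi.
  by apply: (@test_functionI _ 0 1 (b / 3) (b / 2)) => //; [exact: smooth_bump|lra|lra].
have [L L0 psiL] := test_function_derive_bounded tpsi.
have [C C0 hC] := energy_dissipation halpha hbeta hgamma hdelta L0.
pose w x := psi x ^+ p.
have tw : test_function 0 1 w.
  apply: (@test_functionI _ 0 1 (b / 3) (b / 2)); [|lra|lra|].
    by apply: smoothX; exact: smooth_bump.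
  by move=> x; rewrite expf_eq0 negb_and => /orP[|]; [rewrite /p addn2|exact: psi_in].
have w0 x : 0 <= w x by rewrite exprn_ge0// bump_ge0.
have womega x : `]b, c[%classic x -> w x = 0.
  rewrite /= in_itv /= => /andP[bx _]; apply/eqP; apply: contraT.
  by rewrite expf_eq0 negb_and => /orP[|/psi_in/andP[_ ?]]; [rewrite /p addn2|lra].
have dw x : derive1 w x = p%:R * (psi x ^+ p.-1 * derive1 psi x).
  by rewrite /w /p addn2 derive1X//; exact: smooth_bump.
have dissipation x a d :
    - d * (derive1 w x * a + w x * d)
    + alpha / (delta.+2)%:R * (derive1 w x * a ^+ delta.+2)
    + beta * (a * (1 - a ^+ delta) * (a ^+ delta - gamma)) * (w x * a) <= C.
  by rewrite dw; apply: hC => //; rewrite bump_ge0 bump_le1.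
have Lw := test_function_L2 tw.
have iw : (leb (0 : R) 1).-integrable setT (EFin \o w).
  by have := L2M Lw (L2_cst 1); under eq_fun do rewrite mulr1.
pose W := \int[leb (0 : R) 1]_x w x.
have W0 : 0 < W.
  apply: (@Rintegral_leb_gt0 _ _ (b / 3) (b / 2)) => //; [lra|lra|lra|].
  by move=> x xb; rewrite exprn_gt0// bump_gt0.
pose S := \int[leb (0 : R) 1]_x (w x ^+ 2).
(* If [v T] is within 1 of the constant [k], then [W * k] is at most the final moment, bounded by
   [1 + W / 2 + 4 * (C * T + 1)], plus the pairing error, bounded by [S + 1]. The constant [k] makes
   [W * k] exceed this sum by 1, and [C] was fixed before the control is chosen. *)
pose k := (S + 1 + (1 + W / 2 + 4 * (C * T + 1)) + 1) / W.
have [f _ [u [v [sol]]]] := controllable (fun=> 0) (fun=> k) (L2_cst 0) (L2_cst k) 1 ltr01.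
have [ux [ut [[_ [_ hux hH] hu] [htd [hut _ _]] hweak hv hv0]]] := sol.
have LvT : L2 (v T) by case: hv => + _ _; apply; rewrite lexx (ltW hT).
have Lvk : L2 (fun x => v T x - k) by apply: L2B => //; exact: L2_cst.
move=> /(L2norm_le (L2_sq Lvk) ler01) close.
have := L2M_le ltr01 Lw Lvk close.
have hu' : LqLp T (p%:R)%:E (p%:R)%:E u.
  by move: hu; rewrite /p natrD natrM mulrDr mulr1.
have hv0' phi dphi : H10 phi dphi ->
    \int[leb (0 : R) 1]_x (v t x * phi x) @[t --> 0^'+] --> (0 : R).
  move=> /hv0; rewrite (_ : (fun x => 0 * phi x) = fun=> 0).
    by rewrite Rintegral_cst// mul0r.
  by apply/funext => x; rewrite mul0r.
have := final_moment_le halpha hbeta hgamma hdelta hT hu' hux hH htd hut hweak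
  hv hv0' tw w0 womega C0 dissipation.
have i1 := L2M LvT Lw; have i2 := L2M Lw Lvk.
have pointwise (a y : R) : k * a <= y * a + `|a * (y - k)|.
  by have := ler_norm (- (a * (y - k))); rewrite normrN; lra.
have : W * k <= \int[leb (0 : R) 1]_x (v T x * w x) +
                \int[leb (0 : R) 1]_x `|w x * (v T x - k)|.
  rewrite /W mulrC -RintegralZl// -RintegralD//; last exact: integ_norm.
  apply: ae_le_Rintegral; [exact: integZ|by apply: integD => //; exact: integ_norm|].
  by apply: aeW => x; exact: pointwise.
rewrite mul1r -/S -/W {1}/k mulrC divfK ?gt_eqF//; lra.
Qed.
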